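(* Let $\mathbb{F}$ be an algebraically closed field of characteristic $p>0$ and let $n=p$. Let $\lambda$ be a partition of $n$ with $\lambda\neq(1^n)$. (1) If $\lambda\neq(k,1^{n-k})$ for every $k$, then $D^\lambda$ is isomorphic to the $\mathbb{F}\mathfrak{S}_n$-module with basis $\{v_T: T\in\operatorname{Std}(\lambda)\}$ on which, for $1\leq i\leq n-1$, \[s_iv_T=\begin{cases}\rho_i(T)v_T+\sqrt{1-\rho_i(T)^2}\,v_{s_iT}, & \text{if } s_iT\in\operatorname{Std}(\lambda),\\ \rho_i(T)v_T, & \text{otherwise};\end{cases}\] moreover $\dim D^\lambda=\dfrac{n!}{\prod_{(i,j)\in\lambda}h_\lambda(i,j)}$. (2) If $\lambda=(k,1^{n-k})$ with $k\geq 2$, put $\lambda^-=(k-1,1^{n-k})$. Then $D^\lambda$ is isomorphic to the $\mathbb{F}\mathfrak{S}_n$-module with basis $\{v_T:T\in\operatorname{Std}(\lambda^-)\}$ on which, for $1\leq i\leq n-2$, \[s_iv_T=\begin{cases}\rho_i(T)v_T+\sqrt{1-\rho_i(T)^2}\,v_{s_iT}, & \text{if } s_iT\in\operatorname{Std}(\lambda^-),\\ \rho_i(T)v_T, & \text{otherwise},\end{cases}\] and $s_{n-1}v_T=v_T$ if $T_{(1,k-1)}=n-1$, $s_{n-1}v_T=-v_T$ if $T_{(n-k+1,1)}=n-1$; moreover $\dim D^\lambda=\binom{n-2}{k-2}$. (3) The set $\{D^\lambda:\lambda \text{ a partition of } n,\ \lambda\neq(1^n)\}$ is a complete set of pairwise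 non-isomorphic irreducible $\mathbb{F}\mathfrak{S}_n$-modules.
   Context: $\mathfrak{S}_n$ is generated by the simple transpositions $s_i=(i,i+1)$. For a partition $\lambda$ of $n$, $S^\lambda$ is the Specht module over $\mathbb{F}$, which carries a symmetric $\mathfrak{S}_n$-invariant bilinear form with radical $\operatorname{Rad}^\lambda$ (James' construction), and $D^\lambda=S^\lambda/\operatorname{Rad}^\lambda$. Young diagrams: $\lambda=\{(i,j):1\leq i\leq\ell(\lambda),1\leq j\leq\lambda_i\}$; hook length $h_\lambda(i,j)=\lambda_i+\lambda'_j-i-j+1$ with $\lambda'$ the conjugate partition. $\operatorname{Std}(\mu)$ is the set of standard tableaux of shape $\mu$ (entries $1,\dots,|\mu|$ increasing along rows and down columns), $T_{(i,j)}$ is the entry in node $(i,j)$, $T(a)$ is the node containing $a$, and $s_iT$ is the tableau obtained from $T$ by interchanging the entries $i$ and $i+1$. The residue of a node $(i,j)$ is $\operatorname{res}(i,j)=j-i \bmod p\in\mathbb{F}$, and $\rho_i(T)=\big(\operatorname{res}(T(i+1))-\operatorname{res}(T(i))\big)^{-1}$ (computed in the shape of $T$). $\sqrt{\cdot}$ denotes a chosen square root in $\mathbb{F}$. $(k,1^{n-k})$ is the partition $(k,1,\dots,1)$ with $n-k$ ones. *)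

(* Defs.v *)
From HB Require Import structures.
From mathcomp Require Import all_boot all_order all_algebra all_fingroup.
From mathcomp Require Import mxrepresentation.
Set Implicit Arguments.
Unset Strict Implicit.
Unset Printing Implicit Defensive.
Import GRing.Theory.
Local Open Scope ring_scope.

Definition is_part (n : nat) (la : seq nat) : bool :=
  [&& sorted geq la, all (fun x => 0 < x)%N la & sumn la == n].

Definition conjp (la : seq nat) (j : nat) : nat := count (fun x => j < x)%N la.

(* hook length of the node (i,j) (0-based indices):
   h(i+1,j+1) = la_{i+1} + la'_{j+1} - (i+1) - (j+1) + 1 *)
Definition hook (la : seq nat) (i j : nat) : nat :=
  (nth 0 la i + conjp la j - (i + j).+1)%N.

Definition hook_prod (la : seq nat) : nat :=
  (\prod_(i < size la) \prod_(j < nth 0 la i) hook la i j)%N.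

(* Simple transposition s_i = (i, i+1) (1-based i) in 'S_n.           *)
Definition sgen (n i : nat) : 'S_n :=
  match n return 'S_n with
  | 0 => 1%g
  | n'.+1 => tperm (inord i.-1 : 'I_n'.+1) (inord i)
  end.

(* Tableaux with entries 1..m (stored 0-based as 'I_m): a tableau maps  *)
(* each entry a to the node (row, column) containing it (0-based).      *)
Definition tab (m : nat) := {ffun 'I_m -> 'I_m * 'I_m}.

(* T is a tableau of shape la (la a partition of m): T is a bijection   *)
(* from entries onto the Young diagram of la.                           *)
Definition is_tab m (la : seq nat) (T : tab m) : bool :=
  injectiveb T && [forall a, ((T a).2 < nth 0 la (T a).1)%N].

Definition is_std m (la : seq nat) (T : tab m) : bool :=
  [&& is_tab la T,
      [forall a, forall b,
         (((T a).1 == (T b).1) && ((T a).2 < (T b).2)%N) ==> (a < b)%N] &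
      [forall a, forall b,
         (((T a).2 == (T b).2) && ((T a).1 < (T b).1)%N) ==> (a < b)%N]].

Definition Std m (la : seq nat) : {set tab m} := [set T | is_std la T].

(* node T(k) of the (1-based) entry k, as a pair of 0-based nats *)
Definition nodeof m (T : tab m) (k : nat) : nat * nat :=
  match m return tab m -> nat * nat with
  | 0 => fun _ => (0, 0)%N
  | m'.+1 => fun T => let x := T (inord k.-1) in (val x.1, val x.2)
  end T.

Definition stab m (i : nat) (T : tab m) : tab m := [ffun a => T (sgen m i a)].

Section Field.
Variable F : fieldType.

Definition res (x : nat * nat) : F := ((Posz x.2 - Posz x.1)%R)%:~R.

Definition rhoi m (T : tab m) (i : nat) : F :=
  (res (nodeof T i.+1) - res (nodeof T i))^-1.

(* matrix of s_i in the basis {v_T : T in Std(la)} (row-vector convention: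
   row T is the image of v_T); sq is the chosen square-root function *)
Definition snf_mx (sq : F -> F) m (la : seq nat) (i : nat)
  : 'M[F]_#|Std m la| :=
  \matrix_(j, k)
    (let T := enum_val j in let U := enum_val k in
     if U == T then rhoi T i
     else if U == stab i T then sq (1 - rhoi T i ^+ 2) else 0).
End Field.

(* Ambient permutation module: F[X] where X = {ffun 'I_n -> 'I_n}       *)
(* (maps entry -> row).  The tabloids of shape la are exactly the f in X *)
(* with #f^-1(r) = la_r, so M^la is the span of these basis vectors.     *)
Section Perm.
Variable n : nat.
Definition fX := {ffun 'I_n -> 'I_n}.

Definition funact (f : fX) (s : 'S_n) : fX := [ffun a => f ((s^-1)%g a)].

Lemma funact1 f : funact f 1%g = f.
Proof. by apply/ffunP=> a; rewrite ffunE invg1 perm1. Qed.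

Lemma funactM f s t : funact f (s * t)%g = funact (funact f s) t.
Proof. by apply/ffunP=> a; rewrite !ffunE invMg permM. Qed.

Lemma funact_inj s : injective (funact^~ s).
Proof.
move=> f g /(congr1 (funact^~ (s^-1)%g)); rewrite -!funactM mulgV !funact1 //.
Qed.

Definition rperm_fun (s : 'S_n) (i : 'I_#|fX|) : 'I_#|fX| :=
  enum_rank (funact (enum_val i) s).

Lemma rperm_inj s : injective (rperm_fun s).
Proof.
move=> i j /enum_rank_inj /funact_inj /enum_val_inj //.
Qed.

Definition rperm (s : 'S_n) : 'S_#|fX| := perm (@rperm_inj s).

Lemma rperm1 : rperm 1%g = 1%g.
Proof. by apply/permP=> i; rewrite permE perm1 /rperm_fun funact1 enum_valK. Qed.

Lemma rpermM s t : rperm (s * t)%g = (rperm s * rperm t)%g.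
Proof.
by apply/permP=> i; rewrite permM !permE /rperm_fun enum_rankK funactM.
Qed.

Variable F : fieldType.

Lemma perm_module_repr :
  mx_repr [set: 'S_n] (fun s => (perm_mx (rperm s) : 'M[F]_#|fX|)).
Proof.
split; first by rewrite rperm1 perm_mx1.
by move=> s t _ _; rewrite /= rpermM perm_mxM.
Qed.

Definition rM : mx_representation F [set: 'S_n]%G #|fX| :=
  MxRepresentation perm_module_repr.

Definition tabloid (T : tab n) : fX := [ffun a => (T a).1].

Definition colgrp (T : tab n) : {set 'S_n} :=
  [set s : 'S_n | [forall a, (T (s a)).2 == (T a).2]].

Definition polytab (T : tab n) : 'rV[F]_#|fX| :=
  \sum_(s in colgrp T)
     ((-1) ^+ odd_perm s) *: delta_mx 0 (enum_rank (funact (tabloid T) s)).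

Definition tabs (la : seq nat) : {set tab n} := [set T | is_tab la T].

Definition Specht (la : seq nat) : 'M[F]_(#|tabs la|, #|fX|) :=
  \matrix_(i < #|tabs la|) polytab (enum_val i).

(* James' form: the tabloids form an orthonormal basis, i.e. the standard
   dot product <u,v> = u *m v^T.  Rad^la = S^la cap (S^la)^perp. *)
Definition SpechtSp (la : seq nat) : 'M[F]_#|fX| := <<Specht la>>%MS.
Definition SRad (la : seq nat) : 'M[F]_#|fX| :=
  (SpechtSp la :&: kermx (Specht la)^T)%MS.

(* D^la = S^la / Rad^la as a representation of 'S_n over F.  (Both are
   submodules of rM; the fallback branch is never taken.) *)
Definition Dmod (la : seq nat) : {d : nat & mx_representation F [set: 'S_n]%G d} :=
  match @idP (mxmodule rM (SRad la)), @idP (mxmodule rM (SpechtSp la)) with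
  | ReflectT mR, ReflectT mS => existT _ _ (section_repr mR mS)
  | _, _ => existT _ _ (submod_repr (mxmodule0 rM #|fX|))
  end.

Definition Ddim la := projT1 (Dmod la).
Definition Drep la : mx_representation F [set: 'S_n]%G (Ddim la) := projT2 (Dmod la).
End Perm.

(* Main.v *)
(* A weight of a representation is a joint eigenvalue of the Jucys-Murphy
   elements.  In characteristic p = n every proper Young subgroup S_k, k < n,
   has order prime to p, so the Jucys-Murphy elements are simultaneously
   diagonalisable on every irreducible module, and the Okounkov-Vershik local
   analysis shows that each weight is the residue sequence of a standard
   tableau.  Residues mod p separate standard tableaux except for the last
   node of a hook; there the two hooks (k, 1^(n-k)) and (k-1, 1^(n-k+1)) share
   the weights of (k-1, 1^(n-k)), and the arm of the larger one is taken as
   the representative.  Hence an irreducible module has one-dimensional weight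
   spaces indexed by Xstd la for a single la, and rescaling the seminormal
   basis gives the orthogonal form.  On the other side, James' submodule theorem
   makes D^mu irreducible, and the signed column sum of a mu-tableau detects
   the label: it is nonzero on D^mu, and nonzero on D^nu only when nu is
   dominated by mu; an induction along the dominance order then forces the
   label la of D^mu to be mu.  Dimensions follow from Frobenius' proof of the
   hook length formula. *)
Require Import Defs.
From HB Require Import structures.
From mathcomp Require Import all_boot all_order all_algebra all_fingroup.
From mathcomp Require Import mxrepresentation pgroup mxalgebra mxpoly.
From mathcomp Require Import zify ring lra.
Set Implicit Arguments.
Unset Strict Implicit.
Unset Printing Implicit Defensive.
Import GRing.Theory.
Local Open Scope ring_scope.

(** * Partitions and the dominance order *)

Section Partitions.
Local Open Scope nat_scope.
Implicit Types la mu : seq nat.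

(** Two points shape the argument. Diagonalisability and the classification of weights are proved
    together, by induction on [k]. Excluding equal adjacent values in a weight of [S_k] only needs
    [jm i] without Jordan blocks for [i < k - 1]. The classification then puts all weights in the
    prime field, so the weight spaces form a finite sum stable under [S_k], and Maschke makes this
    sum everything while [k < n]. Stopping at [n - 1] is just enough to classify the weights of the
    full group, where Maschke fails.

    The second point is [s_(n-1)] on hooks. There the last two entries always have axial distance 1
    or -1 modulo [p], the intertwiner composes with itself to zero, and weights alone do not force
    [s_(n-1)] to act by scalars. Where it does not, the defect is a nonzero weight vector of a
    neighbouring hook. One moves to longer first rows until all tableaux with [n - 1] in the leg
    behave, then to shorter ones until the others do. The second phase does not undo the first,
    because a defect met there is an eigenvector of [s_(n-1)] for -1, and this spreads to all leg
    tableaux of its hook. *)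

Lemma is_part_nthS n la i : is_part n la -> nth 0 la i.+1 <= nth 0 la i.
Proof.
move=> /and3P [sla _ _]; case: (ltnP i.+1 (size la)) => [lt|ge]; last first.
  by rewrite nth_default.
by move/(sortedP 0): sla; apply.
Qed.

Lemma is_part_nth_anti n la i j : is_part n la -> i <= j -> nth 0 la j <= nth 0 la i.
Proof.
move=> pla; elim: j => [|j IH]; first by rewrite leqn0 => /eqP ->.
rewrite leq_eqVlt => /predU1P [-> //|]; rewrite ltnS => /IH.
by apply: leq_trans; apply: is_part_nthS pla.
Qed.

Lemma is_part_size n la : is_part n la -> size la <= n.
Proof.
move=> /and3P [_ pos /eqP <-]; elim: la pos => //= x la IH /andP [x0 /IH].
by rewrite -[X in X < _]add0n; lia.
Qed.

Lemma sumn_nth la : sumn la = \sum_(i < size la) nth 0 la i.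
Proof. by rewrite sumnE (big_nth 0) big_mkord. Qed.

Lemma sum_nth_ge la m : size la <= m -> \sum_(i < m) nth 0 la i = sumn la.
Proof.
move=> /subnKC <-; rewrite big_split_ord /= sumn_nth [X in _ + X]big1 ?addn0 // => i _.
by rewrite nth_default // leq_addr.
Qed.

Lemma is_part_sum n la m : is_part n la -> n <= m -> \sum_(i < m) nth 0 la i = n.
Proof.
move=> pla nm; rewrite sum_nth_ge; last exact: leq_trans (is_part_size pla) nm.
by case/and3P: pla => _ _ /eqP.
Qed.

Lemma is_part_nth_le n la i : is_part n la -> nth 0 la i <= n.
Proof.
move=> pla; case: (ltnP i (size la)) => [lt|ge]; last by rewrite nth_default.
case/and3P: pla => _ _ /eqP <-.
by rewrite sumn_nth (bigD1 (Ordinal lt)) //= leq_addr.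
Qed.

Lemma is_part_nth_gt0 n la i : is_part n la -> (0 < nth 0 la i) = (i < size la).
Proof.
move=> /and3P [_ /(all_nthP 0) pos _]; case: (ltnP i (size la)) => [lt|ge]; first exact: pos.
by rewrite nth_default.
Qed.

Lemma is_part_inj n la mu : is_part n la -> is_part n mu ->
  (forall i, nth 0 la i = nth 0 mu i) -> la = mu.
Proof.
move=> pla pmu E; apply: (@eq_from_nth _ 0) => //.
have H i : (i < size la) = (i < size mu).
  by rewrite -(is_part_nth_gt0 _ pla) -(is_part_nth_gt0 _ pmu) E.
by case: (ltngtP (size la) (size mu)) => // h; [have := H (size la) | have := H (size mu)]; rewrite h ltnn.
Qed.

Definition psum la r := \sum_(i < r) nth 0 la i.
Definition dominates la mu := forall r, psum mu r <= psum la r.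

Lemma dominates_anti n la mu : is_part n la -> is_part n mu -> dominates la mu -> dominates mu la -> la = mu.
Proof.
move=> pla pmu d1 d2; apply: (is_part_inj pla pmu) => i.
have E r : psum la r = psum mu r by apply/eqP; rewrite eqn_leq d1 d2.
by move: (E i.+1) (E i); rewrite /psum !big_ord_recr /= => + e; rewrite e => /addnI.
Qed.

End Partitions.

Lemma card_ord_below n (k : nat) (le : (k <= n)%N) : #|[set i : 'I_n | (i < k)%N]| = k.
Proof.
rewrite -[RHS]card_ord -cardsT -(card_imset [set: 'I_k] (f := widen_ord le)); last first.
  by move=> a b /(congr1 val) /= e; apply: val_inj.
congr #|pred_of_set _|; apply/setP => i; rewrite inE; apply/idP/imsetP => [ik|[a _ -> /=]].
  by exists (Ordinal ik) => //; apply: val_inj.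
by rewrite ltn_ord.
Qed.

(** * Counting in columns: James' combinatorial lemma *)

Section Tableaux.
Local Open Scope nat_scope.
Variables (n : nat) (la : seq nat).
Hypothesis pla : is_part n la.
Implicit Types T : tab n.

Lemma card_tab_row T (i : 'I_n) : is_tab la T -> #|[set a | (T a).1 == i]| = nth 0 la i.
Proof.
move=> /andP [/injectiveP injT /forallP shT].
have le (j : 'I_n) : #|[set a | (T a).1 == j]| <= nth 0 la j.
  have -> : #|[set a | (T a).1 == j]| = #|[set (T a).2 | a in [set a | (T a).1 == j]]|.
    rewrite card_in_imset // => a b; rewrite !inE => /eqP ea /eqP eb e.
    by apply: injT; rewrite [T a]surjective_pairing [T b]surjective_pairing ea eb e.
  rewrite -[X in _ <= X](card_ord_below (is_part_nth_le j pla)).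
  apply: subset_leq_card; apply/subsetP => c /imsetP [a]; rewrite inE => /eqP ea ->.
  by rewrite inE -ea.
have tot : \sum_(j < n) #|[set a | (T a).1 == j]| = n.
  rewrite -[RHS]card_ord -[RHS]sum1_card [RHS](partition_big (fun a => (T a).1) xpredT) //=.
  by apply: eq_bigr => j _; rewrite -sum1_card; apply: eq_bigl => a; rewrite !inE.
apply/eqP; rewrite eqn_leq le /= leqNgt; apply/negP => lt.
have := is_part_sum pla (leqnn n); rewrite -[RHS]tot.
rewrite (bigD1 i) //= [RHS](bigD1 i) //=; apply/eqP; rewrite eqn_leq negb_and -!ltnNge.
by apply/orP; left; rewrite -addSn leq_add // leq_sum.
Qed.

Lemma tab_surj T (x y : 'I_n) : is_tab la T -> y < nth 0 la x -> exists a, T a = (x, y).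
Proof.
move=> tT; have := tT => /andP [/injectiveP injT /forallP shT] yx.
have card1 : #|[set (T a).2 | a in [set a | (T a).1 == x]]| = nth 0 la x.
  rewrite card_in_imset ?card_tab_row // => a b; rewrite !inE => /eqP ea /eqP eb e.
  by apply: injT; rewrite [T a]surjective_pairing [T b]surjective_pairing ea eb e.
have sub : [set (T a).2 | a in [set a | (T a).1 == x]] \subset [set c : 'I_n | c < nth 0 la x].
  apply/subsetP => c /imsetP [a]; rewrite inE => /eqP ea ->.
  by rewrite inE -ea.
have /eqP E : [set (T a).2 | a in [set a | (T a).1 == x]] == [set c : 'I_n | c < nth 0 la x].
  by rewrite eqEcard sub card1 card_ord_below ?leqnn //; apply: is_part_nth_le pla.
have : y \in [set c : 'I_n | c < nth 0 la x].
  by rewrite inE.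
rewrite -E => /imsetP [a]; rewrite inE => /eqP <- ->; exists a.
by rewrite -surjective_pairing.
Qed.

Definition col_inj T (f : fX n) := forall a b, (T a).2 = (T b).2 -> f a = f b -> a = b.

(** Since [f] is injective on column [j], the left side is at most [r] and at most the length of the
    column; [T] attains the smaller of these two bounds. *)
Lemma col_inj_card T f (j : 'I_n) r : is_tab la T -> col_inj T f ->
  #|[set a | ((T a).2 == j) && (f a < r)]| <= #|[set a | ((T a).2 == j) && ((T a).1 < r)]|.
Proof.
move=> tT cf; have := tT => /andP [/injectiveP injT /forallP shT].
case: (boolP [exists b, ((T b).2 == j) && (r <= (T b).1)]) => [/existsP [b /andP [/eqP bj rb]]|no].
  have rn : r <= n by apply: leq_trans rb _; apply: ltnW.
  apply: (@leq_trans r).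
    have -> : #|[set a | ((T a).2 == j) && (f a < r)]| = #|[set f a | a in [set a | ((T a).2 == j) && (f a < r)]]|.
      rewrite card_in_imset // => a a'; rewrite !inE => /andP [/eqP e _] /andP [/eqP e' _].
      by apply: cf; rewrite e e'.
    rewrite -[X in _ <= X](card_ord_below rn).
    by apply: subset_leq_card; apply/subsetP => c /imsetP [a]; rewrite !inE => /andP [_ H] ->.
  rewrite -[X in X <= _](card_ord_below rn).
  apply: leq_trans (leq_imset_card (fun a => (T a).1) _).
  apply: subset_leq_card; apply/subsetP => i; rewrite inE => ir.
  have [|a Ta] := @tab_surj T i j tT.
    apply: leq_trans (is_part_nth_anti (j := (T b).1) pla _); first by rewrite -bj.
    by apply: leq_trans rb; apply: ltnW.
  by apply/imsetP; exists a; rewrite ?inE Ta ?eqxx /=.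
apply: subset_leq_card; apply/subsetP => a; rewrite !inE => /andP [e _]; rewrite e /=.
by rewrite ltnNge; apply: contra no => H; apply/existsP; exists a; rewrite e.
Qed.

Lemma card_split_col T (P : pred 'I_n) :
  #|[set a | P a]| = \sum_(j < n) #|[set a | ((T a).2 == j) && P a]|.
Proof.
rewrite -[LHS]sum1_card (partition_big (fun a => (T a).2) xpredT) //=.
by apply: eq_bigr => j _; rewrite -sum1_card; apply: eq_bigl => a; rewrite !inE andbC.
Qed.

Lemma card_rows_lt (f : fX n) r : r <= n -> #|[set a | f a < r]| = \sum_(i < r) #|[set a | f a == i :> nat]|.
Proof.
move=> _; elim: r => [|r IH].
  by rewrite big_ord0; apply/eqP; rewrite cards_eq0; apply/eqP/setP => a; rewrite !inE.
rewrite big_ord_recr /= -IH -cardsUI.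
have -> : [set a | f a < r] :&: [set a | f a == r :> nat] = set0.
  by apply/setP => a; rewrite !inE; case: ltngtP.
rewrite cards0 addn0; congr #|pred_of_set _|; apply/setP => a.
by rewrite !inE ltnS leq_eqVlt orbC.
Qed.

End Tableaux.

Lemma card_tab_rows_lt n la (T : tab n) r : is_part n la -> is_tab la T ->
  (r <= n)%N -> #|[set a | ((T a).1 < r)%N]| = psum la r.
Proof.
move=> pla tT rn; have := @card_rows_lt n (tabloid T) r rn.
under eq_finset => a do rewrite ffunE.
move=> ->; apply: eq_bigr => i _.
rewrite -(card_tab_row pla (widen_ord rn i) tT); congr #|pred_of_set _|.
by apply/setP => a; rewrite !inE ffunE.
Qed.

Lemma psum_ge n la r : is_part n la -> (n <= r)%N -> psum la r = n.
Proof. by move=> pla nr; rewrite /psum (is_part_sum pla nr). Qed.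

Lemma card_perm_lt n (f : fX n) (s : 'S_n) r :
  #|[set a | (funact f s a < r)%N]| = #|[set a | (f a < r)%N]|.
Proof.
rewrite -[RHS](card_imset _ (@perm_inj _ s)); congr #|pred_of_set _|.
apply/setP => a; rewrite inE ffunE; apply/idP/imsetP => [H|[b]].
  by exists ((s^-1)%g a); rewrite ?inE ?permKV.
by rewrite inE => H ->; rewrite permK.
Qed.

(** James' combinatorial lemma: the column-by-column bounds add up to a comparison of partial sums
    of the two partitions. *)
Lemma col_inj_dom n la mu (T U : tab n) (s : 'S_n) :
  is_part n la -> is_part n mu -> is_tab la T -> is_tab mu U ->
  col_inj T (funact (tabloid U) s) -> dominates la mu.
Proof.
move=> pla pmu tT tU cf r.
case: (leqP r n) => [rn|/ltnW nr]; last by rewrite !(@psum_ge n).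
rewrite -(card_tab_rows_lt pla tT rn) -(card_tab_rows_lt pmu tU rn).
have := card_perm_lt (tabloid U) s r.
under [in RHS]eq_finset => a do rewrite ffunE.
move=> <-; rewrite (card_split_col T (fun a => funact (tabloid U) s a < r)%N).
rewrite (card_split_col T (fun a => (T a).1 < r)%N); apply: leq_sum => j _.
exact: (col_inj_card pla).
Qed.

(** The equality case of the preceding comparison. Both shapes are [la], so the columnwise
    inequalities have equal sums and are equalities; each column of [T] then meets the same rows
    under [f] as in [T], and matching them yields the column permutation. *)
Lemma col_inj_funact n la (T U : tab n) (s : 'S_n) :
  is_part n la -> is_tab la T -> is_tab la U ->
  col_inj T (funact (tabloid U) s) ->
  exists2 t, t \in colgrp T & funact (tabloid U) s = funact (tabloid T) t.
Proof.
move=> pla tT tU cf; set f := funact _ _ in cf *.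
have le r j := col_inj_card pla j r tT cf.
have eq r (j : 'I_n) : (r <= n)%N ->
   #|[set a | ((T a).2 == j) && (f a < r)%N]| = #|[set a | ((T a).2 == j) && ((T a).1 < r)%N]|.
  move=> rn; apply/eqP; rewrite eqn_leq le /= leqNgt; apply/negP => lt.
  have E : #|[set a | (f a < r)%N]| = #|[set a | ((T a).1 < r)%N]|.
    rewrite (card_tab_rows_lt pla tT rn) -(card_tab_rows_lt pla tU rn) card_perm_lt.
    by congr #|pred_of_set _|; apply/setP => a; rewrite !inE ffunE.
  move: E; rewrite (card_split_col T (fun a => f a < r)%N).
  rewrite (card_split_col T (fun a => (T a).1 < r)%N); apply/eqP.
  rewrite (bigD1 j) //= [X in _ == X](bigD1 j) //= neq_ltn.
  by apply/orP; left; rewrite -addSn leq_add // leq_sum.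
(* If [T] had no node in row [f a] and in the column of [a], raising the bound from [f a] to its
   successor would leave the count for [T] unchanged, while the count for [f] gains [a]. *)
have ex a : exists b, T b = (f a, (T a).2).
  pose j := (T a).2; pose r := val (f a).
  case: (boolP [exists b, T b == (f a, (T a).2)]) => [/existsP [b /eqP <-]|/existsPn no]; first by exists b.
  have := eq r.+1 j (ltn_ord _).
  have -> : [set a0 | ((T a0).2 == j) && ((T a0).1 < r.+1)%N] = [set a0 | ((T a0).2 == j) && ((T a0).1 < r)%N].
    apply/setP => b; rewrite !inE; case: eqP => //= e; rewrite ltnS leq_eqVlt.
    case: eqP => //= e'; case/negP: (no b); apply/eqP.
    by rewrite [T b]surjective_pairing e; congr (_, _); apply: val_inj.
  rewrite -eq; last by apply: ltnW; rewrite ltn_ord.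
  move/eqP; rewrite eqn_leq => /andP [+ _]; rewrite leqNgt => /negP []; apply: proper_card.
  apply/properP; split; last by exists a; rewrite !inE ?eqxx /= ?ltnn ?ltnSn.
  by apply/subsetP => b; rewrite !inE => /andP [->] /= /ltnW; rewrite ltnS.
have /fin_all_exists [t Ht] := ex.
have ti : injective t.
  by move=> a b e; have := Ht a; rewrite e Ht => -[e1 e2]; apply: cf.
exists (perm ti)^-1%g.
  rewrite inE; apply/forallP => a; have := Ht ((perm ti)^-1%g a).
  by rewrite -[t _](permE ti) permKV => ->.
by apply/ffunP => a; rewrite [RHS]ffunE invgK permE [RHS]ffunE Ht.
Qed.

(** * James' submodule theorem through signed column sums *)

Section SignedColumnSum.
Variables (n : nat) (F : fieldType).
Implicit Types T U : tab n.

Lemma colgrpP T (s : 'S_n) : reflect (forall a, (T (s a)).2 = (T a).2) (s \in colgrp T).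
Proof. by rewrite inE; apply: (iffP forallP) => H a; apply/eqP. Qed.

Lemma colgrp_group_set T : group_set (colgrp T).
Proof.
apply/group_setP; split=> [|s t /colgrpP Hs /colgrpP Ht]; apply/colgrpP => a.
  by rewrite perm1.
by rewrite permM Ht Hs.
Qed.
Canonical colgrp_group T := Group (colgrp_group_set T).

(** James' signed column sum, taken in an arbitrary representation so that it can be compared across
    isomorphic modules. *)
Definition colsum d (rG : mx_representation F [set: 'S_n]%G d) T : 'M_d :=
  \sum_(s in colgrp T) ((-1) ^+ odd_perm s) *: rG s.

Lemma colsum_rsim d1 d2 (r1 : mx_representation F [set: 'S_n]%G d1)
  (r2 : mx_representation F [set: 'S_n]%G d2) T :
  mx_rsim r1 r2 -> colsum r1 T = 0 -> colsum r2 T = 0.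
Proof.
move=> /mx_rsim_sym [B _ Bf HB] K0.
apply: (row_free_inj Bf); rewrite mul0mx.
transitivity (B *m colsum r1 T); last by rewrite K0 mulmx0.
rewrite mulmx_suml mulmx_sumr; apply: eq_bigr => s _.
by rewrite -scalemxAl HB ?inE // -scalemxAr.
Qed.

Section Rep.
Variables (d : nat) (rG : mx_representation F [set: 'S_n]%G d) (T : tab n).

Lemma mul_colsum t : t \in colgrp T ->
  rG t *m colsum rG T = (-1) ^+ odd_perm t *: colsum rG T.
Proof.
move=> tC; rewrite mulmx_sumr scaler_sumr [RHS](reindex_inj (mulgI t)) /=.
apply: eq_big => [s|s _]; first by rewrite groupMl.
by rewrite -scalemxAr scalerA odd_permM signr_addb signrMK repr_mxM ?inE.
Qed.

Lemma colsum_idem : colsum rG T *m colsum rG T = #|colgrp T|%:R *: colsum rG T.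
Proof.
rewrite {1}/colsum mulmx_suml -sum1_card natr_sum scaler_suml.
apply: eq_bigr => t tC; rewrite -scalemxAl mul_colsum // scalerA -signr_addb addbb.
by rewrite !scale1r.
Qed.

Lemma submod_colsum (U : 'M_d) (modU : mxmodule rG U) :
  colsum (submod_repr modU) T = in_submod U (val_submod 1%:M *m colsum rG T).
Proof.
rewrite mulmx_sumr linear_sum; apply: eq_bigr => s _.
by rewrite -scalemxAr linearZ.
Qed.

Lemma factmod_colsum m (U : 'M_d) (modU : mxmodule rG U) (W : 'M_(m, d)) :
  in_factmod U W *m colsum (factmod_repr modU) T = in_factmod U (W *m colsum rG T).
Proof.
rewrite !mulmx_sumr linear_sum; apply: eq_bigr => s _.
by rewrite -!scalemxAr linearZ /= in_factmodJ ?inE.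
Qed.

End Rep.

Lemma eqmx_mul0 m1 m2 k l (A : 'M[F]_(m1, k)) (B : 'M_(m2, k)) (M : 'M_(k, l)) :
  (A :=: B)%MS -> (A *m M == 0) = (B *m M == 0).
Proof. by move=> E; rewrite -!submx0 (eqmxMr M E). Qed.

Lemma colsum_submx m d (rG : mx_representation F [set: 'S_n]%G d) (U : 'M_(m, d)) T :
  mxmodule rG U -> (U *m colsum rG T <= U)%MS.
Proof.
move=> /mxmoduleP modU; rewrite mulmx_sumr summx_sub // => s _.
by rewrite -scalemxAr scalemx_sub // modU ?inE.
Qed.

Lemma section_colsum_eq0 d (rG : mx_representation F [set: 'S_n]%G d) T (U V : 'M_d)
    (modU : mxmodule rG U) (modV : mxmodule rG V) :
  (colsum (section_repr modU modV) T == 0) = (V *m colsum rG T <= U)%MS.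
Proof.
rewrite -in_factmod_eq0 -(factmod_colsum T modU) -(eqmx_mul0 _ (genmxE _)).
rewrite /section_repr; set Q := <<_>>%MS; set mQ := section_module modU modV.
rewrite submod_colsum -(eqmx_mul0 _ (val_submod1 Q)).
apply/eqP/eqP => [E|->]; last by rewrite linear0.
rewrite -[LHS](in_submodK (U := Q)) ?E ?linear0 //.
by rewrite (eqmxMr _ (val_submod1 Q)) colsum_submx.
Qed.

Section PermModule.
Local Notation R := (rM n F).

Definition tabv (f : fX n) : 'rV[F]_#|fX n| := delta_mx 0 (enum_rank f).

Lemma tabv_act f s : tabv f *m rM n F s = tabv (funact f s).
Proof.
by rewrite -rowE; apply/rowP => j; rewrite !mxE /= permE /rperm_fun enum_rankK eq_sym.
Qed.

Lemma tabv_colsum T f :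
  tabv f *m colsum R T = \sum_(s in colgrp T) ((-1) ^+ odd_perm s) *: tabv (funact f s).
Proof.
rewrite mulmx_sumr; apply: eq_bigr => s _.
by rewrite -scalemxAr tabv_act.
Qed.

Lemma polytabE T : polytab F T = tabv (tabloid T) *m colsum R T.
Proof. by rewrite tabv_colsum. Qed.

(** The transposition of [a] and [b] lies in the column group and fixes [f], so the terms for [s]
    and [tperm a b * s] cancel. *)
Lemma tabv_colsum0 T (f : fX n) a b : a != b -> (T a).2 = (T b).2 -> f a = f b ->
  tabv f *m colsum R T = 0.
Proof.
move=> ab eT ef; rewrite tabv_colsum.
have tC : tperm a b \in colgrp T by apply/colgrpP => c; case: tpermP => [->|->|].
have ft : funact f (tperm a b) = f.
  by apply/ffunP => c; rewrite ffunE tpermV; case: tpermP => [->|->|].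
rewrite (bigID (fun s => odd_perm s)) /= [X in X + _](reindex_inj (mulgI (tperm a b))) /=.
under eq_bigl => s do rewrite groupMl // odd_mul_tperm ab /=.
rewrite -big_split big1 // => s /andP [_ /negPf os] /=.
by rewrite odd_mul_tperm ab os funactM ft /= scaleN1r scale1r addNr.
Qed.

Lemma tabv_colsum_col_inj T (f : fX n) : tabv f *m colsum R T != 0 -> col_inj T f.
Proof.
move=> nz a b eT ef; apply/eqP; apply: contraNT nz => ab.
by rewrite (tabv_colsum0 ab eT ef).
Qed.

Definition relab T (s : 'S_n) : tab n := [ffun a => T ((s^-1)%g a)].

Lemma relab_tabloid T s : tabloid (relab T s) = funact (tabloid T) s.
Proof. by apply/ffunP => a; rewrite !ffunE. Qed.

Lemma colgrp_relab T s t : ((t ^ s)%g \in colgrp (relab T s)) = (t \in colgrp T).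
Proof.
apply/colgrpP/colgrpP => H a.
  by have := H (s a); rewrite !ffunE permJ !permK.
by rewrite !ffunE -{1}(permKV s a) permJ permK H.
Qed.

Lemma polytab_act T s : polytab F T *m R s = polytab F (relab T s).
Proof.
rewrite !polytabE relab_tabloid -tabv_act -!mulmxA; congr (_ *m _).
rewrite mulmx_suml mulmx_sumr [RHS](reindex_inj (conjg_inj s)) /=.
apply: eq_big => t; first by rewrite colgrp_relab.
by rewrite odd_permJ -scalemxAl -scalemxAr -!perm_mxM -!rpermM -conjgC.
Qed.

Lemma relab_tab la T s : is_tab la T -> is_tab la (relab T s).
Proof.
move=> /andP [/injectiveP iT /forallP sT]; apply/andP; split.
  by apply/injectiveP => a b; rewrite !ffunE => /iT /perm_inj.
by apply/forallP => a; rewrite ffunE.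
Qed.

Lemma tab_relab la T U : is_part n la -> is_tab la T -> is_tab la U ->
  exists s, U = relab T s.
Proof.
move=> pla tT /andP [/injectiveP iU /forallP sU].
have /fin_all_exists [t Ht] a : exists b, T b = U a.
  by rewrite (surjective_pairing (U a)); apply: (tab_surj pla tT (sU a)).
have ti : injective t by move=> a b e; apply: iU; rewrite -!Ht e.
by exists (perm ti)^-1%g; apply/ffunP => a; rewrite ffunE invgK permE Ht.
Qed.

Lemma polytab_sub la T : is_tab la T -> (polytab F T <= SpechtSp n F la)%MS.
Proof.
move=> tT; rewrite genmxE; have iT : T \in tabs n la by rewrite inE.
have -> : polytab F T = row (enum_rank_in iT T) (Specht n F la).
  by rewrite rowK enum_rankK_in.
exact: row_sub.
Qed.

Lemma SpechtSp_sub m la (W : 'M_(m, #|fX n|)) :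
  (forall T, is_tab la T -> (polytab F T <= W)%MS) -> (SpechtSp n F la <= W)%MS.
Proof.
move=> H; rewrite genmxE; apply/row_subP => i; rewrite rowK; apply: H.
by have := enum_valP i; rewrite inE.
Qed.

Lemma SpechtSp_mul_sub m k la (M : 'M_(#|fX n|, k)) (W : 'M_(m, k)) :
  (forall T, is_tab la T -> (polytab F T *m M <= W)%MS) -> (SpechtSp n F la *m M <= W)%MS.
Proof.
move=> H; rewrite (eqmxMr _ (genmxE _)); apply/row_subP => i; rewrite row_mul rowK; apply: H.
by have := enum_valP i; rewrite inE.
Qed.

Lemma SpechtSp_module la : mxmodule R (SpechtSp n F la).
Proof.
apply/mxmoduleP => s _; apply: SpechtSp_mul_sub => T tT.
by rewrite polytab_act polytab_sub ?relab_tab.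
Qed.

Lemma SRadP la m (W : 'M_(m, #|fX n|)) :
  reflect ((W <= SpechtSp n F la)%MS /\
           forall T, is_tab la T -> W *m (polytab F T)^T = 0)
          (W <= SRad n F la)%MS.
Proof.
rewrite sub_capmx; apply: (iffP andP) => -[WS H]; split=> //.
  move=> T tT; have iT : T \in tabs n la by rewrite inE.
  have -> : polytab F T = row (enum_rank_in iT T) (Specht n F la).
    by rewrite rowK enum_rankK_in.
  by rewrite tr_row colE mulmxA (sub_kermxP H) mul0mx.
apply/sub_kermxP/matrixP => i j; rewrite mxE.
have tT : is_tab la (enum_val j) by have := enum_valP j; rewrite inE.
have /matrixP /(_ i 0) := H _ tT; rewrite !mxE => E; rewrite -[RHS]E.
by apply: eq_bigr => k _; rewrite !mxE; congr (_ * _); rewrite !mxE.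
Qed.

Lemma rM_tr s : (R s)^T = R (s^-1)%g.
Proof.
rewrite [R s]/(perm_mx (rperm s)) [R _]/(perm_mx (rperm s^-1)) tr_perm_mx; congr perm_mx.
by apply/eqP; rewrite eq_invg_mul -rpermM mulgV rperm1.
Qed.

Lemma SRad_module la : mxmodule R (SRad n F la).
Proof.
apply/mxmoduleP => s _.
have /SRadP [RS RP] : (SRad n F la <= SRad n F la)%MS by [].
apply/SRadP; split.
  apply: submx_trans (submxMr _ RS) _; apply: (mxmoduleP (SpechtSp_module la)).
  by rewrite inE.
move=> T tT; rewrite -mulmxA -[R s]trmxK rM_tr -trmx_mul polytab_act RP //.
exact: relab_tab.
Qed.

(** Inversion preserves the column group and signs and corresponds to transposing permutation
    matrices: the signed sum is self-adjoint for James' form. *)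
Lemma colsum_tr T : (colsum R T)^T = colsum R T.
Proof.
rewrite linear_sum /= [RHS](reindex_inj invg_inj) /=; apply: eq_big => s.
  by rewrite groupV.
by rewrite linearZ /= rM_tr odd_permV.
Qed.

Lemma tabv_dot f g : tabv f *m (tabv g)^T = (f == g)%:R%:M.
Proof.
rewrite trmx_delta mul_delta_mx_cond (inj_eq enum_rank_inj) eq_sym.
by case: (g == f); apply/matrixP => i j; rewrite !ord1 ?mulr1n ?mulr0n !mxE eqxx.
Qed.

(** Only the identity preserves both the rows and the columns of [T], so the tabloid of [T] has
    coefficient one in its polytabloid. *)
Lemma polytab_dot_tabv la T : is_tab la T -> polytab F T *m (tabv (tabloid T))^T = 1%:M.
Proof.
move=> /andP [/injectiveP iT _]; rewrite mulmx_suml (bigD1 1%g) ?group1 //=.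
rewrite odd_perm1 expr0 scale1r -/(tabv _) funact1 tabv_dot eqxx big1 ?addr0 // => s.
move=> /andP [/colgrpP sC s1]; rewrite -scalemxAl -/(tabv _) tabv_dot.
case: eqP => [E|]; last by rewrite /= scale_scalar_mx mulr0 raddf0.
case/eqP: s1; apply/permP => a; rewrite perm1; apply: iT.
rewrite [LHS]surjective_pairing [RHS]surjective_pairing sC; congr (_, _).
by have /ffunP/(_ (s a)) := E; rewrite !ffunE permK.
Qed.

Lemma polytab_colsum T : polytab F T *m colsum R T = #|colgrp T|%:R *: polytab F T.
Proof. by rewrite polytabE -mulmxA colsum_idem scalemxAr. Qed.

(** One of the two signed sums is moved across the form by self-adjointness and is absorbed by the
    other at the cost of the factor [#|colgrp T|]. The characteristic enters through this number. *)
Lemma polytab_norm la T : is_tab la T ->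
  polytab F T *m (polytab F T)^T = (#|colgrp T|%:R)%:M.
Proof.
move=> tT; rewrite {2}polytabE trmx_mul colsum_tr mulmxA polytab_colsum -scalemxAl.
by rewrite (polytab_dot_tabv tT) scalemx1.
Qed.

(** A tabloid of shape [la] that survives the signed sum is a column permutation of the tabloid of
    [T], hence contributes the polytabloid of [T] up to sign. *)
Lemma Specht_colsum la T : is_part n la -> is_tab la T ->
  (SpechtSp n F la *m colsum R T <= polytab F T)%MS.
Proof.
move=> pla tT; apply: SpechtSp_mul_sub => U tU; rewrite mulmx_suml summx_sub // => s _.
rewrite -scalemxAl scalemx_sub // -/(tabv _).
have [->|/tabv_colsum_col_inj cf] := eqVneq (tabv (funact (tabloid U) s) *m colsum R T) 0.
  exact: sub0mx.
have [t tC ->] := col_inj_funact pla tT tU cf.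
by rewrite -tabv_act -mulmxA mul_colsum // -scalemxAr -polytabE scalemx_sub.
Qed.

Lemma Specht_colsum_dom la mu T : is_part n la -> is_part n mu -> is_tab la T ->
  SpechtSp n F mu *m colsum R T != 0 -> dominates la mu.
Proof.
move=> pla pmu tT; rewrite -submx0.
have [/existsP [U /existsP [s /andP [tU nz]]] _|no] := boolP [exists U : tab n, exists s : 'S_n,
    is_tab mu U && (tabv (funact (tabloid U) s) *m colsum R T != 0)].
  exact: (col_inj_dom pla pmu tT tU (tabv_colsum_col_inj nz)).
case/negP; apply: SpechtSp_mul_sub => U tU; rewrite mulmx_suml summx_sub // => s _.
rewrite -scalemxAl scalemx_sub // -/(tabv _) submx0.
by apply: contraR no => nz; apply/existsP; exists U; apply/existsP; exists s; rewrite tU.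
Qed.

(** First alternative of the submodule theorem: self-adjointness turns the vanishing of the signed
    sum on [W] into orthogonality to one polytabloid, and the stability of [W] extends this to all
    of them. *)
Lemma SRad_colsum la T (W : 'M_#|fX n|) : is_part n la -> is_tab la T ->
  mxmodule R W -> (W <= SpechtSp n F la)%MS -> W *m colsum R T = 0 -> (W <= SRad n F la)%MS.
Proof.
move=> pla tT modW WS W0; apply/SRadP; split=> // U tU.
have [s ->] := tab_relab pla tT tU.
rewrite -polytab_act trmx_mul rM_tr polytabE trmx_mul colsum_tr !mulmxA.
have /submxP [D ->] := mxmoduleP modW (s^-1)%g (in_setT _).
by rewrite -[D *m W *m _]mulmxA W0 mulmx0 mul0mx.
Qed.

End PermModule.

(** Resolves the two decisions in [Dmod], so that later arguments see the quotient itself. *)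
Lemma Dmod_section la : exists mR mS,
  Dmod n F la = existT _ _ (@section_repr _ _ _ _ (rM n F) (SRad n F la) (SpechtSp n F la) mR mS).
Proof.
rewrite /Dmod; case: {-}_ / idP => [mR|nR]; last by case: nR; apply: SRad_module.
case: {-}_ / idP => [mS|nS]; last by case: nS; apply: SpechtSp_module.
by exists mR, mS.
Qed.

Lemma Drep_colsum_eq0 la T :
  (colsum (Drep n F la) T == 0) = (SpechtSp n F la *m colsum (rM n F) T <= SRad n F la)%MS.
Proof.
have [mR [mS E]] := Dmod_section la.
by rewrite /Drep /Ddim E /= section_colsum_eq0.
Qed.

(** The polytabloid of [T] is multiplied by [#|colgrp T|], and its norm is the same number; if the
    result were in the radical, the square of this number would vanish. *)
Lemma Drep_colsum_neq0 la T : is_tab la T -> #|colgrp T|%:R != 0 :> F ->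
  colsum (Drep n F la) T != 0.
Proof.
move=> tT nz; rewrite Drep_colsum_eq0; apply/negP => /(submx_trans (submxMr _ (polytab_sub tT))).
rewrite polytab_colsum => /SRadP [_ /(_ _ tT)].
rewrite -scalemxAl (polytab_norm tT) scale_scalar_mx => /matrixP /(_ 0 0); rewrite !mxE eqxx.
by move/eqP; rewrite mulr1n mulf_eq0 orbb (negPf nz).
Qed.

Lemma Drep_colsum_dom la mu T : is_part n la -> is_part n mu -> is_tab la T ->
  colsum (Drep n F mu) T != 0 -> dominates la mu.
Proof.
move=> pla pmu tT; rewrite Drep_colsum_eq0 => nz; apply: (Specht_colsum_dom pla pmu tT).
by apply: contraNneq nz => ->; apply: sub0mx.
Qed.

(** A submodule of the Specht module above the radical is not killed by the signed sum. Its image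
    lies in the line of the polytabloid of [T], so it contains that polytabloid and all its
    translates, which span. *)
Lemma Drep_irr la T : is_part n la -> is_tab la T -> #|colgrp T|%:R != 0 :> F ->
  mx_irreducible (Drep n F la).
Proof.
move=> pla tT nz; have [mR [mS E]] := Dmod_section la.
rewrite /Drep /Ddim E /=; apply/max_submodP; first by case/SRadP: (submx_refl (SRad n F la)).
split=> [|W [modW RW WS]].
  rewrite ltmxE; apply/andP; split; first by case/SRadP: (submx_refl (SRad n F la)).
  apply/negP => SR; have := submx_trans (polytab_sub tT) SR.
  move=> /SRadP [_ /(_ _ tT)]; rewrite (polytab_norm tT) => /matrixP /(_ 0 0).
  by rewrite !mxE eqxx mulr1n => /eqP; rewrite (negPf nz).
have WK : W *m colsum (rM n F) T != 0.
  apply: contraTneq RW => W0; rewrite ltmxE negb_and negbK orbC.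
  by rewrite (SRad_colsum pla tT modW (ltmxW WS) W0).
have eW : (polytab F T <= W)%MS.
  apply: submx_trans (colsum_submx T modW).
  have := submx_trans (submxMr _ (ltmxW WS)) (Specht_colsum pla tT) => sub.
  rewrite -(geq_leqif (mxrank_leqif_sup sub)).
  by apply: leq_trans (rank_leq_row _) _; rewrite lt0n mxrank_eq0.
move: WS; rewrite ltmxE => /andP [_ /negP []]; apply: SpechtSp_sub => U tU.
have [s ->] := tab_relab pla tT tU; rewrite -polytab_act.
by apply: submx_trans (submxMr _ eW) _; apply: (mxmoduleP modW); rewrite inE.
Qed.

Lemma Drep_not_rsim la mu T U : is_part n la -> is_part n mu -> is_tab la T -> is_tab mu U ->
  #|colgrp T|%:R != 0 :> F -> #|colgrp U|%:R != 0 :> F ->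
  mx_rsim (Drep n F la) (Drep n F mu) -> la = mu.
Proof.
move=> pla pmu tT tU nT nU sim; apply: (dominates_anti pla pmu).
  apply: (Drep_colsum_dom pla pmu tT); apply: contraNneq (Drep_colsum_neq0 tT nT) => K0.
  by apply/eqP/(colsum_rsim (mx_rsim_sym sim) K0).
apply: (Drep_colsum_dom pmu pla tU); apply: contraNneq (Drep_colsum_neq0 tU nU) => K0.
by apply/eqP/(colsum_rsim sim K0).
Qed.

End SignedColumnSum.

(** * Jucys-Murphy elements and weights *)

Section SimpleTranspositions.
Variable m : nat.
Local Notation n := m.+1.

Lemma sgenE i : sgen n i.+1 = tperm (inord i) (inord i.+1).
Proof. by []. Qed.

Lemma sgen_val i (a : 'I_n) : (i.+1 < n)%N ->
  sgen n i.+1 a = (if a == i :> nat then i.+1 else if a == i.+1 :> nat then i else a) :> nat.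
Proof.
move=> lt; have lt' := ltnW lt; rewrite sgenE; case: tpermP => [->|->|].
- by rewrite /= !inordK // eqxx.
- by rewrite /= !inordK // eqxx eqn_leq ltnn.
move=> n1 n2; case: eqP => [e|_]; first by case: n1; apply: val_inj; rewrite /= inordK.
by case: eqP => [e|_] //; case: n2; apply: val_inj; rewrite /= inordK.
Qed.

Lemma sgenK i : (sgen n i * sgen n i = 1)%g.
Proof. by rewrite /sgen tperm2. Qed.

Lemma sgenV i : ((sgen n i)^-1 = sgen n i)%g.
Proof. by rewrite /sgen tpermV. Qed.

Lemma sgen_braid i : (i.+2 < n)%N ->
  (sgen n i.+1 * sgen n i.+2 * sgen n i.+1 = sgen n i.+2 * sgen n i.+1 * sgen n i.+2)%g.
Proof.
move=> lt; apply/permP => a; apply: ord_inj; rewrite !permM.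
rewrite !sgen_val // ?(ltnW lt) //.
have e1 : (i == i.+1) = false by lia.
have e2 : (i == i.+2) = false by lia.
have e3 : (i.+1 == i.+2) = false by lia.
have e4 : (i.+1 == i) = false by lia.
have e5 : (i.+2 == i) = false by lia.
have e6 : (i.+2 == i.+1) = false by lia.
have [E|/negPf n0] := eqVneq (a : nat) i; first by do ?rewrite !(E, e1, e2, e3, e4, e5, e6, eqxx).
have [E|/negPf n1] := eqVneq (a : nat) i.+1; first by do ?rewrite !(E, e1, e2, e3, e4, e5, e6, eqxx).
have [E|/negPf n2] := eqVneq (a : nat) i.+2; first by do ?rewrite !(E, e1, e2, e3, e4, e5, e6, eqxx).
by do ?rewrite !(n0, n1, n2, e1).
Qed.

Section Generation.
Variables (e : 'I_n -> nat) (P : 'S_n -> Prop).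
Hypothesis e_mono : {homo e : a b / (a <= b)%N}.
Hypothesis P1 : P 1%g.
Hypothesis PM : forall s t, P s -> P t -> P (s * t)%g.
Hypothesis Ps : forall i, (i.+1 < n)%N -> e (inord i) = e (inord i.+1) -> P (sgen n i.+1).

Lemma young_tperm k (a b : 'I_n) : b = (a + k)%N :> nat -> e a = e b -> P (tperm a b).
Proof.
elim: k b => [|k IH] b eb eab.
  by rewrite (_ : b = a) ?tperm1 //; apply: ord_inj; rewrite eb addn0.
have lt : ((a + k).+1 < n)%N by rewrite -addnS -eb ltn_ord.
pose c : 'I_n := inord (a + k).
have vc : c = (a + k)%N :> nat by rewrite inordK // ltnW.
have eac : e a = e c.
  have /e_mono h1 : (a <= c)%N by rewrite vc leq_addr.
  have /e_mono h2 : (c <= b)%N by rewrite vc eb addnS.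
  by apply/eqP; rewrite eqn_leq h1 eab.
have Pc : P (sgen n (a + k).+1).
  apply: Ps => //; rewrite -/c -eac eab; congr (e _); apply: ord_inj.
  by rewrite inordK // eb addnS.
have bE : b = inord (a + k).+1 by apply: ord_inj; rewrite inordK // eb addnS.
case: k IH eb lt @c vc eac Pc bE => [|k] IH eb lt c vc eac Pc bE.
  have ca : c = a by apply: ord_inj; rewrite vc addn0.
  by move: Pc; rewrite sgenE -/c ca -bE.
have -> : tperm a b = (sgen n (a + k.+1).+1 * tperm a c * sgen n (a + k.+1).+1)%g.
  rewrite -{1}sgenV -mulgA -/(conjg _ _) tpermJ; congr tperm; apply: ord_inj.
    by rewrite sgen_val //; case: eqP => [|_]; [lia|case: eqP; lia].
  by rewrite sgen_val // vc eqxx bE /= inordK.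
by apply: PM => //; apply: PM => //; apply: IH.
Qed.

(** The fibres of [e] are intervals by [e_mono], and their Young subgroup is generated by the simple
    transpositions inside them. As an induction principle this serves for the full group, for [S_k]
    inside [S_n], and for the column group of a column-reading tableau. *)
Lemma young_ind (s : 'S_n) : (forall a, e (s a) = e a) -> P s.
Proof.
have [k] := ubnP #|[set a | s a != a]|; elim: k s => // k IH s; rewrite ltnS => lek es.
have [/forallP s1|/forallPn /= [a sa]] := boolP [forall a, s a == a].
  by rewrite (_ : s = 1%g) //; apply/permP => a; rewrite perm1; apply/eqP.
(* This permutation fixes [a] in addition to every fixed point of [s], so it moves fewer points. *)
pose s' := (s * tperm a (s a))%g.
have Pt : P (tperm a (s a)).
  case/orP: (leq_total a (s a)) => le; first by apply: (@young_tperm (s a - a)); rewrite ?es ?subnKC.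
  by rewrite tpermC; apply: (@young_tperm (a - s a)); rewrite ?es ?subnKC.
rewrite (_ : s = s' * tperm a (s a))%g; last by rewrite -mulgA tperm2 mulg1.
apply: PM => //; apply: IH => [|b]; last first.
  by rewrite permM -[RHS]es; case: tpermP => [->|->|//]; rewrite es.
apply: leq_trans lek; apply: proper_card; apply/properP; split; last first.
  by exists a; rewrite inE // permM tpermR eqxx.
apply/subsetP => b; rewrite !inE permM; apply: contra => /eqP eb; rewrite eb.
have [E|ba] := eqVneq b a; first by case/eqP: sa; rewrite -E.
rewrite tpermD // 1?eq_sym //; apply: contraNneq ba => E.
by apply/eqP; apply: (@perm_inj _ s); rewrite eb E.
Qed.
End Generation.
End SimpleTranspositions.

Section JucysMurphy.
Variables (F : fieldType) (m d : nat).
Local Notation n := m.+1.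
Variable rG : mx_representation F [set: 'S_n]%G d.
Local Notation s i := (rG (sgen n i.+1)).

(** Entries are counted from zero, so this is the Jucys-Murphy element usually numbered [k + 1]. *)
Definition jm k : 'M[F]_d := \sum_(j < n | (j < k)%N) rG (tperm j (inord k)).

Lemma jm0 : jm 0 = 0.
Proof. by rewrite /jm big_pred0. Qed.

Lemma sgen_inordL i : sgen n i.+1 (inord i) = inord i.+1.
Proof. by rewrite sgenE tpermL. Qed.

Lemma sgen_inordR i : sgen n i.+1 (inord i.+1) = inord i.
Proof. by rewrite sgenE tpermR. Qed.

Lemma sgen_inordD i k : (i.+1 < n)%N -> (k < n)%N -> k != i -> k != i.+1 ->
  sgen n i.+1 (inord k) = inord k.
Proof.
move=> lt lk k1 k2; rewrite sgenE tpermD // eq_sym -val_eqE /= !inordK //.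
exact: ltnW.
Qed.

Lemma mul_sgen_sgen i : s i *m s i = 1%:M.
Proof. by rewrite -repr_mxM ?inE // sgenK repr_mx1. Qed.

Lemma jm_comm_perm k (t : 'S_n) : (k < n)%N -> t (inord k) = inord k ->
  (forall j, (t j < k)%N = (j < k)%N) -> rG t *m jm k = jm k *m rG t.
Proof.
move=> lk tk tj; rewrite mulmx_sumr mulmx_suml (reindex_inj (@perm_inj _ t)) /=.
apply: eq_big => [j|j _]; first exact: tj.
by rewrite -!repr_mxM ?inE // [in RHS]conjgC tpermJ tk.
Qed.

Lemma jm_comm_sgen i k : (i.+1 < n)%N -> (k < n)%N -> k != i -> k != i.+1 ->
  s i *m jm k = jm k *m s i.
Proof.
move=> lt lk k1 k2; apply: jm_comm_perm => // [|j]; first exact: sgen_inordD.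
by rewrite sgen_val //; case: eqP => [->|_]; [|case: eqP => [->|_]] => //; lia.
Qed.

(** The degenerate affine Hecke relation: conjugation by the simple transposition carries [jm i] to
    all terms of [jm i.+1] but one, which is the simple transposition itself and contributes its
    square. *)
Lemma jm_sgen i : (i.+1 < n)%N -> jm i.+1 *m s i = s i *m jm i + 1%:M.
Proof.
move=> lt; have lt' := ltnW lt.
rewrite /jm (bigD1 (inord i)) /=; last by rewrite inordK.
rewrite mulmxDl addrC; congr (_ + _); last exact: mul_sgen_sgen.
rewrite mulmx_sumr mulmx_suml; apply: eq_big => [j|j].
  by rewrite -val_eqE /= inordK //; lia.
rewrite -val_eqE /= inordK // => ji; rewrite -!repr_mxM ?inE //; congr (rG _).
rewrite [LHS]conjgC tpermJ sgen_inordR; congr (_ * tperm _ _)%g.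
by apply: ord_inj; rewrite sgen_val //; case: eqP => [|_]; [|case: eqP]; lia.
Qed.

Lemma sgen_jm i : (i.+1 < n)%N -> s i *m jm i.+1 = jm i *m s i + 1%:M.
Proof.
move=> lt; have := jm_sgen lt; set A := jm _; set B := jm _; set S := s i => E.
have SS : S *m S = 1%:M := mul_sgen_sgen i.
have := congr1 (fun M => S *m M *m S) E.
rewrite mulmxDr mulmx1 !mulmxDl !mulmxA SS mul1mx -!mulmxA SS mulmx1 => ->.
by [].
Qed.

Lemma jm_comm i k : (i < n)%N -> (k < n)%N -> jm i *m jm k = jm k *m jm i.
Proof.
wlog ik : i k / (i <= k)%N => [H li lk|li lk].
  by case/orP: (leq_total i k) => h; [|symmetry]; apply: H.
have [<-//|ne] := eqVneq i k.
rewrite {1}/jm mulmx_suml [RHS]mulmx_sumr; apply: eq_bigr => j ji.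
apply: jm_comm_perm => // [|l].
  by rewrite tpermD // -val_eqE /= !inordK //; lia.
by case: tpermP => [->|->|//] /=; rewrite !inordK //; lia.
Qed.

Definition sw i (c : nat -> F) k := if k == i then c i.+1 else if k == i.+1 then c i else c k.

Lemma swL i c : sw i c i = c i.+1. Proof. by rewrite /sw eqxx. Qed.

Lemma swR i c : sw i c i.+1 = c i. Proof. by rewrite /sw eqxx; case: eqP => // /esym; lia. Qed.

Lemma swD i c k : k != i -> k != i.+1 -> sw i c k = c k.
Proof. by rewrite /sw => /negPf -> /negPf ->. Qed.

Definition wv l (c : nat -> F) (v : 'rV[F]_d) := forall k, (k < l)%N -> v *m jm k = c k *: v.

(** The multiple of [v] that is subtracted absorbs the identity term in the Hecke relations; the
    result is the usual intertwining vector. *)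
Lemma wv_swap l i c v : (l <= n)%N -> (i.+1 < l)%N -> wv l c v -> c i != c i.+1 ->
  wv l (sw i c) (v *m s i - (c i.+1 - c i)^-1 *: v).
Proof.
move=> ln il wc ne k kl; have il' := ltnW il.
have nz : c i.+1 - c i != 0 by rewrite subr_eq0 eq_sym.
have ltn := leq_trans il ln; have lkn := leq_trans kl ln.
rewrite /sw; have [->|ki] := eqVneq k i.
  have -> : (v *m s i - (c i.+1 - c i)^-1 *: v) *m jm i =
            v *m (s i *m jm i) - (c i.+1 - c i)^-1 *: (v *m jm i).
    by rewrite mulmxBl -mulmxA -scalemxAl.
  have -> : s i *m jm i = jm i.+1 *m s i - 1%:M by rewrite jm_sgen // addrK.
  rewrite mulmxBr mulmx1 mulmxA !wc // -scalemxAl.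
  apply/rowP => j; rewrite !mxE; move: nz; set x := c i.+1; set y := c i => nz.
  set w := \sum_(_ < _) _; clearbody w; field.
  by rewrite nz.
have [->|ki'] := eqVneq k i.+1.
  have -> : (v *m s i - (c i.+1 - c i)^-1 *: v) *m jm i.+1 =
            v *m (s i *m jm i.+1) - (c i.+1 - c i)^-1 *: (v *m jm i.+1).
    by rewrite mulmxBl -mulmxA -scalemxAl.
  rewrite sgen_jm // mulmxDr mulmx1 mulmxA !wc // -scalemxAl.
  apply/rowP => j; rewrite !mxE; move: nz; set x := c i.+1; set y := c i => nz.
  set w := \sum_(_ < _) _; clearbody w; field.
  by rewrite nz.
rewrite mulmxBl -mulmxA jm_comm_sgen // mulmxA -!scalemxAl wc //.
by rewrite -scalemxAl scalerBr !scalerA mulrC.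
Qed.

(** The intertwiner applied forth and back, with [r] changing sign, is a scalar. With [r] the
    inverse axial distance, this scalar is nonzero unless that distance is 1 or -1. *)
Lemma swap_swap i (r : F) (v : 'rV_d) : (v *m s i - r *: v) *m s i + r *: (v *m s i - r *: v) = (1 - r ^+ 2) *: v.
Proof.
rewrite mulmxBl -mulmxA mul_sgen_sgen mulmx1 -scalemxAl scalerBr scalerA scalerBl scale1r expr2.
by rewrite addrA subrK.
Qed.

Lemma wv_scale l c a v : wv l c v -> wv l c (a *: v).
Proof. by move=> wc k kl; rewrite -scalemxAl wc // !scalerA mulrC. Qed.

Lemma wv_ext l c c' v : (forall k, (k < l)%N -> c k = c' k) -> wv l c v -> wv l c' v.
Proof. by move=> E wc k kl; rewrite wc // E. Qed.

(* [jm i] has no Jordan block of size two, for each i < l *)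
Definition jm_ss l := forall i (a : F) (u v : 'rV[F]_d), (i < l)%N ->
  v *m jm i = a *: v -> u *m jm i = a *: u - v -> v = 0.

Definition wt l c := exists2 v, v != 0 & wv l c v.

Section Closure.
Variable l : nat.
Hypothesis ln : (l <= n)%N.
Hypothesis ss : jm_ss l.-1.

Lemma wt_zero c : (0 < l)%N -> wt l c -> c 0%N = 0.
Proof.
move=> l0 [v nz wc]; have := wc _ l0; rewrite jm0 mulmx0 => /esym/eqP.
by rewrite scaler_eq0 (negPf nz) orbF => /eqP.
Qed.

(** If the two values agreed, [v *m s i] and [v] would form a Jordan block of [jm i]. The index
    satisfies [i < l - 1], so the last Jucys-Murphy element is never involved; this lets the later
    induction reach the full group. *)
Lemma wt_adj c i : (i.+1 < l)%N -> wt l c -> c i != c i.+1.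
Proof.
move=> il [v nz wc]; apply: contraNneq nz => E.
have il' : (i < l)%N := ltnW il; have ltn := leq_trans il ln.
apply/eqP; apply: (ss (i := i) (a := c i) (u := v *m s i)); first by lia.
  exact: wc.
have -> : v *m s i *m jm i = v *m (jm i.+1 *m s i - 1%:M).
  by rewrite jm_sgen // addrK mulmxA.
by rewrite mulmxBr mulmx1 mulmxA wc // -scalemxAl E.
Qed.

Lemma wt_swap c i : (i.+1 < l)%N -> wt l c -> (c i.+1 - c i) ^+ 2 != 1 -> wt l (sw i c).
Proof.
move=> il wc ne1; have ne := wt_adj il wc; case: wc => v nz wc.
exists (v *m s i - (c i.+1 - c i)^-1 *: v); last exact: wv_swap.
apply: contraNneq nz => E; have := swap_swap i (c i.+1 - c i)^-1 v.
rewrite E mul0mx scaler0 addr0 => /esym/eqP; rewrite scaler_eq0 => /orP [] //.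
by rewrite exprVn subr_eq0 eq_sym invr_eq1 (negPf ne1).
Qed.

Lemma wv_stuck c i v : (i.+1 < l)%N -> wv l c v -> v != 0 -> ~ wt l (sw i c) ->
  v *m s i = (c i.+1 - c i)^-1 *: v.
Proof.
move=> il wc nz nsw; apply/eqP; rewrite -subr_eq0; apply/eqP.
have [//|nz'] := eqVneq (v *m s i - (c i.+1 - c i)^-1 *: v) 0; case: nsw.
exists (v *m s i - (c i.+1 - c i)^-1 *: v) => //; apply: wv_swap => //.
by apply: wt_adj => //; exists v.
Qed.

(** Otherwise either swap would create equal adjacent values, so [v] is an eigenvector of [s i] for
    [r] and of [s i.+1] for [- r]. The braid relation then equates [- r ^+ 3] with [r ^+ 3],
    impossible when [r ^+ 2 = 1] and 2 is invertible. *)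
Lemma wt_braid c i : (2%:R != 0 :> F) -> (i.+2 < l)%N -> wt l c -> c i = c i.+2 ->
  (c i.+1 - c i) ^+ 2 != 1.
Proof.
move=> nz2 il [v nz wc] E; apply/eqP => e2.
set r := c i.+1 - c i in e2; have lt : (i.+1 < l)%N := ltnW il.
have n1 : ~ wt l (sw i c).
  by move=> /(wt_adj il); rewrite swR swD ?E ?eqxx //; lia.
have n2 : ~ wt l (sw i.+1 c).
  by move=> /(wt_adj lt); rewrite swL swD ?E ?eqxx //; lia.
have rV : r^-1 = r.
  have rnz : r != 0 by apply: contra_eq_neq e2 => ->; rewrite expr0n /= eq_sym oner_eq0.
  by apply: (mulfI rnz); rewrite divff // -expr2 e2.
have v1 : v *m s i = r *: v by rewrite (wv_stuck lt wc nz n1) -/r rV.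
have v2 : v *m s i.+1 = - r *: v.
  rewrite (wv_stuck il wc nz n2) -E; congr (_ *: _).
  by rewrite -[c i - _]opprB -/r invrN rV.
have := congr1 (fun g => v *m rG g) (sgen_braid (leq_trans il ln)).
rewrite /= !repr_mxM ?inE ?groupM ?inE // !mulmxA.
rewrite v1 -!scalemxAl v2 -!scalemxAl v1 !(=^~ scalemxAl, v1, v2, scalerA).
move/eqP; rewrite -subr_eq0 -scalerBl scaler_eq0 (negPf nz) orbF.
have -> : r * - r * r - - r * r * - r = - (2%:R * (r ^+ 2 * r)) by ring.
rewrite e2 mul1r oppr_eq0 mulf_eq0 (negPf nz2) /=.
move=> /eqP r0; move: e2; rewrite r0 expr0n /= => /eqP; rewrite eq_sym oner_eq0.
by [].
Qed.

End Closure.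
End JucysMurphy.

(** * Combinatorial consequences of the local rules for weights *)

Section OkounkovVershik.
Variables (F : fieldType) (l : nat) (W : (nat -> F) -> Prop).
(* The Okounkov-Vershik axioms for the set of weights. *)
Hypothesis W0 : forall c, (0 < l)%N -> W c -> c 0%N = 0.
Hypothesis W1 : forall c i, (i.+1 < l)%N -> W c -> c i != c i.+1.
Hypothesis W2 : forall c i, (i.+1 < l)%N -> W c -> (c i.+1 - c i) ^+ 2 != 1 -> W (sw i c).
Hypothesis W3 : forall c i, (i.+2 < l)%N -> W c -> c i = c i.+2 -> (c i.+1 - c i) ^+ 2 != 1.

(** Without such a [j], the value at [q] could be swapped down to position 1 and then past position
    0. Both values would have to be 0, although adjacent values differ. *)
Lemma ov_neighbour q c : (0 < q)%N -> (q < l)%N -> W c ->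
  exists2 j, (j < q)%N & (c j - c q) ^+ 2 = 1.
Proof.
move=> q0 ql Wc.
have [/existsP [j /eqP H]|/existsPn no] := boolP [exists j : 'I_q, (c j - c q) ^+ 2 == 1].
  by exists j.
have {}no j : (j < q)%N -> (c j - c q) ^+ 2 != 1 by move=> jq; apply: (no (Ordinal jq)).
exfalso; elim: q c q0 ql Wc no => // q IH c _ ql Wc no.
have Ws : W (sw q c) by apply: W2 => //; rewrite -sqrrN opprB no.
case: q IH ql no Ws => [|q] IH ql no Ws.
  have := W1 ql Wc; have := W0 (ltn_trans _ ql) Ws; rewrite swL => -> //.
  by rewrite (W0 _ Wc) ?eqxx //; apply: ltn_trans ql.
apply: (IH _ _ _ Ws) => // [|j jq]; first exact: ltnW.
by rewrite swL swD; [apply: no; lia|lia|lia].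
Qed.

(** Induction on the gap between two equal values. An inner neighbour at distance other than 1 or -1
    can be swapped outwards, which shrinks the gap. Otherwise a neighbour already has the value
    sought, or both have the opposite one. *)
Lemma ov_between g c j q e : q = (j + g).+1 -> (q < l)%N -> W c -> c j = c q -> e ^+ 2 = 1 ->
  exists t, [/\ (j < t)%N, (t < q)%N & c t = c j + e].
Proof.
have [N] := ubnP g; elim: N g c j q e => // N IH g c j q e; rewrite ltnS => gN.
move=> qE ql Wc cE e1.
case: g gN qE => [|g] gN qE.
  have qE' : q = j.+1 by lia.
  by have := @W1 c j; rewrite -qE' => /(_ ql Wc); rewrite cE eqxx.
have jl : (j.+1 < l)%N by lia.
have [E1|/(W2 jl Wc) Ws] := eqVneq ((c j.+1 - c j) ^+ 2) 1; last first.
  have [| | | |t [jt tq ct]] := IH g _ j.+1 q e _ _ _ Ws _ e1; try lia.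
    by rewrite swR swD //; lia.
  by exists t; move: ct; rewrite swR swD //; [split=> //; lia|lia|lia].
have [q' qE'] : exists q', q = q'.+1 by exists (j + g.+1)%N.
have ql' : (q'.+1 < l)%N by rewrite -qE'.
have [E2|ne2] := eqVneq ((c q'.+1 - c q') ^+ 2) 1; last first.
  have Ws := W2 ql' Wc ne2.
  have [| | | |t [jt tq ct]] := IH g _ j q' e _ _ _ Ws _ e1; try lia.
    by rewrite swL swD -?qE' //; lia.
  by exists t; move: ct; rewrite [sw _ _ j]swD ?swD //; [split=> //; lia|lia|lia|lia|lia].
have sq x y : (x - y) ^+ 2 = 1 -> x = y + e \/ x = y - e.
  move/eqP; rewrite -e1 eqf_sqr subr_eq subr_eq addrC => /orP [/eqP|/eqP] ->; first by left.
  by right; rewrite addrC.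
have [ce|ce] := sq _ _ E1; first by exists j.+1; split => //; lia.
have [ce'|ce'] : c q' = c j + e \/ c q' = c j - e.
    by rewrite cE qE'; apply: sq; rewrite -sqrrN opprB.
  by exists q'; split => //; lia.
case: g gN qE => [|g] gN qE.
  have := @W3 c j; rewrite (_ : j.+2 = q); last by lia.
  by move=> /(_ ql Wc cE); rewrite E1 eqxx.
(* Both inner neighbours equal [c j - e]. Between them [c j] occurs again, and this occurrence
   together with [j] bounds a shorter gap. The gap of length one, where the two neighbours coincide,
   was excluded by the braid rule. *)
have [| | | |t [jt tq ct]] := IH g c j.+1 q' e _ _ _ Wc _ e1; try lia.
  by rewrite ce ce'.
have ctj : c t = c j by rewrite ct ce subrK.
have [| | | |t' [jt' tq' ct']] := IH (t - j.+1)%N c j t e _ _ _ Wc _ e1; try lia.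
  by [].
by exists t'; split => //; lia.
Qed.
End OkounkovVershik.

(** * Weights as residue sequences of standard tableaux *)

Section Nodes.
Implicit Types (t : nat -> nat * nat) (x : nat * nat).

Definition addable k t x := [/\ forall j, (j < k)%N -> t j <> x,
  forall r c, x = (r.+1, c) -> exists2 j, (j < k)%N & t j = (r, c) &
  forall r c, x = (r, c.+1) -> exists2 j, (j < k)%N & t j = (r, c)].

(* Standard tableaux as growth sequences: [t k] is the node of the entry k+1.
   Prefixes of such a [t] make sense without reference to a shape. *)
Definition pstd l t := forall k, (k < l)%N -> addable k t (t k).

Lemma pstd_le l l' t : (l' <= l)%N -> pstd l t -> pstd l' t.
Proof. by move=> le H k kl; apply: H; apply: leq_trans le. Qed.

Lemma pstd_down l t k r c : pstd l t -> (k < l)%N -> (r <= (t k).1)%N -> (c <= (t k).2)%N ->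
  exists2 j, (j <= k)%N & t j = (r, c).
Proof.
move=> H; have [N] := ubnP ((t k).1 - r + ((t k).2 - c))%N.
elim: N k => // N IH k; rewrite ltnS => lN kl rk ck.
have [_ Hr Hc] := H _ kl; case E : (t k) => [r0 c0] in lN rk ck Hr Hc *.
move: rk ck lN => /= rk ck lN.
have [er|nr] := eqVneq r r0; last first.
  case: r0 => [|r0] in E rk lN Hr Hc nr; first by lia.
  have [j jk Ej] := Hr _ _ (erefl _).
  have [||||i ij Ei] := IH j; rewrite ?Ej /=; try lia.
  by exists i => //; lia.
have [ec|nc] := eqVneq c c0; first by exists k; rewrite // er ec.
case: c0 => [|c0] in E ck lN Hr Hc nc; first by lia.
have [j jk Ej] := Hc _ _ (erefl _).
have [||||i ij Ei] := IH j; rewrite ?Ej /=; try lia.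
by exists i => //; lia.
Qed.

Lemma pstd_inj l t j k : pstd l t -> (j < l)%N -> (k < l)%N -> t j = t k -> j = k.
Proof.
move=> H jl kl E; case: (ltngtP j k) => // h; [have [H' _ _] := H _ kl|have [H' _ _] := H _ jl].
  by case: (H' _ h).
by case: (H' _ h).
Qed.

Lemma pstd_size l t (s : seq (nat * nat)) : uniq s ->
  (forall x, x \in s -> exists2 j, (j < l)%N & t j = x) -> (size s <= l)%N.
Proof.
move=> us H; rewrite -(size_iota 0 l) -(size_map t).
apply: uniq_leq_size => // x /H [j jl <-]; apply: map_f.
by rewrite mem_iota.
Qed.

(** The hook at the corner with [c] nodes in the first row and [r] nodes below them in the first
    column. Fitting such hooks into a diagram is the means of bounding differences of contents. *)
Definition hook_nodes r c := [seq (0%N, j) | j <- iota 0 c] ++ [seq (i, 0%N) | i <- iota 1 r].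

Lemma hook_nodes_uniq r c : uniq (hook_nodes r c).
Proof.
rewrite cat_uniq !map_inj_uniq ?iota_uniq //; try by move=> a b [].
rewrite andbT /=; apply/hasPn => x /mapP [i]; rewrite mem_iota => i1 ->.
by apply/mapP => -[j _ []]; lia.
Qed.

Lemma size_hook_nodes r c : size (hook_nodes r c) = (c + r)%N.
Proof. by rewrite size_cat !size_map !size_iota. Qed.

Lemma hook_nodesP r c x : x \in hook_nodes r c ->
  (x.1 = 0%N /\ (x.2 < c)%N) \/ (x.2 = 0%N /\ (0 < x.1 <= r)%N).
Proof.
by rewrite mem_cat => /orP [] /mapP [j]; rewrite mem_iota => H ->; [left|right]; split => //=; lia.
Qed.

(** The hook reaching the column of one node and the row of the other lies in the diagram. Contents
    in a diagram of at most [p] nodes therefore differ by less than [p]. *)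
Lemma pstd_hook l t k k' : pstd l t -> (k < l)%N -> (k' < l)%N -> ((t k).2 + (t k').1 < l)%N.
Proof.
move=> H kl kl'; rewrite -addSn -size_hook_nodes; apply: (pstd_size (t := t)) (hook_nodes_uniq _ _) _.
case=> r c /hook_nodesP [] /= [-> lt].
  by have [j jk E] := pstd_down H kl (leq0n _) (ltnSE lt); exists j => //; lia.
have [j jk E] := pstd_down H kl' (r := r) (c := 0) ltac:(lia) (leq0n _).
by exists j => //; lia.
Qed.

Variables (F : fieldType) (p : nat).
Hypothesis hp : p \in [pchar F].

Lemma natr_inj_mod a b : a%:R = b%:R :> F -> [\/ a = b, (a + p <= b)%N | (b + p <= a)%N].
Proof.
wlog ab : a b / (a <= b)%N => [H E|].
  case/orP: (leq_total a b) => h; first exact: H.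
  by case: (H _ _ h (esym E)) => ?; [constructor 1|constructor 3|constructor 2].
move=> E; have : (b - a)%:R = 0 :> F by rewrite natrB // E subrr.
move/eqP; rewrite -(dvdn_pcharf hp) => /dvdnP [q Eq].
case: q Eq => [|q] Eq; first by constructor 1; lia.
by constructor 2; nia.
Qed.

Lemma resE x : res F x = x.2%:R - x.1%:R.
Proof. by rewrite /res intrB. Qed.

Lemma res_eq x y : res F x = res F y ->
  [\/ (x.2 + y.1 = y.2 + x.1)%N, (x.2 + y.1 + p <= y.2 + x.1)%N | (y.2 + x.1 + p <= x.2 + y.1)%N].
Proof.
rewrite !resE => E; apply: natr_inj_mod.
by apply/eqP; rewrite !natrD -subr_eq0 -[X in _ == X](subrr (x.2%:R - x.1%:R)) {2}E; apply/eqP; ring.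
Qed.

(** If the residue [c k] has occurred, let [j] be its last occurrence: the residues one above and
    one below, found after [j], must sit right of and below [t j], and the new node is the diagonal
    successor of [t j]. If it has not occurred, the new node ends the first row or the first column.
    The bound [k < p] turns equal residues into equal contents. *)
Lemma pstd_extend k t (c : nat -> F) : pstd k t -> (k < p)%N ->
  (forall j, (j < k)%N -> c j = res F (t j)) -> c 0%N = 0 ->
  (forall q, (0 < q)%N -> (q <= k)%N -> exists2 j, (j < q)%N & (c j - c q) ^+ 2 = 1) ->
  (forall j e, (j < k)%N -> c j = c k -> e ^+ 2 = 1 ->
     exists i, [/\ (j < i)%N, (i < k)%N & c i = c j + e]) ->
  exists2 x, addable k t x & c k = res F x.
Proof.
move=> H kp cE c0 o2 o3; case: (posnP k) => [k0|k0].
  exists (0, 0)%N; last by rewrite k0 c0 resE subrr.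
  by split=> [j|r c' []|r c' []] //; rewrite k0.
have [/existsP [j0 /eqP cj0]|/existsPn no] := boolP [exists j : 'I_k, c j == c k].
  pose P j := (j < k)%N && (c j == c k).
  have [j /andP [jk /eqP cj] jmax] : exists2 j, P j & forall i, P i -> (i <= j)%N.
    have exP : exists j, P j by exists j0; rewrite /P ltn_ord cj0 eqxx.
    have ubP i : P i -> (i <= k)%N by case/andP => /ltnW.
    by exists (ex_maxn exP ubP); case: ex_maxnP.
  have [t1 [jt1 tk1 c1]] := o3 j (-1) jk cj ltac:(by rewrite sqrrN expr1n).
  have [t2 [jt2 tk2 c2]] := o3 j 1 jk cj ltac:(by rewrite expr1n).
  case E : (t j) => [r c'].
  (* The node of [t1] has the content of [(r.+1, c')]. In row [r] or higher it would lie north-west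
     of [t j] and precede it, so it lies low enough for the diagram to contain [(r.+1, c')]. *)
  have L1 : exists2 i, (i < k)%N & t i = (r.+1, c').
    case E1 : (t t1) => [r1 c1'].
    have := @res_eq (t t1) (r.+1, c'); rewrite -(cE _ tk1) c1 (cE _ jk) E !resE /= => -[].
    - by rewrite -natr1; ring.
    - rewrite E1 /= => e; case: (leqP r.+1 r1) => h.
        have [||i ik Ei] := @pstd_down _ _ _ (r.+1) (c') H tk1; rewrite ?E1 /=; try lia.
        by exists i => //; lia.
      have [||i ik Ei] := @pstd_down _ _ _ (r1) (c1') H jk; rewrite ?E /=; try lia.
      have /(_ tk1 ltac:(lia)) := pstd_inj (j := t1) (k := i) H; rewrite E1 Ei => /(_ erefl); lia.
    - by have := pstd_hook H tk1 jk; have := pstd_hook H jk tk1; rewrite E1 E /=; lia.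
    - by have := pstd_hook H tk1 jk; have := pstd_hook H jk tk1; rewrite E1 E /=; lia.
  have L2 : exists2 i, (i < k)%N & t i = (r, c'.+1).
    case E1 : (t t2) => [r1 c1'].
    have := @res_eq (t t2) (r, c'.+1); rewrite -(cE _ tk2) c2 (cE _ jk) E !resE /= => -[].
    - by rewrite -natr1; ring.
    - rewrite E1 /= => e; case: (leqP r r1) => h.
        have [||i ik Ei] := @pstd_down _ _ _ (r) (c'.+1) H tk2; rewrite ?E1 /=; try lia.
        by exists i => //; lia.
      have [||i ik Ei] := @pstd_down _ _ _ (r1) (c1') H jk; rewrite ?E /=; try lia.
      have /(_ tk2 ltac:(lia)) := pstd_inj (j := t2) (k := i) H; rewrite E1 Ei => /(_ erefl); lia.
    - by have := pstd_hook H tk2 jk; have := pstd_hook H jk tk2; rewrite E1 E /=; lia.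
    - by have := pstd_hook H tk2 jk; have := pstd_hook H jk tk2; rewrite E1 E /=; lia.
  exists (r.+1, c'.+1); last by rewrite -cj (cE _ jk) E !resE /= -!natr1; ring.
  split; last first.
  - by move=> ? ? [<- <-].
  - by move=> ? ? [<- <-].
  move=> i ik Ei.
  have ij : (i <= j)%N.
    apply: jmax; rewrite /P ik /= -cj (cE _ ik) (cE _ jk) E Ei !resE /= -!natr1; apply/eqP; ring.
  have [j' ji' Ej'] := pstd_down H ik (r := r) (c := c') ltac:(by rewrite Ei) ltac:(by rewrite Ei).
  have /(_ ltac:(lia) jk) := pstd_inj (j := j') (k := j) H; rewrite Ej' E => /(_ erefl) jj.
  have ij' : i = j by lia.
  by move: Ei; rewrite ij' E => -[]; lia.
have {}no j : (j < k)%N -> c j != c k by move=> jk; apply: (no (Ordinal jk)).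
have [j jk] := o2 k k0 (leqnn _).
case E : (t j) => [r c'] /eqP; rewrite -[X in _ == X](expr1n _ 2) eqf_sqr !subr_eq => /orP [] /eqP e.
  have ck : c k = c j - 1 by rewrite e; ring.
  (* A node to the left of [t j] would have residue [c k], which has not occurred. *)
  have c'0 : c' = 0%N.
    case: c' E => // c' E.
    have [||i ik Ei] := @pstd_down _ _ _ (r) (c') H jk; rewrite ?E /=; try lia.
    have ik' : (i < k)%N by lia.
    case/eqP: (no _ ik'); rewrite ck (cE _ ik') (cE _ jk) E Ei !resE /= -natr1; ring.
  exists (r.+1, 0%N); last by rewrite ck (cE _ jk) E c'0 !resE /= -natr1; ring.
  split=> [i ik Ei|? ? [<- <-]|? ? []] //; last by exists j => //; rewrite E c'0.
  case/eqP: (no _ ik); rewrite ck (cE _ ik) (cE _ jk) E Ei c'0 !resE /= -natr1; ring.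
have ck : c k = c j + 1 by rewrite e; ring.
have r0 : r = 0%N.
  case: r E => // r E.
  have [||i ik Ei] := @pstd_down _ _ _ (r) (c') H jk; rewrite ?E /=; try lia.
  have ik' : (i < k)%N by lia.
  case/eqP: (no _ ik'); rewrite ck (cE _ ik') (cE _ jk) E Ei !resE /= -natr1; ring.
exists (0%N, c'.+1); last by rewrite ck (cE _ jk) E r0 !resE /= -natr1; ring.
split=> [i ik Ei|? ? []|? ? [<- <-]] //; last by exists j => //; rewrite E r0.
case/eqP: (no _ ik); rewrite ck (cE _ ik) (cE _ jk) E Ei r0 !resE /= -natr1; ring.
Qed.

End Nodes.

(** * Semisimplicity of the Jucys-Murphy elements *)

Section EigenTools.
Variables (F : fieldType) (d : nat).
Implicit Types (A : 'M[F]_d) (v : 'rV[F]_d).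

Definition rootprod A (s : seq F) : 'M_d := foldr (fun b M => (A - b%:M) *m M) 1%:M s.

Lemma rootprod_eigen A v a s : v *m A = a *: v -> v *m rootprod A s = (\prod_(b <- s) (a - b)) *: v.
Proof.
move=> va; elim: s => [|b s IH] /=; first by rewrite mulmx1 big_nil scale1r.
by rewrite mulmxA mulmxBr va mul_mx_scalar -scalerBl -scalemxAl IH scalerA big_cons.
Qed.

Lemma prod_sub_eq0 (a : F) s : (\prod_(b <- s) (a - b) == 0) = (a \in s).
Proof.
elim: s => [|b s IH]; first by rewrite big_nil oner_eq0.
by rewrite big_cons mulf_eq0 IH subr_eq0 inE.
Qed.

(** A matrix annihilated by a product of distinct linear factors has no Jordan block. Annihilation
    is required for every ordering of [s], so that the factor for [a] may be put in front without
    discussing commutation. *)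
Lemma rootprod_ss A s : (forall t, perm_eq t s -> rootprod A t = 0) -> uniq s ->
  forall a (u v : 'rV_d), v *m A = a *: v -> u *m A = a *: u - v -> v = 0.
Proof.
move=> H us a u v va ua; have [//|nz] := eqVneq v 0.
have := rootprod_eigen s va; rewrite (H s) // mulmx0 => /esym/eqP.
rewrite scaler_eq0 (negPf nz) orbF prod_sub_eq0 => sa.
have /esym := congr1 (mulmx u) (H _ (etrans (perm_sym _ _) (perm_to_rem sa))); rewrite [in RHS]/= mulmx0 mulmxA.
have -> : u *m (A - a%:M) = - v by rewrite mulmxBr ua mul_mx_scalar addrAC subrr sub0r.
rewrite mulNmx (rootprod_eigen _ va) => /esym/eqP.
by rewrite oppr_eq0 scaler_eq0 (negPf nz) orbF prod_sub_eq0 mem_rem_uniq // !inE eqxx.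
Qed.
End EigenTools.

Lemma stable_eigenvector (F : closedFieldType) d q (V : 'M[F]_(q, d)) (A : 'M_d) :
  V != 0 -> (V *m A <= V)%MS -> exists a, exists2 v : 'rV_d, v != 0 & (v <= V)%MS /\ v *m A = a *: v.
Proof.
move=> nz st; pose B := row_base V; pose X := B *m A *m pinvmx B.
have BX : X *m B = B *m A.
  apply: mulmxKpV; rewrite !eq_row_base.
  by apply: submx_trans st; rewrite submxMr ?eq_row_base.
have r0 : (0 < \rank V)%N by rewrite lt0n mxrank_eq0.
have /closed_rootP [a] : size (char_poly X) != 1%N.
  by rewrite size_char_poly; case: (\rank V) r0.
rewrite -eigenvalue_root_char => /eigenvalueP [y ya ynz].
exists a, (y *m B).
  by rewrite mulmx_free_eq0 ?row_base_free.
split; first by rewrite mulmx_sub // eq_row_base.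
by rewrite -mulmxA -BX mulmxA ya scalemxAl.
Qed.

Lemma two_neq0 (F : fieldType) p : p \in [pchar F] -> (2 < p)%N -> 2%:R != 0 :> F.
Proof. by move=> hp p2; rewrite -(dvdn_pcharf hp); apply/negP => /dvdn_leq; lia. Qed.

Section Classification.
Variables (F : closedFieldType) (m d : nat).
Local Notation n := m.+1.
Hypothesis hp : n \in [pchar F].
Variable rG : mx_representation F [set: 'S_n]%G d.
Local Notation jm := (jm rG).
Local Notation s i := (rG (sgen n i.+1)).

(** [W] is cut down by one eigenspace at a time; since the operators commute, every intersection is
    still stable under the remaining ones. *)
Lemma joint_eigenvector (W : 'M[F]_d) k : (k <= n)%N -> W != 0 ->
  (forall j, (j < k)%N -> (W *m jm j <= W)%MS) ->
  exists c, exists2 w : 'rV_d, w != 0 & (w <= W)%MS /\ wv rG k c w.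
Proof.
move=> kn nz st.
suff H : forall k', (k' <= k)%N -> exists c, exists2 V : 'M[F]_d, V != 0 &
    [/\ (V <= W)%MS, forall j, (j < k)%N -> (V *m jm j <= V)%MS &
        forall j, (j < k')%N -> V *m jm j = c j *: V].
  have [c [V Vnz [VW _ Vc]]] := H k (leqnn _).
  have [i nzi] : exists i, row i V != 0.
    apply/existsP; apply: contra_neqT Vnz => /existsPn no; apply/row_matrixP => i.
    by rewrite row0; apply/eqP; rewrite -[_ == _]negbK no.
  exists c, (row i V) => //; split; first by apply: submx_trans VW; apply: row_sub.
  by move=> j jk; rewrite -row_mul Vc // linearZ.
elim=> [_|k' IH kk']; first by exists (fun=> 0), W.
have [c [V Vnz [VW Vst Vc]]] := IH (ltnW kk').
have [a [v vnz [vV va]]] := stable_eigenvector Vnz (Vst _ kk').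
exists (fun j => if j == k' then a else c j).
exists (V :&: eigenspace (jm k') a)%MS.
  apply: contraNneq vnz => E; rewrite -submx0 -E sub_capmx vV.
  by apply/eigenspaceP.
split.
- by apply: submx_trans VW; apply: capmxSl.
- move=> j jk; rewrite sub_capmx; apply/andP; split.
    by apply: submx_trans (Vst _ jk); rewrite submxMr ?capmxSl.
  apply/eigenspaceP; rewrite -mulmxA jm_comm; try lia.
  rewrite mulmxA (eigenspaceP (capmxSr _ _)) scalemxAl //.
- move=> j jk; case: eqP => [->|ne]; first by apply/eigenspaceP/capmxSr.
  have /submxP [D ->] := capmxSl V (eigenspace (jm k') a).
  by rewrite -mulmxA Vc -?scalemxAr //; lia.
Qed.

Section Step.
Variable k : nat.
Hypothesis kn : (k <= n)%N.
Hypothesis ss : jm_ss rG k.-1.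

Lemma wt_ov_neighbour q c : (0 < q)%N -> (q < k)%N -> wt rG k c ->
  exists2 j, (j < q)%N & (c j - c q) ^+ 2 = 1.
Proof.
apply: ov_neighbour => [c' k0|c' i ik|c' i ik].
- exact: wt_zero.
- exact: wt_adj.
- exact: wt_swap.
Qed.

Lemma wt_ov_between c j q e : (j < q)%N -> (q < k)%N -> wt rG k c -> c j = c q ->
  e ^+ 2 = 1 -> exists t, [/\ (j < t)%N, (t < q)%N & c t = c j + e].
Proof.
move=> jq; have qE : q = (j + (q - j.+1)).+1 by lia.
apply: (ov_between (l := k) (W := wt rG k)) qE => [c' i ik|c' i ik|c' i ik].
- exact: wt_adj.
- exact: wt_swap.
- by apply: wt_braid => //; apply: (two_neq0 hp); lia.
Qed.

Lemma wt_nodes c : wt rG k c ->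
  exists2 t, pstd k t & forall j, (j < k)%N -> c j = res F (t j).
Proof.
move=> wc.
suff H : forall l, (l <= k)%N -> exists2 t, pstd l t & forall j, (j < l)%N -> c j = res F (t j).
  exact: H.
elim=> [_|l IH lk]; first by exists (fun=> (0, 0)%N).
have [t tl tc] := IH (ltnW lk).
have [||||q q0 ql|j e jl|x ax xc] := @pstd_extend F n hp l t c => //.
- lia.
- by apply: (wt_zero (rG := rG) (l := k)) => //; lia.
- by apply: wt_ov_neighbour => //; lia.
- by apply: wt_ov_between => //.
have tE j : (j < l)%N -> (if (j < l)%N then t j else x) = t j by move=> ->.
exists (fun j => if (j < l)%N then t j else x) => j; rewrite ltnS leq_eqVlt => /predU1P [->|jl].
- rewrite ltnn; case: ax => a1 a2 a3; split.
  + by move=> i il; rewrite il; apply: a1.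
  + by move=> r c' /a2 [i il Ei]; exists i; rewrite ?il.
  + by move=> r c' /a3 [i il Ei]; exists i; rewrite ?il.
- rewrite jl; case: (tl _ jl) => a1 a2 a3; split.
  + by move=> i il; rewrite (ltn_trans il jl); apply: a1.
  + by move=> r c' /a2 [i il Ei]; exists i; rewrite ?(ltn_trans il jl).
  + by move=> r c' /a3 [i il Ei]; exists i; rewrite ?(ltn_trans il jl).
- by rewrite ltnn.
- by rewrite jl tc.
Qed.

(** Weights are coded by finite functions with values in ['I_n], representing prime-field elements,
    so that the sum over all weight spaces is a finite one. *)
Definition wsp (c : {ffun 'I_n -> 'I_n}) : 'M[F]_d :=
  (\bigcap_(i < k) eigenspace (jm i) (c (inord i))%:R)%MS.

Definition cf (c : {ffun 'I_n -> 'I_n}) j : F := (c (inord j))%:R.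

Lemma wspP c (v : 'rV_d) : reflect (wv rG k (cf c) v) (v <= wsp c)%MS.
Proof.
apply: (iffP sub_bigcapmxP) => [H j jk|H i _].
  by apply/eigenspaceP; apply: (H (Ordinal jk)).
by apply/eigenspaceP; apply: H.
Qed.

Definition wsum : 'M[F]_d := (\sum_c wsp c)%MS.

Lemma wsum_sgen i : (i.+1 < k)%N -> (wsum *m s i <= wsum)%MS.
Proof.
move=> ik; rewrite /wsum sumsmxMr; apply/sumsmx_subP => c _; apply/row_subP => r.
rewrite row_mul; set v := row r _; have /wspP wv : (v <= wsp c)%MS by apply: row_sub.
have [->|nz] := eqVneq v 0; first by rewrite mul0mx sub0mx.
have ne : cf c i != cf c i.+1 by apply: (wt_adj kn ss) => //; exists v.
have := wv_swap kn ik wv ne; set r0 := (_ - _)^-1; set v' := _ - _ => wv'.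
have -> : v *m s i = v' + r0 *: v by rewrite subrK.
apply: addmx_sub; last first.
  by rewrite scalemx_sub // (sumsmx_sup c) //; apply/wspP.
apply: (sumsmx_sup [ffun a => c (sgen n i.+1 a)]) => //; apply/wspP.
apply: wv_ext wv' => j jk; rewrite /cf ffunE.
have [->|n1] := eqVneq j i; first by rewrite swL sgen_inordL.
have [->|n2] := eqVneq j i.+1; first by rewrite swR sgen_inordR.
by rewrite swD // sgen_inordD //; lia.
Qed.

(** One block for the entries below [k] and singletons above it: the associated Young subgroup is
    the copy of [S_k] in [S_n]. *)
Definition below_class (a : 'I_n) : nat := if (a < k)%N then 0%N else a.

Definition below : {set 'S_n} := [set t : 'S_n | [forall a, below_class (t a) == below_class a]].

Lemma belowP (t : 'S_n) : reflect (forall a, below_class (t a) = below_class a) (t \in below).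
Proof. by rewrite inE; apply: (iffP forallP) => H a; apply/eqP. Qed.

Lemma below_group_set : group_set below.
Proof.
apply/group_setP; split=> [|t u /belowP Ht /belowP Hu]; apply/belowP => a.
  by rewrite perm1.
by rewrite permM Hu Ht.
Qed.
Canonical below_group := Group below_group_set.

Lemma below_fix (t : 'S_n) (a : 'I_n) : t \in below -> (k <= a)%N -> t a = a.
Proof.
move=> /belowP/(_ a); rewrite /below_class [in RHS]ltnNge => + ka; rewrite ka /=.
by case: ltnP => [lt a0|_ E]; [exfalso; lia|apply: ord_inj].
Qed.

Lemma tperm_below (j : 'I_n) l : (j < k)%N -> (l < k)%N -> tperm j (inord l) \in below.
Proof.
move=> jk lk; apply/belowP => a; have ln : (l < n)%N by apply: leq_trans kn.
by case: tpermP => [->|->|//]; rewrite /below_class jk inordK ?lk.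
Qed.

Lemma card_below : (k < n)%N -> #|below|%:R != 0 :> F.
Proof.
move=> kn'; have -> : #|below| = k`!%N.
  have <- : #|[set a : 'I_n | (a < k)%N]| = k := card_ord_below kn.
  rewrite -card_perm; apply: eq_card => t; rewrite [RHS]unfold_in.
  apply/belowP/subsetP => H a.
    rewrite !inE; apply: contraNT; rewrite -leqNgt => ka; apply/eqP/below_fix => //.
    exact/belowP.
  have [ta|ta] := eqVneq (t a) a; first by rewrite ta.
  have := H a ta; rewrite inE /below_class => ->.
  have := H (t a); rewrite !inE /= (inj_eq perm_inj) ta => /(_ isT) -> //.
elim: (k) kn' => [_|j IH jn]; first by rewrite fact0 oner_eq0.
rewrite factS natrM mulf_neq0 ?IH //; last exact: ltnW.
by rewrite -(dvdn_pcharf hp); apply/negP => /dvdn_leq; lia.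
Qed.

Lemma wsum_below : mxmodule (subg_repr rG (subsetT below)) wsum.
Proof.
apply/mxmoduleP => t tB; rewrite /=.
have [k0|k0] := posnP k.
  rewrite (_ : t = 1%g) ?repr_mx1 ?mulmx1 //.
  by apply/permP => a; rewrite perm1 below_fix // k0.
have Hc := belowP _ tB.
apply: (young_ind (e := below_class) (P := fun u => (wsum *m rG u <= wsum)%MS)) Hc.
- by move=> a b ab; rewrite /below_class; case: ltnP => [_|ka] //; case: ltnP => kb //; lia.
- by rewrite repr_mx1 mulmx1.
- move=> u u' Hu Hu'; rewrite repr_mxM ?inE // mulmxA.
  by apply: submx_trans Hu'; rewrite submxMr.
- move=> i lt; rewrite /below_class !inordK // ?(ltnW lt) //.
  case: (ltnP i.+1 k) => [ik _|ki]; first exact: wsum_sgen.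
  by case: ltnP => [_|_]; lia.
Qed.

(** A Maschke complement of the sum of weight spaces, if nonzero, would contain a joint eigenvector.
    By the classification its weight lies in the prime field, so the vector lies in the sum as
    well. *)
Lemma wsum_full : (k < n)%N -> (1%:M <= wsum)%MS.
Proof.
move=> kn'; have pg : ([pchar F]^'.-group below_group)%g by rewrite /pgroup pcharf'_nat card_below.
have [W modW UW dx] := mx_Maschke_pchar (subg_repr rG (subsetT below)) pg wsum_below (submx1 _).
rewrite -UW; have [->|Wnz] := eqVneq W 0; first by rewrite addsmx0_id.
have st j : (j < k)%N -> (W *m jm j <= W)%MS.
  move=> jk; rewrite mulmx_sumr summx_sub // => i ij.
  apply: (mxmoduleP modW); apply: tperm_below => //; exact: ltn_trans jk.
have [c [w wnz [wW wc]]] := joint_eigenvector kn Wnz st.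
have [|t tk tc] := @wt_nodes c; first by exists w.
have b_ex (j : 'I_n) : exists b : 'I_n, (j < k)%N -> c j = b%:R.
  have [jk|jk] := ltnP j k; last by exists ord0.
  have n0 : (0 < n)%N by [].
  (* A natural number congruent to the content of the node modulo [n], avoiding subtraction. *)
  pose z := ((t j).2 + (n - 1) * (t j).1)%N.
  exists (Ordinal (ltn_pmod z n0)) => _; rewrite tc // resE /=.
  have -> : (z %% n)%:R = z%:R :> F.
    by rewrite {2}(divn_eq z n) natrD natrM (pcharf0 hp) mulr0 add0r.
  by rewrite natrD natrM natrB // (pcharf0 hp) sub0r mulN1r.
have /fin_all_exists [b Hb] := b_ex.
case/eqP: wnz; apply/eqP; rewrite -submx0 -(mxdirect_addsP dx) sub_capmx wW andbT.
apply: (sumsmx_sup [ffun j => b j]) => //; apply/wspP; apply: wv_ext wc => j jk.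
by rewrite /cf ffunE -Hb ?inordK //; apply: leq_trans kn.
Qed.

Lemma wsum_ss : (k < n)%N -> jm_ss rG k.
Proof.
move=> kn' i a u v ik va ua.
apply: (@rootprod_ss _ _ (jm i) [seq (nat_of_ord b)%:R | b <- enum 'I_n]) va ua; last first.
  rewrite map_inj_in_uniq ?enum_uniq // => x y _ _ /(natr_inj_mod hp) [] /=.
  - exact: ord_inj.
  - by have := ltn_ord y; lia.
  - by have := ltn_ord x; lia.
move=> t tP; rewrite -[LHS]mul1mx; apply/eqP; rewrite -submx0.
apply: submx_trans (submxMr _ (wsum_full kn')) _; rewrite /wsum sumsmxMr.
apply/sumsmx_subP => c _; apply/row_subP => r; rewrite row_mul.
have /wspP/(_ _ ik) wc : (row r (wsp c) <= wsp c)%MS by apply: row_sub.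
rewrite (rootprod_eigen _ wc) (_ : \prod_(_ <- _) _ = 0) ?scale0r ?sub0mx //.
apply/eqP; rewrite prod_sub_eq0 (perm_mem tP) /cf; apply/mapP.
by exists (c (inord i)); rewrite ?mem_enum.
Qed.

End Step.

(** Each step uses semisimplicity below [k] to classify the weights of [S_(k+1)], then Maschke for
    that group, whose order is prime to the characteristic as long as [k + 1 < n]. *)
Lemma jm_semisimple k : (k < n)%N -> jm_ss rG k.
Proof.
elim: k => [_ i a u v //|k IH kn]; apply: wsum_ss => //; first exact: ltnW.
by apply: IH; apply: ltnW.
Qed.

Lemma weight_nodes c : wt rG n c ->
  exists2 t, pstd n t & forall j, (j < n)%N -> c j = res F (t j).
Proof. by apply: wt_nodes => //; apply: jm_semisimple. Qed.

Lemma weight_exists : (0 < d)%N -> exists c, wt rG n c.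
Proof.
move=> d0; have nz : (1%:M : 'M[F]_d) != 0 by rewrite -mxrank_eq0 mxrank1 -lt0n.
have [j _|c [w wnz [_ wc]]] := joint_eigenvector (leqnn n) nz; first by rewrite submx1.
by exists c, w.
Qed.

End Classification.

(** * Addable nodes, and growth sequences determined by residues *)

Section AddableNodes.
Variables (k : nat) (t : nat -> nat * nat).
Hypothesis tk : pstd k t.

Lemma addable_ext t' x : (forall j, (j < k)%N -> t j = t' j) -> addable k t x -> addable k t' x.
Proof.
move=> E [a1 a2 a3]; split.
- by move=> j jk; rewrite -E //; apply: a1.
- by move=> r c /a2 [j jk Ej]; exists j; rewrite -?E.
- by move=> r c /a3 [j jk Ej]; exists j; rewrite -?E.
Qed.

Lemma addable_down x y : addable k t x -> (y.1 <= x.1)%N -> (y.2 <= x.2)%N -> y <> x ->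
  exists2 j, (j < k)%N & t j = y.
Proof.
case: x y => [r c] [r' c'] [_ a2 a3] /= rr cc ne.
have [er|nr] := eqVneq r' r; last first.
  case: r => [|r] in a2 a3 rr ne nr; first by lia.
  have [j jk Ej] := a2 _ _ erefl.
  have [||i ij Ei] := @pstd_down _ _ _ r' c' tk jk; rewrite ?Ej /=; try lia.
  by exists i => //; lia.
have nc : c' != c by apply/eqP => ec; case: ne; rewrite er ec.
case: c => [|c] in a2 a3 cc ne nc; first by lia.
have [j jk Ej] := a3 _ _ erefl.
have [||i ij Ei] := @pstd_down _ _ _ r' c' tk jk; rewrite ?Ej /=; try lia.
by exists i => //; lia.
Qed.

Lemma addable_notin x j : addable k t x -> (j < k)%N -> t j <> x.
Proof. by case=> a1 _ _; apply: a1. Qed.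

(** Comparable addable nodes coincide, because everything north-west of an addable node is already
    present. For incomparable ones the hook stopping just short of both lies in the diagram, which
    gives the numerical bound. *)
Lemma addable_antichain x y : addable k t x -> addable k t y ->
  [\/ x = y, [/\ (x.1 < y.1)%N, (y.2 < x.2)%N & (x.2 + y.1 <= k.+1)%N] |
             [/\ (y.1 < x.1)%N, (x.2 < y.2)%N & (y.2 + x.1 <= k.+1)%N]].
Proof.
have bound u v : addable k t u -> addable k t v -> (u.1 < v.1)%N -> (v.2 < u.2)%N ->
    (u.2 + v.1 <= k.+1)%N.
  move=> au av r c; suff : (u.2 + v.1.-1 <= k)%N by lia.
  rewrite -size_hook_nodes; apply: (pstd_size (t := t)) (hook_nodes_uniq _ _) _ => w.
  case/hook_nodesP => -[e lt].
    by apply: (addable_down au) => //; [lia|lia|move=> E; rewrite E in lt; lia].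
  by apply: (addable_down av) => //; [lia|lia|move=> E; rewrite E in lt; lia].
have incomp u v : addable k t u -> addable k t v -> (u.1 <= v.1)%N -> (u.2 <= v.2)%N -> u = v.
  move=> au av r c; case: (eqVneq u v) => // /eqP ne.
  by have [j jk Ej] := addable_down av r c ne; case: (addable_notin au jk).
move=> ax ay; case: (leqP x.1 y.1) => r; case: (leqP x.2 y.2) => c.
- by constructor 1; apply: incomp.
- case: (ltngtP x.1 y.1) r => // [r|e] _.
    by constructor 2; split => //; apply: bound.
  by constructor 1; symmetry; apply: incomp => //; lia.
- case: (ltngtP x.2 y.2) c => // [c|e] _.
    by constructor 3; split => //; apply: bound.
  by constructor 1; symmetry; apply: incomp => //; lia.
- by constructor 1; symmetry; apply: incomp => //; apply: ltnW.
Qed.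
End AddableNodes.

(** At the first disagreement there would be two different addable nodes of equal residue. Their
    contents differ, but by at most one more than the number of nodes placed so far, hence by less
    than [p]. *)
Lemma pstd_prefix_eq (F : fieldType) p l t t' : p \in [pchar F] -> (l < p)%N ->
  pstd l t -> pstd l t' -> (forall j, (j < l)%N -> res F (t j) = res F (t' j)) ->
  forall j, (j < l)%N -> t j = t' j.
Proof.
move=> hp lp tl tl' E j; have [N] := ubnP j; elim: N j => // N IH j; rewrite ltnS => jN jl.
have IH' i : (i < j)%N -> t i = t' i by move=> ij; apply: IH => //; lia.
have tj := pstd_le (ltnW jl) tl.
have a' : addable j t (t' j).
  by apply: addable_ext (tl' _ jl) => i ij; rewrite IH'.
case: (addable_antichain tj (tl _ jl) a') => // -[r c b].
  by case: (res_eq hp (E _ jl)); lia.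
by case: (res_eq hp (E _ jl)); lia.
Qed.

(** * Translation between standard tableaux and growth sequences *)

Section Std.
Variables (m : nat).
Local Notation n := m.+1.
Implicit Types (T : tab n) (la : seq nat).

Definition nd T k : nat * nat := nodeof T k.+1.

Lemma ndE T k : nd T k = (nat_of_ord (T (inord k)).1, nat_of_ord (T (inord k)).2).
Proof. by []. Qed.

Lemma nd_ord T (a : 'I_n) : nd T a = (nat_of_ord (T a).1, nat_of_ord (T a).2).
Proof. by rewrite ndE inord_val. Qed.

Lemma nd_inj T U : (forall k, (k < n)%N -> nd T k = nd U k) -> T = U.
Proof.
move=> E; apply/ffunP => a; have := E a (ltn_ord a); rewrite !nd_ord => -[e1 e2].
by rewrite [LHS]surjective_pairing [RHS]surjective_pairing; congr (_, _); apply: ord_inj.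
Qed.

Lemma std_tab la T : T \in Std n la -> is_tab la T.
Proof. by rewrite inE => /and3P []. Qed.

Lemma std_row la T (a b : 'I_n) : T \in Std n la -> (T a).1 = (T b).1 -> ((T a).2 < (T b).2)%N -> (a < b)%N.
Proof.
rewrite inE => /and3P [_ /forallP/(_ a)/forallP/(_ b)/implyP H _] e lt.
by apply: H; rewrite e eqxx.
Qed.

Lemma std_col la T (a b : 'I_n) : T \in Std n la -> (T a).2 = (T b).2 -> ((T a).1 < (T b).1)%N -> (a < b)%N.
Proof.
rewrite inE => /and3P [_ _ /forallP/(_ a)/forallP/(_ b)/implyP H] e lt.
by apply: H; rewrite e eqxx.
Qed.

Lemma tab_in_shape la T k : is_tab la T -> ((nd T k).2 < nth 0%N la (nd T k).1)%N.
Proof. by case/andP => _ /forallP H; apply: H. Qed.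

Lemma std_pstd la T : is_part n la -> T \in Std n la -> pstd n (nd T).
Proof.
move=> pla sT k kn; have tT := std_tab sT; have := tT => /andP [/injectiveP iT _].
split.
- move=> j jk; rewrite !ndE => -[e1 e2].
  have := iT (inord j) (inord k); rewrite [T (inord j)]surjective_pairing [T (inord k)]surjective_pairing.
  rewrite (ord_inj e1) (ord_inj e2) => /(_ erefl) /(congr1 val) /=; rewrite !inordK //; lia.
- move=> r c E; have := tab_in_shape k tT; rewrite E /= => cl.
  have rn : (r < n)%N by move: E; rewrite ndE => -[e _]; have := ltn_ord (T (inord k)).1; lia.
  have cn : (c < n)%N by move: E; rewrite ndE => -[_ <-].
  have [|a Ea] := @tab_surj _ _ pla T (Ordinal rn) (Ordinal cn) tT.
    exact: leq_trans cl (is_part_nthS _ pla).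
  exists (nat_of_ord a); last by rewrite nd_ord Ea.
  rewrite -(inordK kn); apply: (std_col sT); move: E; rewrite ndE Ea => -[/= e1 e2].
    by apply: ord_inj.
  by rewrite e1.
- move=> r c E; have := tab_in_shape k tT; rewrite E /= => cl.
  have rn : (r < n)%N by move: E; rewrite ndE => -[<- _].
  have cn : (c < n)%N by move: E; rewrite ndE => -[_ e]; have := ltn_ord (T (inord k)).2; lia.
  have [|a Ea] := @tab_surj _ _ pla T (Ordinal rn) (Ordinal cn) tT; first exact: ltnW.
  exists (nat_of_ord a); last by rewrite nd_ord Ea.
  rewrite -(inordK kn); apply: (std_row sT); move: E; rewrite ndE Ea => -[/= e1 e2].
    by apply: ord_inj.
  by rewrite e2.
Qed.

Lemma std_shape la T (x : nat * nat) : is_part n la -> T \in Std n la -> (x.2 < nth 0%N la x.1)%N ->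
  exists2 k, (k < n)%N & nd T k = x.
Proof.
case: x => r c pla sT /= cl.
have rn : (r < n)%N.
  by rewrite (leq_trans _ (is_part_size pla)) // -(is_part_nth_gt0 _ pla); lia.
have cn : (c < n)%N by apply: leq_trans cl (is_part_nth_le _ pla).
have [a Ea] := @tab_surj _ _ pla T (Ordinal rn) (Ordinal cn) (std_tab sT) cl.
by exists (nat_of_ord a); rewrite ?ltn_ord // nd_ord Ea.
Qed.

Lemma nd_stab T i k : (i.+1 < n)%N -> (k < n)%N ->
  nd (stab i.+1 T) k = if k == i then nd T i.+1 else if k == i.+1 then nd T i else nd T k.
Proof.
move=> lt kn; rewrite ndE ffunE.
have [->|n1] := eqVneq k i; first by rewrite sgen_inordL -ndE.
have [->|n2] := eqVneq k i.+1; first by rewrite sgen_inordR -ndE.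
by rewrite sgen_inordD // -ndE.
Qed.

Lemma stabK T i : stab i.+1 (stab i.+1 T) = T.
Proof. by apply/ffunP => a; rewrite !ffunE -permM sgenK perm1. Qed.

(** The swap affects only the order of the two consecutive entries, so it can fail only if the first
    node is weakly north-west of the second. No entry fits between them, so the nodes are then
    adjacent. *)
Lemma stab_std la T i : is_part n la -> T \in Std n la -> (i.+1 < n)%N ->
  [\/ stab i.+1 T \in Std n la,
      nd T i.+1 = ((nd T i).1, (nd T i).2.+1) | nd T i.+1 = ((nd T i).1.+1, (nd T i).2)].
Proof.
move=> pla sT lt; have pT := std_pstd pla sT; have lt' := ltnW lt.
have [e|/eqP n1] := eqVneq (nd T i.+1) ((nd T i).1, (nd T i).2.+1); first by constructor 2.
have [e|/eqP n2] := eqVneq (nd T i.+1) ((nd T i).1.+1, (nd T i).2); first by constructor 3.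
constructor 1.
have vi : inord i = i :> nat := inordK lt'; have vi1 : inord i.+1 = i.+1 :> nat := inordK lt.
have key (a b : 'I_n) : ((T a).1 <= (T b).1)%N -> ((T a).2 <= (T b).2)%N -> (a < b)%N ->
    ~ (a = i :> nat /\ b = i.+1 :> nat).
  move=> r c ab [ai bi]; rewrite -[T a]/(T a) in r c.
  have Ea := nd_ord T a; have Eb := nd_ord T b; rewrite ai in Ea; rewrite bi in Eb.
  have [rr|rr] := eqVneq ((T a).1 : nat) (T b).1.
    have [cc|cc] := eqVneq ((T a).2 : nat) (T b).2.
      by have := pstd_inj pT lt' lt; rewrite Ea Eb rr cc => /(_ erefl); lia.
    have [_ _ Hc] := pT _ lt; have := Hc (T a).1 (T b).2.-1; rewrite Eb rr prednK; last by lia.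
    case=> // j ji Ej.
    have [||j' j'j Ej'] := @pstd_down _ _ _ (T a).1 (T a).2 pT (ltn_trans ji lt); rewrite ?Ej /=; try lia.
    have := pstd_inj pT (j := j') (k := i) ltac:(lia) lt'; rewrite Ej' Ea => /(_ erefl) e.
    have ei : j = i by lia.
    by case: n1; rewrite Eb Ea; move: Ej; rewrite ei Ea => -[e1 e2] /=; congr (_, _); lia.
  have [_ Hr _] := pT _ lt; have := Hr (T b).1.-1 (T b).2; rewrite Eb prednK; last by lia.
  case=> // j ji Ej.
  have [||j' j'j Ej'] := @pstd_down _ _ _ (T a).1 (T a).2 pT (ltn_trans ji lt); rewrite ?Ej /=; try lia.
  have := pstd_inj pT (j := j') (k := i) ltac:(lia) lt'; rewrite Ej' Ea => /(_ erefl) e.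
  have ei : j = i by lia.
  by case: n2; rewrite Eb Ea; move: Ej; rewrite ei Ea => -[e1 e2] /=; congr (_, _); lia.
have sw_lt (a b : 'I_n) : (sgen n i.+1 a < sgen n i.+1 b)%N ->
    ~ (sgen n i.+1 a = i :> nat /\ sgen n i.+1 b = i.+1 :> nat) -> (a < b)%N.
  by rewrite !sgen_val //; repeat case: eqP => ?; lia.
rewrite inE; apply/and3P; split.
- have /andP [/injectiveP iT /forallP shT] := std_tab sT; apply/andP; split.
    by apply/injectiveP => a b; rewrite !ffunE => /iT /perm_inj.
  by apply/forallP => a; rewrite ffunE.
- apply/forallP => a; apply/forallP => b; rewrite !ffunE; apply/implyP => /andP [/eqP e c].
  have ab := std_row sT e c; apply: sw_lt ab _; apply: (key _ _ _ (ltnW c)); first by rewrite e.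
  exact: (std_row sT e c).
- apply/forallP => a; apply/forallP => b; rewrite !ffunE; apply/implyP => /andP [/eqP e c].
  have ab := std_col sT e c; apply: sw_lt ab _; apply: (key _ _ (ltnW c)); first by rewrite e.
  exact: (std_col sT e c).
Qed.

End Std.

Lemma mem_down_closed (s : seq nat) c : uniq s ->
  (forall x y, x \in s -> (y <= x)%N -> y \in s) -> (c \in s) = (c < size s)%N.
Proof.
move=> us dc; apply/idP/idP => [cs|cs].
  rewrite -[c.+1](size_iota 0); apply: uniq_leq_size (iota_uniq _ _) _ => y.
  by rewrite mem_iota => ?; apply: dc cs _; lia.
apply: contraLR cs => nc; rewrite -leqNgt -[X in (_ <= X)%N](size_iota 0).
apply: uniq_leq_size us _ => x xs; rewrite mem_iota /= add0n ltnNge.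
by apply: contra nc => cx; apply: dc xs cx.
Qed.

(** * The shape and the tableau of a growth sequence *)

Section ShapeOfPstd.
Variables (m : nat).
Local Notation n := m.+1.
Variable t : nat -> nat * nat.
Hypothesis pt : pstd n t.

Definition row_seq r := [seq (t k).2 | k <- iota 0 n & (t k).1 == r].
Definition col0_seq := [seq (t k).1 | k <- iota 0 n & (t k).2 == 0%N].

Lemma mem_row_seq r c : reflect (exists2 k, (k < n)%N & t k = (r, c)) (c \in row_seq r).
Proof.
apply: (iffP mapP) => [[k]|[k kn E]].
  rewrite mem_filter mem_iota => /andP [/eqP e /andP [_ kn]] ->; exists k => //.
  by rewrite -e -surjective_pairing.
by exists k; rewrite ?mem_filter ?mem_iota E ?eqxx.
Qed.

Lemma mem_col0_seq r : reflect (exists2 k, (k < n)%N & t k = (r, 0)%N) (r \in col0_seq).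
Proof.
apply: (iffP mapP) => [[k]|[k kn E]].
  rewrite mem_filter mem_iota => /andP [/eqP e /andP [_ kn]] ->; exists k => //.
  by rewrite -e -surjective_pairing.
by exists k; rewrite ?mem_filter ?mem_iota E ?eqxx.
Qed.

Lemma row_seq_size r c : (c \in row_seq r) = (c < size (row_seq r))%N.
Proof.
apply: mem_down_closed => [|x y /mem_row_seq [k kn E] yx].
  rewrite map_inj_in_uniq ?filter_uniq ?iota_uniq // => j k.
  rewrite !mem_filter !mem_iota => /andP [/eqP e1 jn] /andP [/eqP e2 kn] e.
  by apply: (pstd_inj pt) => //; rewrite [t j]surjective_pairing [t k]surjective_pairing e1 e2 e.
have [|| j jk Ej] := @pstd_down _ _ _ r y pt kn; rewrite ?E //.
by apply/mem_row_seq; exists j => //; lia.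
Qed.

Lemma col0_seq_size r : (r \in col0_seq) = (r < size col0_seq)%N.
Proof.
apply: mem_down_closed => [|x y /mem_col0_seq [k kn E] yx].
  rewrite map_inj_in_uniq ?filter_uniq ?iota_uniq // => j k.
  rewrite !mem_filter !mem_iota => /andP [/eqP e1 jn] /andP [/eqP e2 kn] e.
  by apply: (pstd_inj pt) => //; rewrite [t j]surjective_pairing [t k]surjective_pairing e1 e2 e.
have [|| j jk Ej] := @pstd_down _ _ _ y 0 pt kn; rewrite ?E //.
by apply/mem_col0_seq; exists j => //; lia.
Qed.

Definition shape_of : seq nat := [seq size (row_seq r) | r <- iota 0 (size col0_seq)].

Lemma row0_col0 r : (0 < size (row_seq r))%N = (r < size col0_seq)%N.
Proof.
rewrite -row_seq_size -col0_seq_size.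
by apply/mem_row_seq/mem_col0_seq.
Qed.

Lemma nth_shape_of r : nth 0%N shape_of r = size (row_seq r).
Proof.
have [lt|ge] := ltnP r (size col0_seq).
  by rewrite (nth_map 0%N) ?size_iota // nth_iota.
rewrite nth_default; last by rewrite size_map size_iota.
have := row0_col0 r; rewrite [(r < _)%N]ltnNge ge lt0n => /negbFE/eqP ->.
by [].
Qed.

Lemma shape_of_part : is_part n shape_of.
Proof.
apply/and3P; split.
- apply/(sortedP 0%N) => r _; rewrite !nth_shape_of /=.
  case E : (size (row_seq r.+1)) => [//|c].
  have : c \in row_seq r.+1 by rewrite row_seq_size E.
  move=> /mem_row_seq [k kn Ek]; have [_ H _] := pt kn.
  have [j jk Ej] := H _ _ Ek; rewrite -row_seq_size; apply/mem_row_seq; exists j => //.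
  exact: ltn_trans kn.
- apply/allP => x /mapP [r]; rewrite mem_iota => /= rs ->.
  by rewrite row0_col0.
- rewrite sumnE big_map (eq_bigr (fun r => (\sum_(k <- iota 0 n) ((t k).1 == r))%N)); last first.
    by move=> r _; rewrite size_map size_filter -sum1_count big_mkcond; apply: eq_bigr => k _; case: eqP.
  rewrite exchange_big; apply/eqP; transitivity (\sum_(k <- iota 0 n) 1)%N; last by rewrite sum1_size size_iota.
  rewrite big_seq [RHS]big_seq; apply: eq_bigr => k; rewrite mem_iota => /= kn.
  transitivity (count_mem (t k).1 (iota 0 (size col0_seq))).
    by rewrite -sum1_count [RHS]big_mkcond; apply: eq_bigr => r _ /=; rewrite eq_sym; case: eqP.
  rewrite count_uniq_mem ?iota_uniq // mem_iota /= add0n -row0_col0 -row_seq_size.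
  by have [j jk Ej] := pstd_down pt kn (leqnn _) (leq0n _); case: mem_row_seq => // -[]; exists j => //; lia.
Qed.

Definition tab_of : tab n := [ffun a : 'I_n => (inord (t a).1, inord (t a).2)].

Lemma nd_tab_of k : (k < n)%N -> nd tab_of k = t k.
Proof.
move=> kn; rewrite ndE ffunE /= (inordK kn).
have := pstd_hook pt kn kn => h.
by rewrite !inordK -?surjective_pairing //; lia.
Qed.

Lemma tab_of_std : tab_of \in Std n shape_of.
Proof.
have E (a : 'I_n) : ((tab_of a).1 : nat, (tab_of a).2 : nat) = t a by rewrite -nd_ord nd_tab_of.
have E1 (a : 'I_n) : (tab_of a).1 = (t a).1 :> nat by rewrite -E.
have E2 (a : 'I_n) : (tab_of a).2 = (t a).2 :> nat by rewrite -E.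
rewrite inE; apply/and3P; split; first (apply/andP; split).
- apply/injectiveP => a b e; apply: ord_inj; apply: (pstd_inj pt) => //.
  by rewrite -!E e.
- apply/forallP => a; rewrite nth_shape_of E1 E2 -row_seq_size; apply/mem_row_seq.
  by exists (nat_of_ord a); rewrite // -surjective_pairing.
- apply/forallP => a; apply/forallP => b; rewrite E2 E2; apply/implyP => /andP [/eqP /(congr1 val) /=].
  rewrite E1 E1 => e c; have [||j jb Ej] := @pstd_down _ _ _ (t a).1 (t a).2 pt (ltn_ord b); [lia|lia|].
  have := @pstd_inj _ _ j a pt; rewrite Ej -surjective_pairing => H.
  have ja : j = a by apply: H => //; have := ltn_ord b; lia.
  by rewrite ltn_neqAle -ja jb andbT; apply: contraTneq c => jb'; rewrite -jb' Ej /= ltnn.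
- apply/forallP => a; apply/forallP => b; rewrite E1 E1; apply/implyP => /andP [/eqP /(congr1 val) /=].
  rewrite E2 E2 => e c; have [||j jb Ej] := @pstd_down _ _ _ (t a).1 (t a).2 pt (ltn_ord b); [lia|lia|].
  have := @pstd_inj _ _ j a pt; rewrite Ej -surjective_pairing => H.
  have ja : j = a by apply: H => //; have := ltn_ord b; lia.
  by rewrite ltn_neqAle -ja jb andbT; apply: contraTneq c => jb'; rewrite -jb' Ej /= ltnn.
Qed.

End ShapeOfPstd.

(** * Axial distance one modulo [p] *)

Section FarAddables.
Variables (F : fieldType) (n : nat).
Hypothesis hp : n \in [pchar F].

Lemma sqr_natr_eq1 D : (2 <= D)%N -> (D < n)%N -> (D%:R : F) ^+ 2 = 1 -> D = n.-1.
Proof.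
move=> D2 Dn /eqP; rewrite -[X in _ == X](expr1n _ 2) eqf_sqr => /orP [] /eqP e.
  by case: (@natr_inj_mod F n hp D 1 e); lia.
have : (D.+1)%:R = 0%:R :> F by rewrite -natr1 e addNr.
by case/(natr_inj_mod hp); lia.
Qed.

(** Contents of two distinct addable nodes differ by at least 2 and at most [i + 1], so residues at
    distance 1 force a difference of [n - 1]. Then [i = n - 2], the nodes lie in the first row and
    the first column, and the hook between them leaves no room for the node [(1, 1)]. *)
Lemma far_addables t i x y : pstd n t -> (i.+1 < n)%N -> addable i t x -> addable i t y ->
  (res F x - res F y) ^+ 2 = 1 ->
  [/\ i.+2 = n,
     forall k, (k < i)%N -> t k <> (1, 1)%N &
     ([/\ x.1 = 0, y.2 = 0, 0 < y.1 & 0 < x.2] \/ [/\ y.1 = 0, x.2 = 0, 0 < x.1 & 0 < y.2])%N].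
Proof.
move=> pt lt.
have tk : pstd i t by apply: pstd_le pt; lia.
wlog xy : x y / (x.1 < y.1)%N => [H ax ay e|ax ay e].
  case: (addable_antichain tk ax ay) => [E|[r _ _]|[r _ _]].
  - by move/eqP: e; rewrite E subrr expr0n /= eq_sym oner_eq0.
  - exact: H.
  - have [|i2 h11 h] := H _ _ r ay ax; first by rewrite -sqrrN opprB.
    by split => //; case: h; [right|left].
case: (addable_antichain tk ax ay) => [E|[r c b]|[r]]; [by rewrite E ltnn in xy| |by lia].
have De : res F x - res F y = ((x.2 + y.1) - (x.1 + y.2))%:R.
  by rewrite natrB; [rewrite !resE !natrD; ring|lia].
rewrite De in e; have := sqr_natr_eq1 _ _ e => D.
have {}D : (x.2 + y.1 - (x.1 + y.2))%N = n.-1 by apply: D; lia.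
split; first by lia.
  move=> k ki E.
  have : (size ((1, 1)%N :: hook_nodes y.1.-1 x.2) <= i)%N.
    apply: (pstd_size (t := t)) => [|w].
      rewrite /= hook_nodes_uniq andbT; apply/negP => /hook_nodesP /=; lia.
    rewrite inE => /predU1P [->|]; first by exists k.
    case/hook_nodesP => -[e' lt'].
      by apply: (addable_down tk ax) => //; [lia|lia|move=> E'; rewrite E' in lt'; lia].
    by apply: (addable_down tk ay) => //; [lia|lia|move=> E'; rewrite E' in lt'; lia].
  by rewrite /= size_hook_nodes; lia.
by left; split; lia.
Qed.
End FarAddables.

Section Types.
Variables (F : fieldType) (m : nat).
Local Notation n := m.+1.
Implicit Types (T : tab n) (la : seq nat).

Definition wtT T k : F := res F (nd T k).

Definition hookish la := (nth 0 la 1 <= 1)%N.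

(* For a hook of size p only the tableaux with p at the end of the arm are
   weights of the irreducible module. *)
Definition Xstd la : {set tab n} :=
  [set T in Std n la | hookish la ==> ((T ord_max).1 == ord0)].

(* Excludes only s_(p-1) on hooks, where the axial distance is 1 or -1 mod p. *)
Definition okidx la i := (i.+1 < n)%N && ~~ (hookish la && (i.+2 == n)).

Lemma Xstd_std la T : T \in Xstd la -> T \in Std n la.
Proof. by rewrite inE => /andP []. Qed.

Lemma wtT_stab T i k : (i.+1 < n)%N -> (k < n)%N -> wtT (stab i.+1 T) k = sw i (wtT T) k.
Proof. by move=> lt kn; rewrite /wtT nd_stab // /sw; case: eqP => // _; case: eqP. Qed.

Lemma std_not_hookish la T : is_part n la -> T \in Std n la -> ~~ hookish la ->
  exists2 k, (k < n)%N & nd T k = (1, 1)%N.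
Proof. by move=> pla sT h; apply: (std_shape pla sT) => /=; rewrite ltnNge. Qed.

Lemma diff_stab_std la T i : is_part n la -> T \in Std n la -> (i.+1 < n)%N ->
  (wtT T i.+1 - wtT T i) ^+ 2 != 1 -> stab i.+1 T \in Std n la.
Proof.
move=> pla sT lt; case: (stab_std pla sT lt) => // E; rewrite /wtT E !resE /= -natr1 => /negP [];
  by apply/eqP; ring.
Qed.

Lemma Xstd_stab la T i : T \in Xstd la -> okidx la i -> stab i.+1 T \in Std n la ->
  stab i.+1 T \in Xstd la.
Proof.
move=> TX; have := TX; rewrite inE => /andP [sT hT] /andP [lt ok] sT'; rewrite inE sT' /=.
apply/implyP => hla; move: ok; rewrite hla /= => i2; move/implyP: hT => /(_ hla).
rewrite ffunE (_ : sgen n i.+1 ord_max = ord_max) //.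
apply: ord_inj; rewrite sgen_val //=; case: eqP => [|_]; [lia|].
by case: eqP => // ?; lia.
Qed.
Hypothesis hp : n \in [pchar F].

(** When both tableaux are standard, the two nodes are simultaneously addable before step [i];
    residues at distance 1 then occur only for the last two entries of a hook, which [okidx]
    excludes. *)
Lemma stab_std_diff la T i : is_part n la -> T \in Std n la -> okidx la i ->
  stab i.+1 T \in Std n la -> (wtT T i.+1 - wtT T i) ^+ 2 != 1.
Proof.
move=> pla sT /andP [lt ok] sT'; apply: contra ok => /eqP e.
have lt' := ltnW lt.
have pT := std_pstd pla sT; have pT' := std_pstd pla sT'.
have ax : addable i (nd T) (nd T i.+1).
  have := pT' i lt'; rewrite nd_stab // eqxx; apply: addable_ext => j ji.
  by rewrite nd_stab //; [case: eqP => [|_]; [lia|case: eqP => //; lia]|lia].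
have [i2 n11 h] := far_addables hp pT lt ax (pT i lt') e.
rewrite i2 eqxx andbT; apply/negPn/negP => /(std_not_hookish pla sT) [k kn E].
have [ki|ki] := ltnP k i; first exact: n11 E.
have [ei|ni] := eqVneq k i; first by rewrite -ei E /= in h; case: h => -[]; lia.
have ek : k = i.+1 by lia.
by rewrite -ek E /= in h; case: h => -[]; lia.
Qed.

(** A growth sequence with the swapped residues agrees with [T] before [i], so its next node and
    that of [T] are both addable with residues at distance 1; again only the excluded hook case
    permits this. *)
Lemma no_swapped_weight la T i t' : is_part n la -> T \in Std n la -> okidx la i ->
  (wtT T i.+1 - wtT T i) ^+ 2 = 1 -> pstd n t' ->
  (forall j, (j < n)%N -> sw i (wtT T) j = res F (t' j)) -> False.
Proof.
move=> pla sT /andP [lt ok] e pt' E; case/negP: ok.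
have lt' := ltnW lt; have pT := std_pstd pla sT.
have pre j : (j < i)%N -> t' j = nd T j.
  apply: (pstd_prefix_eq hp lt') => [||k ki].
  - by apply: pstd_le pt'; lia.
  - by apply: pstd_le pT; lia.
  - by rewrite -E; [rewrite swD //; lia|lia].
have ax : addable i (nd T) (t' i) by apply: addable_ext (pt' i lt').
have ei : res F (t' i) = wtT T i.+1 by rewrite -E // swL.
have e' : (res F (t' i) - res F (nd T i)) ^+ 2 = 1 by rewrite ei.
have [i2 n11 h] := far_addables hp pT lt ax (pT i lt') e'.
rewrite i2 eqxx andbT; apply/negPn/negP => /(std_not_hookish pla sT) [k kn Ek].
have [ki|ki] := ltnP k i; first exact: n11 Ek.
have [eki|ni] := eqVneq k i; first by rewrite -eki Ek /= in h; case: h => -[]; lia.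
have ek : k = i.+1 by lia.
move: ei; rewrite /wtT -ek Ek (resE F (1, 1)%N) subrr resE => /eqP; rewrite subr_eq0 => /eqP e0.
have hk := pstd_hook pt' lt' lt'.
by case: (natr_inj_mod hp e0); case: h => -[]; lia.
Qed.

End Types.

Arguments Xstd {m} la.

(** * Seminormal and orthogonal forms *)

Section Inversions.
Variables (F : fieldType) (m : nat).
Local Notation n := m.+1.
Implicit Types (T U : tab n) (la : seq nat).

(* the rank of the node [T a] in the column reading order *)
Definition colkey T (a : 'I_n) : nat := ((T a).2 * n + (T a).1)%N.

Definition inversions T : {set 'I_n * 'I_n} :=
  [set ab : 'I_n * 'I_n | (ab.1 < ab.2)%N && (colkey T ab.2 < colkey T ab.1)%N].

Lemma colkey_inj la T : is_tab la T -> injective (colkey T).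
Proof.
move=> /andP [/injectiveP iT _] a b; rewrite /colkey => e; apply: iT.
have h1 := ltn_ord (T a).1; have h2 := ltn_ord (T b).1.
have E2 : (T a).2 = (T b).2 :> nat.
  have := congr1 (fun x => x %/ n)%N e; rewrite !divnMDl // !divn_small //; lia.
have E1 : (T a).1 = (T b).1 :> nat by rewrite E2 in e; lia.
by rewrite [LHS]surjective_pairing [RHS]surjective_pairing; congr (_, _); apply: ord_inj.
Qed.

Lemma colkey_stab T i a : colkey (stab i.+1 T) a = colkey T (sgen n i.+1 a).
Proof. by rewrite /colkey ffunE. Qed.

Definition swap_pair i (ab : 'I_n * 'I_n) := (sgen n i.+1 ab.1, sgen n i.+1 ab.2).

Lemma sgen_invol i : involutive (sgen n i.+1).
Proof. by move=> a; rewrite -permM sgenK perm1. Qed.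

Lemma swap_pairK i : involutive (swap_pair i).
Proof. by case=> a b; rewrite /swap_pair /= !sgen_invol. Qed.

Lemma inversions_stab T i : (i.+1 < n)%N -> (colkey T (inord i) < colkey T (inord i.+1))%N ->
  inversions (stab i.+1 T) = (inord i, inord i.+1) |: [set swap_pair i ab | ab in inversions T]
  /\ (inord i, inord i.+1) \notin [set swap_pair i ab | ab in inversions T].
Proof.
move=> lt up; have lt' := ltnW lt.
have mem_im a b : ((a, b) \in [set swap_pair i ab | ab in inversions T]) = (swap_pair i (a, b) \in inversions T).
  by rewrite -{1}[(a, b)](swap_pairK i) mem_imset //; apply: can_inj (swap_pairK i).
split; last first.
  by rewrite mem_im inE /= sgen_inordL sgen_inordR !inordK // ltnNge leqnSn.
apply/setP => -[a b]; rewrite in_setU1 mem_im !inE /= !colkey_stab.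
have [/eqP [-> ->]|ne] := boolP ((a, b) == (inord i, inord i.+1)).
  by rewrite sgen_inordL sgen_inordR !inordK // ltnSn up.
have [[-> ->]|ne'] := eqVneq (a, b) (inord i.+1, inord i); last first.
  congr (_ && _); move: ne ne'; rewrite !xpair_eqE -!val_eqE /= !inordK //.
  by rewrite !sgen_val //; repeat case: eqP => ? /=; lia.
  rewrite sgen_inordL sgen_inordR !inordK // [X in _ = _ && X]ltnNge (ltnW up) andbF.
  by rewrite ltnNge leqnSn.
Qed.

(** For a tableau, the Coxeter length of the permutation relating it to the column-reading tableau
    of its shape. *)
Definition ell T := #|inversions T|.

Lemma ell_stab T i : (i.+1 < n)%N -> (colkey T (inord i) < colkey T (inord i.+1))%N ->
  ell (stab i.+1 T) = (ell T).+1.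
Proof.
move=> lt up; have [E ni] := inversions_stab lt up.
by rewrite /ell E cardsU1 ni card_imset //; apply: can_inj (swap_pairK i).
Qed.

Variable sq : F -> F.

(* The factor between the seminormal and the orthogonal basis vector at T. *)
Definition gam T : F :=
  \prod_(ab in inversions T) sq (1 - (wtT F T ab.2 - wtT F T ab.1)^-1 ^+ 2).

Lemma gam_stab T i : (i.+1 < n)%N -> (colkey T (inord i) < colkey T (inord i.+1))%N ->
  gam (stab i.+1 T) = sq (1 - rhoi F T i.+1 ^+ 2) * gam T.
Proof.
move=> lt up; have [E ni] := inversions_stab lt up.
rewrite /gam E big_setU1 //= !inordK ?(ltnW lt) // !wtT_stab ?(ltnW lt) // swL swR.
congr (_ * _).
  by congr (sq _); rewrite -[wtT F T i - _]opprB invrN sqrrN.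
rewrite big_imset /=; last by move=> x y _ _; apply: can_inj (swap_pairK i) _ _.
apply: eq_bigr => -[a b] _ /=; congr (sq (1 - (_ - _)^-1 ^+ 2)).
  by rewrite wtT_stab // -wtT_stab // /wtT !nd_ord !ffunE sgen_invol.
by rewrite wtT_stab // -wtT_stab // /wtT !nd_ord !ffunE sgen_invol.
Qed.

Definition col_sorted k T := forall a b : 'I_n, (a < b)%N -> (b < k)%N -> (colkey T a < colkey T b)%N.

Lemma mono_perm_id (u : 'S_n) : (forall a b : 'I_n, (a < b)%N -> (u a < u b)%N) -> u = 1%g.
Proof.
have le (v : 'S_n) : (forall a b : 'I_n, (a < b)%N -> (v a < v b)%N) -> forall a : 'I_n, (a <= v a)%N.
  move=> mv [a an]; elim: a an => // a IH an.
  have an' := ltnW an; have := IH an'; have := mv (Ordinal an') (Ordinal an) (ltnSn a); rewrite /=; lia.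
move=> mu; have mu' (a b : 'I_n) : (a < b)%N -> ((u^-1)%g a < (u^-1)%g b)%N.
  move=> ab; case: ltngtP => // [lt|/ord_inj/perm_inj e]; last by rewrite e ltnn in ab.
  by have := mu _ _ lt; rewrite !permKV; lia.
apply/permP => a; rewrite perm1; apply: ord_inj; have := le _ mu a; have := le _ mu' (u a).
by rewrite permK; lia.
Qed.

Lemma col_sorted_inj la k T U : is_part n la -> is_tab la T -> is_tab la U ->
  col_sorted k T -> col_sorted k U -> (forall a : 'I_n, (k <= a)%N -> T a = U a) -> T = U.
Proof.
move=> pla tT tU sT sU E; have [u Eu] := tab_relab pla tT tU.
have /andP [/injectiveP iT _] := tT.
have UE a : U a = T ((u^-1)%g a) by rewrite Eu ffunE.
have fixk (a : 'I_n) : (k <= a)%N -> (u^-1)%g a = a.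
  by move=> ka; apply: iT; rewrite -UE E.
have ltk (a : 'I_n) : (a < k)%N -> ((u^-1)%g a < k)%N.
  move=> ak; rewrite ltnNge; apply/negP => h; have /perm_inj e := fixk _ h.
  by rewrite e in h; lia.
suff u1 : (u^-1)%g = 1%g by apply/ffunP => a; rewrite UE u1 perm1.
apply: mono_perm_id => a b ab; have [bk|kb] := ltnP b k; last first.
  rewrite (fixk b) //; have [ak|ka] := ltnP a k; last by rewrite fixk.
  by have := ltk _ ak; lia.
have := sU _ _ ab bk; rewrite /colkey !UE -/(colkey T _) => lt.
case: ltngtP => // [h|/ord_inj e]; last by rewrite e ltnn in lt.
have := sT _ _ h (ltk _ (ltn_trans ab bk)); rewrite /colkey in lt *; lia.
Qed.

Lemma not_col_sorted la k T : is_tab la T -> (k <= n)%N -> ~ col_sorted k T ->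
  exists i, (i.+1 < k)%N /\ (colkey T (inord i.+1) < colkey T (inord i))%N.
Proof.
move=> tT kn ns.
have [/existsP [i /andP [ik d]]|/existsPn no] := boolP [exists i : 'I_n, (i.+1 < k)%N &&
   (colkey T (inord i.+1) < colkey T (inord i))%N]; first by exists (nat_of_ord i).
case: ns => a b; have [N] := ubnP (b - a); elim: N a b => // N IH a b; rewrite ltnS => bN ab bk.
have up i : (i.+1 < k)%N -> (colkey T (inord i) < colkey T (inord i.+1))%N.
  move=> ik; have ni : (i < n)%N by lia.
  have := no (Ordinal ni); rewrite /= ik /= -leqNgt leq_eqVlt => /orP [/eqP/(colkey_inj tT)|//].
  by move/(congr1 val) => /=; rewrite !inordK; lia.
have b0 : (0 < b)%N by lia.
have bE : b = inord b.-1.+1 by apply: ord_inj; rewrite prednK // inordK.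
have [e|ne] := eqVneq (a : nat) b.-1.
  by have := up b.-1; rewrite -bE -e inord_val; apply; lia.
have b1n : (b.-1 < n)%N by have := ltn_ord b; lia.
apply: (@ltn_trans (colkey T (inord b.-1))); first by apply: IH; rewrite inordK //; lia.
by rewrite {2}bE; apply: up; lia.
Qed.

Lemma descent_std la T i : is_part n la -> T \in Std n la -> (i.+1 < n)%N ->
  (colkey T (inord i.+1) < colkey T (inord i))%N -> stab i.+1 T \in Std n la.
Proof.
move=> pla sT lt d; case: (stab_std pla sT lt) => //; rewrite !ndE => -[/= e1 e2];
  by move: d; rewrite /colkey e1 e2; lia.
Qed.

Lemma ell_descent T i : (i.+1 < n)%N ->
  (colkey T (inord i.+1) < colkey T (inord i))%N -> ell T = (ell (stab i.+1 T)).+1.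
Proof.
move=> lt d; rewrite -{1}[T](stabK T i) ell_stab // !colkey_stab sgen_inordL sgen_inordR.
by [].
Qed.

Lemma ell0_sorted la T : is_tab la T -> ell T = 0%N -> col_sorted n T.
Proof.
move=> tT /eqP; rewrite cards_eq0 => /eqP E a b ab _.
have : (a, b) \notin inversions T by rewrite E inE.
rewrite inE /= ab /= -leqNgt leq_eqVlt => /orP [/eqP /(colkey_inj tT) e|//].
by rewrite e ltnn in ab.
Qed.

Lemma ell0_uniq la T U : is_part n la -> is_tab la T -> is_tab la U -> ell T = 0%N -> ell U = 0%N -> T = U.
Proof.
move=> pla tT tU eT eU; apply: (col_sorted_inj pla tT tU (k := n)).
- exact: (ell0_sorted tT eT).
- exact: (ell0_sorted tU eU).
- by move=> a; rewrite leqNgt ltn_ord.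
Qed.

Lemma ell_gt0 la T : is_tab la T -> (0 < ell T)%N ->
  exists2 i, (i.+1 < n)%N & (colkey T (inord i.+1) < colkey T (inord i))%N.
Proof.
move=> tT e; have [||i [lt d]] := @not_col_sorted la n T tT => //; last by exists i.
move=> st; move: e; rewrite card_gt0 => /set0Pn [[a b]]; rewrite inE /= => /andP [ab lt].
by have := st _ _ ab (ltn_ord b); lia.
Qed.

Lemma Xstd_arm la T : is_part n la -> (0 < m)%N -> T \in Xstd la -> hookish la ->
  nd T m = (0, (nth 0 la 0).-1)%N.
Proof.
move=> pla m0 TX hla; have sT := Xstd_std TX; have := TX; rewrite inE hla /= => /andP [_ /eqP r0].
have Em : nd T m = (0%N, nat_of_ord (T ord_max).2) by rewrite -[m in nd T m]/(nat_of_ord (@ord_max m)) nd_ord r0.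
have := tab_in_shape m (std_tab sT); rewrite Em /= => lt.
congr (_, _); apply/eqP; rewrite eqn_leq; apply/andP; split; first lia.
rewrite leqNgt; apply/negP => lt2.
have [|k kn Ek] := @std_shape _ la T (0, (nat_of_ord (T ord_max).2).+1)%N pla sT; first by rewrite /=; lia.
have [_ _ H] := std_pstd pla sT kn; have [j jk Ej] := H _ _ Ek.
have := pstd_inj (std_pstd pla sT) (j := j) (k := m); rewrite Ej Em => /(_ ltac:(lia) (ltnSn _) erefl); lia.
Qed.

(** On a hook the entry [n] sits at the end of the arm, which comes last in column reading order, so
    the last two entries never form a descent. Inductions on [ell] therefore meet admissible indices
    only. *)
Lemma descent_ok la T i : is_part n la -> (2 <= nth 0 la 0)%N -> T \in Xstd la -> (i.+1 < n)%N ->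
  (colkey T (inord i.+1) < colkey T (inord i))%N -> okidx m la i.
Proof.
move=> pla la0 TX lt d; rewrite /okidx lt /=; apply/negP => /andP [hla /eqP i2].
have im : i.+1 = m by lia.
have Em : nd T i.+1 = (0, (nth 0 la 0).-1)%N by rewrite im; apply: Xstd_arm => //; lia.
have sT := Xstd_std TX; have := tab_in_shape i (std_tab sT).
move: d Em; rewrite /colkey !ndE => d [e1 e2] /= sh; rewrite e1 e2 in d.
have r := is_part_nth_anti pla (leq0n (T (inord i)).1).
have : ((nth 0 la 0).-1 <= (T (inord i)).2)%N.
  by have h := ltn_ord (T (inord i)).1; rewrite leqNgt; apply/negP => h2; nia.
move=> c; have r0 : ((T (inord i)).1 : nat) = 0%N.
  case E : ((T (inord i)).1 : nat) => [//|r'].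
  have := is_part_nth_anti (i := 1) (j := r'.+1) pla (ltn0Sn _); rewrite -E.
  by move: hla; rewrite /hookish; lia.
have pT := std_pstd pla sT.
have := pstd_inj (j := i) (k := i.+1) pT (ltnW lt) lt; rewrite !ndE e1 e2 r0.
rewrite (_ : nat_of_ord (T (inord i)).2 = (nth 0 la 0).-1)%N; last by move: sh; rewrite r0; lia.
by move=> /(_ erefl); lia.
Qed.

End Inversions.

(** * A family of weight vectors grown from the column-reading tableau *)

Section Family.
Variables (F : closedFieldType) (m d : nat).
Local Notation n := m.+1.
Hypothesis hp : n \in [pchar F].
Variable rG : mx_representation F [set: 'S_n]%G d.
Local Notation jm := (jm rG).
Local Notation s i := (rG (sgen n i.+1)).
Variable la : seq nat.
Hypothesis pla : is_part n la.
Implicit Types (T U S : tab n).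
Local Notation X := (@Xstd m la).

Lemma char_m_gt0 : (0 < m)%N.
Proof. by have /andP [/prime_gt1] := hp. Qed.

Definition ev T (v : 'rV[F]_d) := wv rG n (wtT F T) v.

Lemma rhoiE T i : rhoi F T i.+1 = (wtT F T i.+1 - wtT F T i)^-1.
Proof. by []. Qed.

Lemma rhoi_sqr T i : (rhoi F T i.+1 ^+ 2 == 1) = ((wtT F T i.+1 - wtT F T i) ^+ 2 == 1).
Proof. by rewrite rhoiE exprVn invr_eq1. Qed.

(** For the one-column partition [Xstd] is empty: the last entry would have to occupy the corner,
    which belongs to the first entry. This is how [(1^n)] drops out of the labels. *)
Lemma Xstd_la0 T : T \in X -> (2 <= nth 0 la 0)%N.
Proof.
move=> TX; have sT := Xstd_std TX; rewrite leqNgt; apply/negP => l0.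
have hla : hookish la by have := is_part_nthS 0 pla; rewrite /hookish; lia.
have Em := Xstd_arm pla char_m_gt0 TX hla.
have pT := std_pstd pla sT; have [a1 a2 a3] := pT 0%N isT.
have E0 : nd T 0 = (0, 0)%N.
  by case E : (nd T 0) => [[|r] [|c]] //; [case: (a3 _ _ E)|case: (a2 _ _ E)|case: (a2 _ _ E)].
have := pstd_inj (j := 0) (k := m) pT; rewrite Em E0 => H.
have := H isT (ltnSn _); have := char_m_gt0.
by rewrite (_ : (nth 0 la 0).-1 = 0)%N; [move=> ? /(_ erefl); lia|lia].
Qed.

Lemma Xstd_descent_ok T i : T \in X -> (i.+1 < n)%N ->
  (colkey T (inord i.+1) < colkey T (inord i))%N -> okidx m la i.
Proof. by move=> TX; apply: descent_ok => //; apply: Xstd_la0 TX. Qed.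

(** Residues determine the first [n - 1] nodes, and the common shape leaves a single node for the
    last entry. *)
Lemma wtT_inj T U : T \in Std n la -> U \in Std n la ->
  (forall k, (k < n)%N -> wtT F T k = wtT F U k) -> T = U.
Proof.
move=> sT sU E; have pT := std_pstd pla sT; have pU := std_pstd pla sU.
have pre j : (j < m)%N -> nd T j = nd U j.
  apply: (pstd_prefix_eq hp (ltnSn m)) => [||k km].
  - by apply: pstd_le pT; lia.
  - by apply: pstd_le pU; lia.
  - by apply: E; lia.
apply: nd_inj => k; rewrite ltnS leq_eqVlt => /predU1P [->|]; last exact: pre.
have [|j jn Ej] := @std_shape _ la U (nd T m) pla sU; first exact: tab_in_shape (std_tab sT).
have [ej|nj] := eqVneq j m; first by rewrite -Ej ej.
have jm : (j < m)%N by lia.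
have := pstd_inj (j := j) (k := m) pT jn (ltnSn m); rewrite pre // Ej => /(_ erefl); lia.
Qed.

Lemma wtT_diff T U : T \in Std n la -> U \in Std n la -> T != U ->
  exists2 k, (k < n)%N & wtT F T k != wtT F U k.
Proof.
move=> sT sU ne.
have [/existsP [k H]|/existsPn no] := boolP [exists k : 'I_n, wtT F T k != wtT F U k].
  by exists (nat_of_ord k).
case/eqP: ne; apply: wtT_inj => // k kn; apply/eqP.
by have := no (Ordinal kn); rewrite negbK.
Qed.

Lemma ev_stuck T i v : T \in X -> okidx m la i -> ev T v -> rhoi F T i.+1 ^+ 2 = 1 ->
  v *m s i = rhoi F T i.+1 *: v.
Proof.
move=> TX ok evT /eqP; rewrite rhoi_sqr => /eqP e; have [lt _] := andP ok.
have [->|nz] := eqVneq v 0; first by rewrite mul0mx scaler0.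
have ss := jm_semisimple hp (rG := rG) (ltnSn m).
apply: (wv_stuck (leqnn n) ss lt evT nz) => /(weight_nodes hp) [t' pt' Et].
exact: (no_swapped_weight hp pla (Xstd_std TX) ok e pt').
Qed.

Lemma ev_stab T i v : T \in X -> (i.+1 < n)%N -> ev T v -> v != 0 ->
  ev (stab i.+1 T) (v *m s i - rhoi F T i.+1 *: v).
Proof.
move=> TX lt evT nz; have ss := jm_semisimple hp (rG := rG) (ltnSn m).
have ne : wtT F T i != wtT F T i.+1 by apply: (wt_adj (leqnn n) ss lt); exists v.
have := wv_swap (leqnn n) lt evT ne; rewrite -rhoiE.
by apply: wv_ext => k kn; rewrite wtT_stab.
Qed.

Lemma stab_X T i : T \in X -> okidx m la i -> rhoi F T i.+1 ^+ 2 != 1 -> stab i.+1 T \in X.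
Proof.
move=> TX ok; rewrite rhoi_sqr => e; have [lt _] := andP ok.
by apply: Xstd_stab => //; apply: (diff_stab_std pla (Xstd_std TX) lt e).
Qed.

Lemma stab_rho T i : T \in X -> okidx m la i -> stab i.+1 T \in X -> rhoi F T i.+1 ^+ 2 != 1.
Proof.
move=> TX ok TX'; rewrite rhoi_sqr.
exact: (stab_std_diff hp pla (Xstd_std TX) ok (Xstd_std TX')).
Qed.

Lemma rhoi_stab T i : (i.+1 < n)%N -> rhoi F (stab i.+1 T) i.+1 = - rhoi F T i.+1.
Proof. by move=> lt; rewrite !rhoiE !wtT_stab ?(ltnW lt) // swL swR -invrN opprB. Qed.

Definition espace T : 'M[F]_d := (\bigcap_(k < n) eigenspace (jm k) (wtT F T k))%MS.

Lemma espaceP T (v : 'rV_d) : reflect (ev T v) (v <= espace T)%MS.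
Proof.
apply: (iffP sub_bigcapmxP) => [H j jk|H i _].
  by apply/eigenspaceP; apply: (H (Ordinal jk)).
by apply/eigenspaceP; apply: H.
Qed.

Definition others (x : F) := [seq b <- [seq b%:R | b <- iota 0 n] | b != x].

(** An unnormalised projection to the weight of [T]: for each Jucys-Murphy element, the product of
    the factors for all prime-field values other than the one prescribed by [T]. On a weight vector
    it acts by the scalar [wnorm]. *)
Definition wproj T : 'M[F]_d :=
  foldr (fun k M => rootprod (jm k) (others (wtT F T k)) *m M) 1%:M (iota 0 n).

Definition wnorm T (c : nat -> F) :=
  \prod_(k <- iota 0 n) \prod_(b <- others (wtT F T k)) (c k - b).

Lemma wproj_wv T c v : wv rG n c v -> v *m wproj T = wnorm T c *: v.
Proof.
move=> wc; rewrite /wproj /wnorm.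
have : all (fun k => k < n)%N (iota 0 n) by apply/allP => k; rewrite mem_iota.
elim: (iota 0 n) => [_|k l IH /= /andP [kn /IH {}IH]]; first by rewrite big_nil scale1r mulmx1.
by rewrite mulmxA (rootprod_eigen _ (wc _ kn)) -scalemxAl IH scalerA big_cons.
Qed.

Lemma wnorm_neq0 T : wnorm T (wtT F T) != 0.
Proof.
rewrite /wnorm prodf_seq_neq0; apply/allP => k _ /=.
by rewrite prod_sub_eq0 mem_filter eqxx.
Qed.

Lemma res_in_prime x : res F x \in [seq b%:R | b <- iota 0 n].
Proof.
pose z := (x.2 + (n - 1) * x.1)%N; apply/mapP; exists (z %% n)%N.
  by rewrite mem_iota ltn_pmod.
have -> : (z %% n)%:R = z%:R :> F.
  by rewrite {2}(divn_eq z n) natrD natrM (pcharf0 hp) mulr0 add0r.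
by rewrite natrD natrM natrB // (pcharf0 hp) sub0r mulN1r resE.
Qed.

Lemma wnorm_eq0 T U : T \in Std n la -> U \in Std n la -> T != U -> wnorm T (wtT F U) = 0.
Proof.
move=> sT sU ne; have [k kn wk] := wtT_diff sT sU ne.
apply/eqP; rewrite /wnorm prodf_seq_eq0; apply/hasP; exists k; first by rewrite mem_iota.
by rewrite /= prod_sub_eq0 mem_filter eq_sym wk res_in_prime.
Qed.

Definition low l : 'M[F]_d := (\sum_(S in X | (ell S < l)%N) espace S)%MS.

Lemma ell_stab_le T i : is_tab la T -> (i.+1 < n)%N -> (ell (stab i.+1 T) <= (ell T).+1)%N.
Proof.
move=> tT lt; case: (ltngtP (colkey T (inord i)) (colkey T (inord i.+1))) => h.
- by rewrite ell_stab.
- by rewrite (ell_descent lt h); lia.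
- by move/(colkey_inj tT)/(congr1 val): h; rewrite /= !inordK //; lia.
Qed.

Lemma low_sgen l i (v : 'rV_d) : okidx m la i -> (v <= low l)%MS -> (v *m s i <= low l.+1)%MS.
Proof.
move=> ok vl; have [lt _] := andP ok; apply: submx_trans (submxMr _ vl) _.
rewrite /low sumsmxMr; apply/sumsmx_subP => S /andP [SX el]; apply/row_subP => r.
rewrite row_mul; set w := row r _; have /espaceP ew : (w <= espace S)%MS by apply: row_sub.
have [->|nz] := eqVneq w 0; first by rewrite mul0mx sub0mx.
have wl : (w <= low l.+1)%MS.
  by apply: (sumsmx_sup S); [rewrite SX; lia|apply/espaceP].
have [e|ne] := eqVneq (rhoi F S i.+1 ^+ 2) 1; first by rewrite (ev_stuck SX ok ew e) scalemx_sub.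
rewrite -[w *m _](subrK (rhoi F S i.+1 *: w)) addmx_sub ?scalemx_sub //.
apply: (sumsmx_sup (stab i.+1 S)); last by apply/espaceP/ev_stab.
by rewrite (stab_X SX ok ne) /=; have := ell_stab_le (std_tab (Xstd_std SX)) lt; lia.
Qed.

Lemma low_wproj l T (v : 'rV_d) : T \in X -> (l <= ell T)%N -> (v <= low l)%MS -> v *m wproj T = 0.
Proof.
move=> TX lT vl; apply/eqP; rewrite -submx0; apply: submx_trans (submxMr _ vl) _.
rewrite /low sumsmxMr; apply/sumsmx_subP => S /andP [SX el]; apply/row_subP => r.
rewrite row_mul; have /espaceP ew : (row r (espace S) <= espace S)%MS by apply: row_sub.
rewrite (wproj_wv T ew) wnorm_eq0 ?scale0r ?sub0mx //; try exact: Xstd_std.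
by apply: contraTneq el => <-; lia.
Qed.

Section Fam.
Variable T0 : tab n.
Hypothesis T0X : T0 \in X.
Hypothesis ellT0 : ell T0 = 0%N.

Definition uT T : 'S_n := odflt 1%g [pick u : 'S_n | [forall a, T (u a) == T0 a]].

Lemma uTP T : is_tab la T -> forall a, T (uT T a) = T0 a.
Proof.
move=> tT; rewrite /uT; case: pickP => [u /forallP H a|no]; first exact/eqP.
have [u Eu] := tab_relab pla tT (std_tab (Xstd_std T0X)).
have /negP [] := no (u^-1)%g; apply/forallP => a.
by rewrite (_ : T0 a = T ((u^-1)%g a)) // Eu ffunE.
Qed.

Lemma uT_uniq T (u : 'S_n) : is_tab la T -> (forall a, T (u a) = T0 a) -> uT T = u.
Proof.
move=> tT H; apply/permP => a; have /andP [/injectiveP iT _] := tT; apply: iT.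
by rewrite uTP // H.
Qed.

Lemma uT_stab T i : T \in Std n la -> stab i.+1 T \in Std n la ->
  uT (stab i.+1 T) = (uT T * sgen n i.+1)%g.
Proof.
move=> sT sT'; apply: uT_uniq => [|a]; first exact: std_tab sT'.
by rewrite ffunE permM sgen_invol uTP //; apply: std_tab sT.
Qed.

Variable v0 : 'rV[F]_d.
Hypothesis evT0 : ev T0 v0.

(* Projecting the permuted vector to its weight space keeps its leading term
   with respect to [ell]; see [fam_ok]. *)
Definition fam (T : tab n) := (wnorm T (wtT F T))^-1 *: (v0 *m rG (uT T) *m wproj T).

Lemma wproj_ev T (v : 'rV_d) : ev T v -> (wnorm T (wtT F T))^-1 *: (v *m wproj T) = v.
Proof. by move=> e; rewrite (wproj_wv T e) scalerA mulVf ?scale1r ?wnorm_neq0. Qed.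

Lemma fam_T0 : fam T0 = v0.
Proof.
rewrite /fam (uT_uniq (u := 1%g)) ?repr_mx1 ?mulmx1 ?wproj_ev //.
  exact: std_tab (Xstd_std T0X).
by move=> a; rewrite perm1.
Qed.

(** Unitriangularity: [fam T] is the weight-[T] part of the translate of [v0], and the rest is
    supported on tableaux of smaller [ell]. *)
Definition fam_ok T := ev T (fam T) /\ (v0 *m rG (uT T) - fam T <= low (ell T))%MS.

(** Applying [s i] to the translate of [v0] gives the intertwined vector, which has weight
    [stab i.+1 T], plus terms of length at most [ell T]. The projection kills the latter and fixes
    the former. *)
Lemma fam_step T i : T \in X -> okidx m la i -> stab i.+1 T \in X ->
  (colkey T (inord i) < colkey T (inord i.+1))%N -> fam_ok T ->
  fam (stab i.+1 T) = fam T *m s i - rhoi F T i.+1 *: fam T /\ fam_ok (stab i.+1 T).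
Proof.
move=> TX ok TX' up [evf lo]; have [lt _] := andP ok.
have eE : ell (stab i.+1 T) = (ell T).+1 := ell_stab lt up.
set f := fam T in evf lo *; set e := f *m s i - _.
have eve : ev (stab i.+1 T) e.
  have [f0|nz] := eqVneq f 0; last exact: ev_stab.
  by rewrite /e f0 mul0mx scaler0 subr0 => k kn; rewrite mul0mx scaler0.
set R := rhoi F T i.+1 *: f + (v0 *m rG (uT T) - f) *m s i.
have Rl : (R <= low (ell (stab i.+1 T)))%MS.
  rewrite eE addmx_sub ?low_sgen // scalemx_sub //.
  by apply: (sumsmx_sup T); [rewrite TX /=; lia|apply/espaceP].
have uE : v0 *m rG (uT (stab i.+1 T)) = e + R.
  rewrite uT_stab ?(Xstd_std TX) ?(Xstd_std TX') // repr_mxM ?inE // mulmxA.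
  by rewrite /e /R addrA subrK mulmxBl addrC subrK.
have fE : fam (stab i.+1 T) = e.
  by rewrite /fam uE mulmxDl (low_wproj TX' (leqnn _) Rl) addr0 wproj_ev.
by split => //; split; rewrite fE // uE addrC addKr.
Qed.

(** Every tableau of [Xstd] is reached from [T0] by ascents within [Xstd], because removing a
    descent is always an admissible move. *)
Lemma Xstd_ell_ind (P : tab n -> Prop) : P T0 ->
  (forall T i, T \in X -> okidx m la i -> stab i.+1 T \in X ->
     (colkey T (inord i) < colkey T (inord i.+1))%N -> P T -> P (stab i.+1 T)) ->
  forall T, T \in X -> P T.
Proof.
move=> P0 PS T; have [N] := ubnP (ell T); elim: N T => // N IH T; rewrite ltnS => lN TX.
have tT := std_tab (Xstd_std TX).
have [e0|e0] := posnP (ell T).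
  by rewrite (ell0_uniq pla tT (std_tab (Xstd_std T0X)) e0 ellT0).
have [i lt de] := ell_gt0 tT e0.
have ok := Xstd_descent_ok TX lt de.
have sT' := descent_std pla (Xstd_std TX) lt de.
have TX' : stab i.+1 T \in X by apply: Xstd_stab.
rewrite -(stabK T i); apply: PS => //.
- by rewrite stabK.
- by rewrite !colkey_stab sgen_inordL sgen_inordR.
- by apply: IH => //; have := ell_descent lt de; lia.
Qed.

Lemma fam_okP T : T \in X -> fam_ok T.
Proof.
move: T; apply: Xstd_ell_ind => [|T i TX ok TX' up IH].
  split; rewrite fam_T0 // (uT_uniq (u := 1%g)) ?repr_mx1 ?mulmx1 ?subrr ?sub0mx //.
    exact: std_tab (Xstd_std T0X).
  by move=> a; rewrite perm1.
by case: (fam_step TX ok TX' up IH).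
Qed.

Lemma fam_ev T : T \in X -> ev T (fam T).
Proof. by case/fam_okP. Qed.

Lemma fam_up T i : T \in X -> okidx m la i -> stab i.+1 T \in X ->
  (colkey T (inord i) < colkey T (inord i.+1))%N ->
  fam (stab i.+1 T) = fam T *m s i - rhoi F T i.+1 *: fam T.
Proof. by move=> TX ok TX' up; case: (fam_step TX ok TX' up (fam_okP TX)). Qed.

Lemma fam_neq0 T : v0 != 0 -> T \in X -> fam T != 0.
Proof.
move=> nz; move: T; apply: Xstd_ell_ind => [|T i TX ok TX' up]; first by rewrite fam_T0.
apply: contraNneq => E; have := swap_swap rG i (rhoi F T i.+1) (fam T).
rewrite -fam_up // E mul0mx scaler0 addr0 => /esym/eqP; rewrite scaler_eq0 subr_eq0 eq_sym.
by rewrite (negPf (stab_rho TX ok TX')).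
Qed.

Lemma fam_stuck T i : T \in X -> okidx m la i -> stab i.+1 T \notin X ->
  fam T *m s i = rhoi F T i.+1 *: fam T.
Proof.
move=> TX ok nX; apply: ev_stuck => //; first exact: fam_ev.
by apply/eqP; apply: contraNT nX; apply: stab_X.
Qed.

Variable sq : F -> F.
Hypothesis hsq : forall x, sq x ^+ 2 = x.

Lemma sq_eq0 x : (sq x == 0) = (x == 0).
Proof. by rewrite -[x in RHS]hsq expf_eq0. Qed.

Lemma gam_neq0 T : T \in X -> gam sq T != 0.
Proof.
move: T; apply: Xstd_ell_ind => [|T i TX ok TX' up IH].
  by move/eqP: ellT0; rewrite cards_eq0 /gam => /eqP ->; rewrite big_set0 oner_eq0.
have [lt _] := andP ok; rewrite gam_stab // mulf_neq0 // sq_eq0 subr_eq0 eq_sym.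
exact: stab_rho.
Qed.

Definition vfam T := (gam sq T)^-1 *: fam T.

(** In the seminormal family one direction has coefficient 1 and the other [1 - r ^+ 2]. The ratio
    of the two factors [gam] is a square root of the latter, so division by [gam] makes both
    coefficients equal to it. *)
Lemma vfam_up T i : T \in X -> okidx m la i -> stab i.+1 T \in X ->
  (colkey T (inord i) < colkey T (inord i.+1))%N ->
  vfam T *m s i = rhoi F T i.+1 *: vfam T + sq (1 - rhoi F T i.+1 ^+ 2) *: vfam (stab i.+1 T)
  /\ vfam (stab i.+1 T) *m s i = - rhoi F T i.+1 *: vfam (stab i.+1 T) + sq (1 - rhoi F T i.+1 ^+ 2) *: vfam T.
Proof.
move=> TX ok TX' up; have [lt _] := andP ok.
have E1 := fam_up TX ok TX' up; have E2 := swap_swap rG i (rhoi F T i.+1) (fam T).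
rewrite -E1 in E2; have g0 := gam_neq0 TX; have g1 := gam_neq0 TX'.
rewrite gam_stab // in g1; rewrite /vfam gam_stab //.
set r := rhoi F T i.+1 in E1 E2 g1 *; set q := sq _ in g1 *; set g := gam _ _ in g0 g1 *.
have q0 : q != 0 by apply: contraNneq g1 => ->; rewrite mul0r.
have q2 : 1 - r ^+ 2 = q ^+ 2 by rewrite hsq.
move: (fam T) (fam (stab i.+1 T)) E1 E2; clearbody r q g => f f' E1 E2; rewrite -!scalemxAl.
have -> : f *m s i = r *: f + f' by rewrite E1 addrC subrK.
have -> : f' *m s i = q ^+ 2 *: f - r *: f' by rewrite -q2 -E2 addrK.
rewrite !scalerDr !scalerN !scalerA; split.
  by congr (_ *: _ + _ *: _); field; rewrite ?g0 ?q0.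
by rewrite addrC; congr (_ + _); rewrite -?scaleNr; congr (_ *: _); field; rewrite ?g0 ?q0.
Qed.

Lemma vfam_sgen T i : T \in X -> okidx m la i -> stab i.+1 T \in X ->
  vfam T *m s i = rhoi F T i.+1 *: vfam T + sq (1 - rhoi F T i.+1 ^+ 2) *: vfam (stab i.+1 T).
Proof.
move=> TX ok TX'; have [lt _] := andP ok.
case: (ltngtP (colkey T (inord i)) (colkey T (inord i.+1))) => h.
- by case: (vfam_up TX ok TX' h).
- have := @vfam_up (stab i.+1 T) i TX' ok; rewrite stabK !colkey_stab sgen_inordL sgen_inordR.
  by move=> /(_ TX h) [_]; rewrite rhoi_stab // opprK sqrrN.
- by move/(colkey_inj (std_tab (Xstd_std TX)))/(congr1 val): h; rewrite /= !inordK //; lia.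
Qed.

End Fam.

Lemma Xstd_T0 T : T \in X -> exists2 T0, T0 \in X & ell T0 = 0%N.
Proof.
have [N] := ubnP (ell T); elim: N T => // N IH T; rewrite ltnS => lN TX.
have tT := std_tab (Xstd_std TX).
have [e0|e0] := posnP (ell T); first by exists T.
have [i lt de] := ell_gt0 tT e0; have ok := Xstd_descent_ok TX lt de.
apply: (IH (stab i.+1 T)); first by have := ell_descent lt de; lia.
by apply: Xstd_stab => //; apply: descent_std de => //; apply: Xstd_std TX.
Qed.

(** Intertwiners along descents carry [v] to a vector of weight [T0]. Returning along the same path
    reproduces [v] up to the factors [1 - rho ^+ 2], nonzero at admissible indices. *)
Lemma fam_through T0 T v : T0 \in X -> ell T0 = 0%N -> T \in X -> ev T v -> v != 0 ->
  exists v0, [/\ v0 != 0, ev T0 v0 & exists2 a, a != 0 & fam T0 v0 T = a *: v].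
Proof.
move=> T0X e00; have [N] := ubnP (ell T); elim: N T v => // N IH T v; rewrite ltnS => lN TX evT nz.
have tT := std_tab (Xstd_std TX).
have [e0|e0] := posnP (ell T).
  have E := ell0_uniq pla tT (std_tab (Xstd_std T0X)) e0 e00.
  rewrite -E; exists v; split => //; exists 1; rewrite ?oner_eq0 // scale1r.
  by apply: fam_T0 => //; rewrite E.
have [i lt de] := ell_gt0 tT e0; have ok := Xstd_descent_ok TX lt de.
have TX' : stab i.+1 T \in X.
  by apply: Xstd_stab => //; apply: descent_std de => //; apply: Xstd_std TX.
have ne1 : 1 - rhoi F T i.+1 ^+ 2 != 0 by rewrite subr_eq0 eq_sym (stab_rho TX ok TX').
have ss := swap_swap rG i (rhoi F T i.+1) v.
have evT' := ev_stab TX lt evT nz.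
set v' := v *m _ - _ in ss evT'.
have nz' : v' != 0.
  apply: contraNneq nz => E; move/eqP: ss; rewrite E mul0mx scaler0 addr0 eq_sym scaler_eq0.
  by rewrite (negPf ne1).
clearbody v'.
have [|v0 [v0nz ev0 [a a0 Ea]]] := IH (stab i.+1 T) v' _ TX' evT' nz'.
  by have := ell_descent lt de; clear -lN; lia.
exists v0; split => //; exists (a * (1 - rhoi F T i.+1 ^+ 2)); first by rewrite mulf_neq0.
have := @fam_up T0 T0X e00 v0 ev0 (stab i.+1 T) i TX' ok.
rewrite stabK !colkey_stab sgen_inordL sgen_inordR => -> //.
rewrite Ea rhoi_stab // scaleNr opprK; transitivity (a *: (v' *m s i + rhoi F T i.+1 *: v')).
  by rewrite scalerDr -scalemxAl !scalerA [a * _]mulrC.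
by rewrite ss scalerA.
Qed.

End Family.

Lemma hook_count m la (T : tab m.+1) j r : let n := m.+1 in is_part n la -> T \in Std n la -> hookish la -> (j < n)%N ->
  nd T j = (r, 0)%N -> (0 < r)%N -> (forall k, (j < k)%N -> (k < n)%N -> (nd T k).1 = 0%N) ->
  (nth 0 la 0 + r = n)%N.
Proof.
move=> n pla sT hla jn Ej r0 last; have pT := std_pstd pla sT.
apply/eqP; rewrite eqn_leq; apply/andP; split.
  rewrite -size_hook_nodes; apply: (pstd_size (t := nd T)) (hook_nodes_uniq _ _) _ => w.
  case/hook_nodesP => -[e lt].
    by apply: (std_shape pla sT); rewrite e.
  case: w e lt => w1 w2 /= -> /andP [_ lt].
  have [||k kj Ek] := @pstd_down _ _ _ w1 0 pT jn; rewrite ?Ej //.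
  by exists k => //; lia.
rewrite -size_hook_nodes -[X in (X <= _)%N](size_iota 0 n) -(size_map (nd T)).
apply: uniq_leq_size.
  rewrite map_inj_in_uniq ?iota_uniq // => a b; rewrite !mem_iota /= add0n => an bn.
  exact: pstd_inj pT an bn.
move=> w /mapP [k]; rewrite mem_iota /= add0n => kn ->.
have sh := tab_in_shape k (std_tab sT); rewrite mem_cat.
case E : (nd T k) => [[|r'] c] in sh *.
  by apply/orP; left; apply/mapP; exists c; rewrite // mem_iota.
apply/orP; right; apply/mapP.
have c0 : c = 0%N.
  have := is_part_nth_anti (i := 1) (j := r'.+1) pla (ltn0Sn _).
  by move: hla sh; rewrite /hookish /=; lia.
exists r'.+1; last by rewrite c0.
rewrite mem_iota; suff : (r'.+1 <= r)%N by lia.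
rewrite leqNgt; apply/negP => lt.
have [kj|jk] := leqP k j; last by have := last _ jk kn; rewrite E.
have [||i ij Ei] := @pstd_down _ _ _ r 0 pT kn; rewrite ?E //=; first lia.
have := pstd_inj (j := i) (k := j) pT; rewrite Ei Ej => /(_ ltac:(lia) jn erefl) eij.
have ekj : k = j by lia.
by move: E; rewrite ekj Ej => -[]; lia.
Qed.

Section SeminormalForm.
Variables (F : closedFieldType) (m : nat).
Local Notation n := m.+1.
Hypothesis hp : n \in [pchar F].
Variable sq : F -> F.
Hypothesis hsq : forall x, sq x ^+ 2 = x.
Implicit Types (T U S : tab n) (la : seq nat).

(* [snf_mx] restricted to a set of tableaux. *)
Definition smx (A : {set tab n}) i : 'M[F]_#|A| :=
  \matrix_(j, k)
    (let T := enum_val j in let U := enum_val k in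
     if U == T then rhoi F T i
     else if U == stab i T then sq (1 - rhoi F T i ^+ 2) else 0).

Definition is_snf (A : {set tab n}) (rho : mx_representation F [set: 'S_n]%G #|A|) :=
  forall i, (i.+1 < n)%N -> rho (sgen n i.+1) = smx A i.+1.

Lemma rep_eq_on_sgen d (r1 r2 : mx_representation F [set: 'S_n]%G d) :
  (forall i, (i.+1 < n)%N -> r1 (sgen n i.+1) = r2 (sgen n i.+1)) -> forall s, r1 s = r2 s.
Proof.
move=> E s; apply: (young_ind (e := fun=> 0%N) (P := fun u => r1 u = r2 u)) => //.
- by rewrite !repr_mx1.
- by move=> u v Eu Ev; rewrite !repr_mxM ?inE // Eu Ev.
- by move=> i lt _; apply: E.
Qed.

Lemma is_snf_rsim A r1 r2 : @is_snf A r1 -> @is_snf A r2 -> mx_rsim r1 r2.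
Proof.
move=> s1 s2; exists 1%:M => //; first by rewrite row_free_unit unitmx1.
move=> x _; rewrite mul1mx mulmx1; apply: rep_eq_on_sgen => i lt.
by rewrite s1 // s2.
Qed.

Lemma conj_rep d N (rG : mx_representation F [set: 'S_n]%G d) (B : 'M[F]_(N, d)) :
  row_free B -> row_full B ->
  exists2 rho : mx_representation F [set: 'S_n]%G N, mx_rsim rho rG & forall g, rho g *m B = B *m rG g.
Proof.
move=> Bf Bu; pose f (g : 'S_n) := B *m rG g *m pinvmx B.
have fE g : f g *m B = B *m rG g by rewrite mulmxKpV // submx_full.
have fr : mx_repr [set: 'S_n]%G f.
  split=> [|x y _ _]; apply: (row_free_inj Bf); rewrite fE; first by rewrite repr_mx1 mulmx1 mul1mx.
  by rewrite -mulmxA fE mulmxA fE -mulmxA -repr_mxM ?inE.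
exists (MxRepresentation fr) => //; exists B => //.
exact: etrans (esym (eqP Bf)) (eqP Bu).
Qed.

Lemma stable_module d N (rG : mx_representation F [set: 'S_n]%G d) (B : 'M[F]_(N, d)) :
  (forall i, (i.+1 < n)%N -> (B *m rG (sgen n i.+1) <= B)%MS) -> mxmodule rG B.
Proof.
move=> st; apply/mxmoduleP => s _.
apply: (young_ind (e := fun=> 0%N) (P := fun u => (B *m rG u <= B)%MS)) => //.
- by rewrite repr_mx1 mulmx1.
- move=> u v Eu Ev; rewrite repr_mxM ?inE // mulmxA.
  by apply: submx_trans Ev; rewrite submxMr.
- by move=> i lt _; apply: st.
Qed.

Section OneRep.
Variables (d : nat) (rG : mx_representation F [set: 'S_n]%G d).
Local Notation s i := (rG (sgen n i.+1)).

Section Hook.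
Variable la : seq nat.
Hypothesis pla : is_part n la.
Local Notation X := (@Xstd m la).

Lemma not_okidx i : (i.+1 < n)%N -> ~~ okidx m la i -> hookish la /\ i = m.-1.
Proof.
by rewrite /okidx => lt; rewrite lt /= negbK => /andP [h /eqP e]; split => //; clear -e; lia.
Qed.

Lemma stab_not_ok T i : T \in X -> (i.+1 < n)%N -> ~~ okidx m la i -> stab i.+1 T \notin X.
Proof.
move=> TX lt nok; have [hla im] := not_okidx lt nok; apply/negP => TX'.
have m0 := char_m_gt0 hp; have im' : i.+1 = m by lia.
have ndm U : nd U i.+1 = nd U m by rewrite im'.
have E : nd (stab i.+1 T) i.+1 = nd T i.
  by rewrite nd_stab // eqxx; case: eqP => //; lia.
have := Xstd_arm pla m0 TX' hla; rewrite -ndm E -(Xstd_arm pla m0 TX hla) => e.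
have := pstd_inj (std_pstd pla (Xstd_std TX)) (ltnW lt) (ltnSn m) e; lia.
Qed.

(** What weights leave undecided: on hooks the last generator must act by scalars on the family. For
    other shapes every index is admissible and the condition is void. *)
Definition good T0 v0 := forall T i, T \in X -> (i.+1 < n)%N -> ~~ okidx m la i ->
  fam rG T0 v0 T *m s i = rhoi F T i.+1 *: fam rG T0 v0 T.

(** The vectors [vfam] have distinct weights, hence are independent; their span is stable, hence
    everything by irreducibility. In the basis they form, the generators are given by [smx]. *)
Lemma good_snf T0 v0 : mx_irreducible rG -> T0 \in X -> ell T0 = 0%N -> v0 != 0 -> ev rG T0 v0 ->
  good T0 v0 -> exists2 rho, @is_snf X rho & mx_rsim rho rG.
Proof.
move=> irr T0X e0 nz ev0 gd.
pose B := \matrix_(j < #|X|) vfam rG T0 v0 sq (enum_val j).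
have evB T : T \in X -> ev rG T (vfam rG T0 v0 sq T).
  by move=> TX; apply: wv_scale; apply: (fam_ev hp pla T0X).
have nzB T : T \in X -> vfam rG T0 v0 sq T != 0.
  move=> TX; rewrite scaler_eq0 invr_eq0 negb_or (gam_neq0 hp pla T0X e0 hsq TX).
  exact: (fam_neq0 hp pla T0X e0 ev0 nz TX).
have BE i : (i.+1 < n)%N -> smx X i.+1 *m B = B *m s i.
  move=> lt; apply/row_matrixP => j; rewrite !row_mul rowK.
  set T := enum_val j; have TX : T \in X := enum_valP j.
  have neT : stab i.+1 T != T.
    apply/eqP => /(congr1 (fun U => nd U i)); rewrite nd_stab ?eqxx ?(ltnW lt) // => E.
    have := pstd_inj (std_pstd pla (Xstd_std TX)) lt (ltnW lt) E; lia.
  have sumE (c : F) U : U \in X ->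
     \sum_k (if enum_val k == U then c else 0) *: row k B = c *: vfam rG T0 v0 sq U.
    move=> UX; rewrite (bigD1 (enum_rank_in UX U)) //= enum_rankK_in // eqxx rowK enum_rankK_in //.
    rewrite big1 ?addr0 // => k nk; case: eqP => [E|_]; last by rewrite scale0r.
    by case/eqP: nk; apply: enum_val_inj; rewrite enum_rankK_in.
  rewrite mulmx_sum_row.
  have [TX'|nTX'] := boolP (stab i.+1 T \in X).
    have ok : okidx m la i by apply: contraLR TX' => nok; apply: stab_not_ok.
    rewrite (vfam_sgen hp pla T0X e0 ev0 hsq TX ok TX') -!sumE // -big_split /=.
    apply: eq_bigr => k _; rewrite !mxE /= -/T -scalerDl; congr (_ *: _).
    case: eqP => [->|_]; first by rewrite [T == _]eq_sym (negPf neT) addr0.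
    by case: eqP => _; rewrite add0r.
  have vE : vfam rG T0 v0 sq T *m s i = rhoi F T i.+1 *: vfam rG T0 v0 sq T.
    have : fam rG T0 v0 T *m s i = rhoi F T i.+1 *: fam rG T0 v0 T.
      have [ok|nok] := boolP (okidx m la i); last exact: gd.
      exact: (fam_stuck hp pla T0X e0 ev0 TX ok nTX').
    rewrite /vfam; move: (fam rG T0 v0 T) => f E.
    by rewrite -scalemxAl E !scalerA mulrC.
  rewrite vE -sumE //; apply: eq_bigr => k _; rewrite !mxE /= -/T; congr (_ *: _).
  case: eqP => // _; case: eqP => // E; case/negP: nTX'.
  by rewrite -E enum_valP.
have Bf : row_free B.
  rewrite -kermx_eq0; apply/eqP/row_matrixP => r; rewrite row0; set y := row r _.
  have yB : y *m B = 0 by apply/sub_kermxP/row_sub.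
  apply/rowP => j; rewrite [RHS]mxE; set T := enum_val j; have TX : T \in X := enum_valP j.
  (* Projecting to the weight of [T] isolates the coefficient of the basis vector at [T]. *)
  have := congr1 (mulmx^~ (wproj rG T)) yB.
  rewrite [y *m B]mulmx_sum_row mul0mx mulmx_suml.
  rewrite (bigD1 j) //= big1 ?addr0 => [|k nk].
    rewrite rowK -scalemxAl (wproj_wv T (evB _ TX)) scalerA => /eqP.
    rewrite scaler_eq0 (negPf (nzB _ TX)) orbF mulf_eq0 (negPf (wnorm_neq0 F T)) orbF.
    by move/eqP.
  have UX : enum_val k \in X := enum_valP k.
  rewrite rowK -scalemxAl (wproj_wv T (evB _ UX)) (wnorm_eq0 hp pla) ?scale0r ?scaler0 //.
  - exact: Xstd_std TX.
  - exact: Xstd_std UX.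
  - by rewrite eq_sym (inj_eq enum_val_inj).
have Bm : mxmodule rG B by apply: stable_module => i lt; rewrite -BE // submxMl.
have Bu : row_full B.
  case/mx_irrP: irr => d0 irr; rewrite -sub1mx -(genmxE B) sub1mx; apply: irr.
    by rewrite (eqmx_module _ (genmxE B)).
  rewrite -mxrank_eq0 genmxE (eqP Bf) -lt0n; apply/card_gt0P; by exists T0.
have [rho sim rhoE] := conj_rep rG Bf Bu; exists rho => // i lt.
by apply: (row_free_inj Bf); rewrite rhoE BE.
Qed.

End Hook.

(** A hook tableau with [n] at the foot of a leg of length [r] is outside [Xstd]. With first row [k]
    one has [k + r = n], so moving [n] to the end of the arm keeps its residue and gives a tableau
    of the next larger hook. *)
Lemma weight_Xstd c : wt rG n c ->
  exists la T, [/\ is_part n la, T \in Xstd la & forall k, (k < n)%N -> c k = wtT F T k].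
Proof.
move=> /(weight_nodes hp) [t pt ct].
pose la := shape_of m t; pose T := tab_of m t.
have pla : is_part n la := shape_of_part pt; have sT : T \in Std n la := tab_of_std pt.
have cT k : (k < n)%N -> c k = wtT F T k by move=> kn; rewrite ct // /wtT nd_tab_of.
have [TX|nTX] := boolP (T \in Xstd la); first by exists la, T.
have hla : hookish la by apply: contraNT nTX => /negPf h; rewrite inE sT h.
have rowm : (T ord_max).1 != ord0 by apply: contraNneq nTX => h; rewrite inE sT h eqxx implybT.
have m0 := char_m_gt0 hp; have pT := std_pstd pla sT.
case Em : (nd T m) => [r c'].
have r0 : (0 < r)%N.
  rewrite lt0n; apply: contraNneq rowm => r0; apply/eqP/ord_inj.
  have : nd T m = ((T ord_max).1 : nat, (T ord_max).2 : nat) := nd_ord T ord_max.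
  by rewrite Em r0 => -[<-].
have c'0 : c' = 0%N.
  have := tab_in_shape m (std_tab sT); rewrite Em /=.
  have := is_part_nth_anti (i := 1) (j := r) pla r0; move: hla; rewrite /hookish; lia.
rewrite c'0 in Em; set k := nth 0%N la 0.
have kr : (k + r = n)%N.
  by apply: (hook_count pla sT hla (ltnSn m) Em r0) => j; lia.
pose t' j := if (j < m)%N then nd T j else (0, k)%N.
have t'E j : (j < m)%N -> nd T j = t' j by rewrite /t' => ->.
have pt' : pstd n t'.
  move=> j; rewrite ltnS leq_eqVlt => /predU1P [->|jm]; last first.
    rewrite -t'E //; apply: addable_ext (pT j (ltnW jm)) => i ij.
    by apply: t'E; apply: ltn_trans jm.
  rewrite {2}/t' ltnn; apply: (addable_ext (t := nd T)); first exact: t'E.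
  split=> [i im Ei|r1 c1 []|r1 c1 [<- Ek]] //.
    by have := tab_in_shape i (std_tab sT); rewrite Ei /= -/k ltnn.
  have [|i iN Ei] := @std_shape _ la T (0, c1)%N pla sT; first by rewrite /= -/k Ek.
  exists i => //; rewrite ltn_neqAle -ltnS iN andbT; apply: contraTneq r0 => eim.
  by move: Ei; rewrite eim Em => -[-> _].
exists (shape_of m t'), (tab_of m t'); split.
- exact: shape_of_part.
- rewrite inE tab_of_std //; apply/implyP => _; apply/eqP/ord_inj.
  have := nd_tab_of pt' (ltnSn m); rewrite {2}/t' ltnn => E.
  have : nd (tab_of m t') m = ((tab_of m t' ord_max).1 : nat, (tab_of m t' ord_max).2 : nat).
    exact: (nd_ord (tab_of m t') ord_max).
  by rewrite E => -[<- _].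
- move=> j jn; rewrite cT // /wtT nd_tab_of // /t'; case: ltnP => // mj.
  have -> : j = m by lia.
  rewrite Em !resE /= subr0 sub0r; apply/eqP; rewrite eq_sym -subr_eq0 opprK -natrD kr.
  by rewrite (pcharf0 hp).
Qed.

End OneRep.
End SeminormalForm.

(** * Hook weights *)

Section HookType.
Variables (F : closedFieldType) (m : nat).
Local Notation n := m.+1.
Hypothesis hp : n \in [pchar F].
Variables (d : nat) (rG : mx_representation F [set: 'S_n]%G d).
Local Notation s i := (rG (sgen n i.+1)).
Local Notation z := m.-1.
Implicit Types (T U S : tab n) (la : seq nat).

Lemma predmS : z.+1 = m.
Proof. by rewrite prednK // (char_m_gt0 hp). Qed.

Lemma nd_predmS T : nd T z.+1 = nd T m.
Proof. by rewrite predmS. Qed.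

Lemma predm_lt : (z.+1 < n)%N.
Proof. by rewrite predmS. Qed.

(** The node of [n - 1] lies below the first row. On a hook in [Xstd] the alternative is that
    [n - 1] stands just before [n] in the arm. *)
Definition leg T := (0 < (nd T z).1)%N.

Section OneHook.
Variable la : seq nat.
Hypotheses (pla : is_part n la) (hla : hookish la).
Local Notation X := (@Xstd m la).

Lemma hook_last T : T \in X -> nd T m = (0, (nth 0%N la 0).-1)%N.
Proof. by move=> TX; apply: Xstd_arm => //; apply: char_m_gt0 hp. Qed.

Lemma hook_nd_row T k : T \in X -> (0 < (nd T k).1)%N -> (nd T k).2 = 0%N.
Proof.
move=> TX r; have := tab_in_shape k (std_tab (Xstd_std TX)).
have := is_part_nth_anti pla r; move: hla; rewrite /hookish; lia.
Qed.

Lemma arm_nd T : T \in X -> ~~ leg T -> nd T z = (0, (nth 0%N la 0).-2)%N.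
Proof.
move=> TX; rewrite /leg lt0n negbK => /eqP r0; have pT := std_pstd pla (Xstd_std TX).
have l0 := Xstd_la0 hp pla TX; have Em := hook_last TX; have zn := ltnW predm_lt.
case E : (nd T z) r0 => [r c] /= r0; rewrite r0 in E *; congr (_, _).
have := tab_in_shape z (std_tab (Xstd_std TX)); rewrite E /= => cl.
have c1 : c <> (nth 0%N la 0).-1.
  move=> ec; have := pstd_inj pT zn (ltnSn m); rewrite E Em ec => /(_ erefl).
  by have := predmS; lia.
have [|j jn Ej] := @std_shape _ la T (0, c.+1)%N pla (Xstd_std TX); first by rewrite /=; lia.
have [_ _ H] := pT _ jn; have [j' jj Ej'] := H _ _ Ej.
have := pstd_inj pT (j := j') (k := z); rewrite E Ej' => /(_ ltac:(lia) zn erefl) e.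
have jm : j = m by have := predmS; lia.
by move: Ej; rewrite jm Em => -[]; lia.
Qed.

Lemma leg_nd T : T \in X -> leg T -> nd T z = ((nd T z).1, 0)%N /\ (nth 0%N la 0 + (nd T z).1 = n)%N.
Proof.
move=> TX lT; have c0 := hook_nd_row TX lT.
have E : nd T z = ((nd T z).1, 0)%N by rewrite {1}[nd T z]surjective_pairing c0.
split => //; apply: (hook_count pla (Xstd_std TX) hla (ltnW predm_lt) E lT) => k zk kn.
have -> : k = m by have := predmS; lia.
by rewrite hook_last.
Qed.

Lemma leg_la0_lt T : T \in X -> leg T -> (nth 0%N la 0 < n)%N.
Proof. by move=> TX lT; have [_ <-] := leg_nd TX lT; rewrite -[X in (X < _)%N]addn0 ltn_add2l. Qed.

Lemma wtT_last T : T \in X -> wtT F T z.+1 = (nth 0%N la 0).-1%:R.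
Proof. by move=> TX; rewrite /wtT nd_predmS hook_last // resE subr0. Qed.

Lemma arm_wtT T : T \in X -> ~~ leg T -> wtT F T z = (nth 0%N la 0).-2%:R.
Proof. by move=> TX lT; rewrite /wtT arm_nd // resE subr0. Qed.

Lemma leg_wtT T : T \in X -> leg T -> wtT F T z = (nth 0%N la 0)%:R.
Proof.
move=> TX lT; have [E kr] := leg_nd TX lT; rewrite /wtT E resE /= sub0r.
apply/eqP; rewrite eq_sym -subr_eq0 opprK -natrD kr; apply/eqP; exact: (pcharf0 hp).
Qed.

Lemma arm_rho T : T \in X -> ~~ leg T -> rhoi F T z.+1 = 1.
Proof.
move=> TX lT; rewrite rhoiE wtT_last // arm_wtT //.
have := Xstd_la0 hp pla TX; case: (nth _ la 0) => [|[|k]] //= _.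
by rewrite -natr1 addrAC subrr add0r invr1.
Qed.

Lemma leg_rho T : T \in X -> leg T -> rhoi F T z.+1 = -1.
Proof.
move=> TX lT; rewrite rhoiE wtT_last // leg_wtT //.
have := Xstd_la0 hp pla TX; case: (nth _ la 0) => [|k] //= _.
by rewrite -natr1 opprD addrA subrr sub0r invrN1.
Qed.

End OneHook.

(** With first row [k], the last two residues are [k, k - 1] if [n - 1] is in the leg, and
    [k - 2, k - 1] otherwise. After the swap the last residue is [k] or [k - 2], which makes the
    first row [k + 1] or [k - 1]; a node [(1, 1)] would need residue 0 at a place where it cannot
    occur. *)
Lemma swapped_type la T w : is_part n la -> hookish la -> T \in Xstd la -> w != 0 -> wv rG n (sw z (wtT F T)) w ->
  exists la' T', [/\ is_part n la', hookish la', T' \in Xstd la', ev rG T' w &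
     if leg T then nth 0%N la' 0 = (nth 0%N la 0).+1
     else ((nth 0%N la' 0).+1 = nth 0%N la 0) /\ leg T'].
Proof.
move=> pla hla TX wnz ww; have [|la' [T' [pla' TX' cT']]] := @weight_Xstd F m hp d rG (sw z (wtT F T)).
  by exists w.
have evT' : ev rG T' w by apply: wv_ext ww.
have sT := Xstd_std TX; have sT' := Xstd_std TX'.
have pT := std_pstd pla sT; have pT' := std_pstd pla' sT'.
have l0 := Xstd_la0 hp pla TX; have l0' := Xstd_la0 hp pla' TX'.
have ln := is_part_nth_le 0 pla; have ln' := is_part_nth_le 0 pla'.
have zm := predmS; have lt := predm_lt.
have cz : wtT F T' z = (nth 0%N la 0).-1%:R by rewrite -cT' ?(ltnW lt) // swL (wtT_last pla hla TX).
have cm : wtT F T' z.+1 = wtT F T z by rewrite -cT' // swR.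
have hla' : hookish la'.
  apply/negPn/negP => /(std_not_hookish pla' sT') [j jn Ej].
  have [jz|zj] := ltnP j z.
    have e : nd T j = nd T' j.
      apply: (pstd_prefix_eq hp (ltnW lt)) jz => [||k kz].
      - by apply: pstd_le pT; apply: ltnW (ltnW lt).
      - by apply: pstd_le pT'; apply: ltnW (ltnW lt).
      - by have := cT' k (ltn_trans kz (ltnW lt)); rewrite swD //; clear -kz; lia.
    by have := hook_nd_row (k := j) pla hla TX; rewrite e Ej => /(_ isT).
  have r11 : res F (1, 1)%N = 0%:R by rewrite resE subrr.
  have [ejz|njz] := eqVneq j z.
    move: cz; rewrite /wtT -ejz Ej r11 => /(natr_inj_mod hp) []; clear -l0 ln; lia.
  have ejm : j = z.+1 by clear -njz zj jn zm; lia.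
  have hk := pstd_hook pT' jn jn; rewrite Ej /= in hk.
  move: cm; rewrite /wtT -ejm Ej r11 -/(wtT F T z); have [lT|aT] := boolP (leg T).
    rewrite (leg_wtT pla hla TX lT) => /(natr_inj_mod hp).
    by have kn := leg_la0_lt pla hla TX lT; case; clear -l0 kn; lia.
  rewrite (arm_wtT pla hla TX aT) => /(natr_inj_mod hp) e'.
  have e : 0%N = (nth 0%N la 0).-2 by case: e'; clear -l0 ln; lia.
  have := arm_nd pla hla TX aT; rewrite -e => Ez.
  have [a1 a2 a3] := pT 0%N isT.
  have E0 : nd T 0 = (0, 0)%N.
    by case E : (nd T 0) => [[|r] [|c]] //; [case: (a3 _ _ E)|case: (a2 _ _ E)|case: (a2 _ _ E)].
  by have := pstd_inj pT (j := z) (k := 0) (ltnW lt) isT; rewrite E0 Ez => /(_ erefl); clear -hk zm; lia.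
exists la', T'; split => //.
have := Xstd_arm pla' (char_m_gt0 hp) TX' hla' => Em'.
have cm' : wtT F T' z.+1 = (nth 0%N la' 0).-1%:R by rewrite /wtT nd_predmS Em' resE subr0.
rewrite cm' in cm; have [lT|aT] := boolP (leg T).
  rewrite (leg_wtT pla hla TX lT) in cm; have kr := leg_la0_lt pla hla TX lT.
  by case: (natr_inj_mod hp cm); clear -kr l0 l0' ln ln'; lia.
rewrite (arm_wtT pla hla TX aT) in cm.
have e1 : (nth 0%N la' 0).+1 = nth 0%N la 0 by case: (natr_inj_mod hp cm); clear -l0 l0' ln ln'; lia.
split => //; apply/negPn/negP => aT'.
move: cz; rewrite (arm_wtT pla' hla' TX' aT') => /(natr_inj_mod hp) []; clear -l0 l0' ln ln' e1; lia.
Qed.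

Lemma sgen_far_comm i j : (i.+1 < j)%N -> (j.+1 < n)%N -> s i *m s j = s j *m s i.
Proof.
move=> ij jn; rewrite -!repr_mxM ?inE //; congr (rG _).
rewrite [RHS]conjgC; congr (_ * _)%g; rewrite [sgen n j.+1]sgenE tpermJ.
by rewrite !sgen_inordD //; lia.
Qed.

Section Connect.
Variable la : seq nat.
Hypotheses (pla : is_part n la) (hla : hookish la).
Local Notation X := (@Xstd m la).
Variables (T0 : tab n) (v0 : 'rV[F]_d).
Hypotheses (T0X : T0 \in X) (e0 : ell T0 = 0%N) (ev0 : ev rG T0 v0).
Local Notation f T := (fam rG T0 v0 T).

Lemma leg_sort T : T \in X -> leg T -> exists T1,
  [/\ T1 \in X, nd T1 z = nd T z, col_sorted z T1 & (f T *m s z = - f T <-> f T1 *m s z = - f T1)].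
Proof.
have [N] := ubnP (ell T); elim: N T => // N IH T; rewrite ltnS => lN TX lT.
have tT := std_tab (Xstd_std TX); have zm := predmS; have zn := predm_lt.
have [so|nso] := boolP [forall a : 'I_n, forall b : 'I_n,
    (a < b)%N && (b < z)%N ==> (colkey T a < colkey T b)%N].
  exists T; split => // a b ab bz.
  by have /forallP/(_ a)/forallP/(_ b)/implyP := so; apply; rewrite ab bz.
have [|i [iz de]] := not_col_sorted tT (ltnW (ltnW zn)).
  move=> so; case/negP: nso; apply/forallP => a; apply/forallP => b.
  by apply/implyP => /andP [ab bz]; apply: so.
have lt : (i.+1 < n)%N by clear -iz zn; lia.
have ok : okidx m la i.
  by rewrite /okidx lt /= negb_and; apply/orP; right; clear -iz zm; lia.
have TX' : stab i.+1 T \in X.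
  by apply: Xstd_stab => //; apply: descent_std de => //; apply: Xstd_std TX.
have Ez : nd (stab i.+1 T) z = nd T z.
  rewrite nd_stab ?(ltnW zn) //; case: eqP => [e|_]; first by clear -iz e; lia.
  by case: eqP => [e|//]; clear -iz e; lia.
have [||| T1 [T1X E1 so1 iff1]] := IH (stab i.+1 T) => //.
- by rewrite -(ell_descent lt de).
- by rewrite /leg Ez.
exists T1; split => //; first by rewrite E1.
apply: iff_trans iff1.
have fE := fam_up hp pla T0X e0 ev0 TX' ok.
rewrite stabK !colkey_stab sgen_inordL sgen_inordR in fE.
have {}fE := fE TX de; have cm := sgen_far_comm iz zn.
have ss := swap_swap rG i (rhoi F (stab i.+1 T) i.+1) (f (stab i.+1 T)).
have ne1 : 1 - rhoi F (stab i.+1 T) i.+1 ^+ 2 != 0.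
  by rewrite subr_eq0 eq_sym (stab_rho hp pla TX' ok) // stabK.
rewrite -fE in ss; move: (f T) (f (stab i.+1 T)) fE ss => g g' fE ss.
set r := rhoi _ _ _ in fE ss ne1 *; split=> H.
  apply: (scalerI ne1); rewrite scalemxAl -ss mulmxDl -mulmxA cm mulmxA H scalerN -scalemxAl H -ss.
  by rewrite mulNmx scalerN opprD.
by rewrite fE mulmxBl -mulmxA cm mulmxA H -scalemxAl H mulNmx scalerN opprD.
Qed.

(** Sorting the entries before [n - 1] uses generators that commute with the last one, so being an
    eigenvector for -1 is transported along. All leg tableaux of a hook have the same sorted
    form. *)
Lemma leg_connect T S : T \in X -> S \in X -> leg T -> leg S ->
  f T *m s z = - f T -> f S *m s z = - f S.
Proof.
move=> TX SX lT lS; have [T1 [T1X ET1 sT1 iT]] := leg_sort TX lT.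
have [S1 [S1X ES1 sS1 iS]] := leg_sort SX lS.
suff E : T1 = S1 by move/iT; rewrite E => /iS.
apply: (col_sorted_inj pla (std_tab (Xstd_std T1X)) (std_tab (Xstd_std S1X)) sT1 sS1) => a za.
have zm := predmS.
have ndE : nd T1 a = nd S1 a.
  have [ea|na] := eqVneq (a : nat) z.
    have [ET kT] := leg_nd pla hla TX lT; have [ES kS] := leg_nd pla hla SX lS.
    by rewrite ea ET1 ES1 ET ES; congr (_, _); clear -kT kS; lia.
  have -> : (a : nat) = m by have an := ltn_ord a; clear -an na za zm; lia.
  by rewrite !(hook_last pla hla).
move: ndE; rewrite !nd_ord => -[h1 h2].
by rewrite [LHS]surjective_pairing [RHS]surjective_pairing; congr (_, _); apply: ord_inj.
Qed.

End Connect.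

Definition legs_good la T0 v0 := [/\ is_part n la, hookish la, T0 \in @Xstd m la, ell T0 = 0%N &
  [/\ v0 != 0, ev rG T0 v0 & forall T, T \in Xstd la -> leg T ->
     fam rG T0 v0 T *m s z = - fam rG T0 v0 T]].

Definition good_start := exists la T0 v0, [/\ is_part n la, T0 \in @Xstd m la, ell T0 = 0%N, v0 != 0 &
  ev rG T0 v0 /\ good rG la T0 v0].

(** The descending phase. A defect at an arm tableau is a weight vector of the next smaller hook at
    a leg tableau; being an eigenvector for -1, it makes all legs of that hook good, and the first
    row has become shorter. *)
Lemma legs_good_start k la T0 v0 : (nth 0%N la 0 <= k)%N -> legs_good la T0 v0 -> good_start.
Proof.
elim: k la T0 v0 => [|k IH] la T0 v0 lk [pla hla T0X e0 [nz ev0 lg]].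
  by have l0 := Xstd_la0 hp pla T0X; clear -l0 lk; lia.
have fev T : T \in Xstd la -> ev rG T (fam rG T0 v0 T) by apply: (fam_ev hp pla T0X e0 ev0).
have [/forallP ag|/forallPn [T]] := boolP [forall T : tab n,
   (T \in Xstd la) && ~~ leg T ==> (fam rG T0 v0 T *m s z == fam rG T0 v0 T)].
  exists la, T0, v0; split => //; split => // T i TX lt nok.
  have [_ ->] := not_okidx lt nok; have [lT|aT] := boolP (leg T).
    by rewrite lg // (leg_rho pla hla TX lT) scaleN1r.
  by rewrite (arm_rho pla hla TX aT) scale1r; apply/eqP; have := ag T; rewrite TX aT.
rewrite negb_imply => /andP [/andP [TX aT] bad].
set w := fam rG T0 v0 T *m s z - fam rG T0 v0 T.
have wnz : w != 0 by rewrite subr_eq0.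
have nzf := fam_neq0 hp pla T0X e0 ev0 nz TX.
have wE := ev_stab hp TX predm_lt (fev _ TX) nzf.
rewrite (arm_rho pla hla TX aT) scale1r -/w in wE.
have ww : wv rG n (sw z (wtT F T)) w.
  by apply: wv_ext wE => j jn; rewrite wtT_stab // predm_lt.
have [la' [T' [pla' hla' TX' ev']]] := swapped_type pla hla TX wnz ww.
rewrite (negPf aT) => -[k' lT'].
have [T0' T0X' e0'] := Xstd_T0 hp pla' TX'.
have [v0' [nz' ev0' [a a0 fa]]] := fam_through hp pla' T0X' e0' TX' ev' wnz.
apply: (IH la' T0' v0'); first by clear -lk k'; lia.
split => //; split => // S SX lS.
apply: (leg_connect pla' hla' T0X' e0' ev0' TX' SX lT' lS).
rewrite fa -scalemxAl -scalerN; congr (_ *: _).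
(* The defect is [f *m s - f], and [s] is an involution, hence the eigenvalue -1. *)
by rewrite /w mulmxBl -mulmxA mul_sgen_sgen mulmx1 opprB.
Qed.

(** The ascending phase: a defect at a leg tableau is a weight vector of the next larger hook. It
    ends at the latest with the one-row shape, which has no leg. *)
Lemma hook_start k la T v : (n - nth 0%N la 0 <= k)%N -> is_part n la -> hookish la ->
  T \in Xstd la -> v != 0 -> ev rG T v -> good_start.
Proof.
elim: k la T v => [|k IH] la T v lk pla hla TX nz evT; have [T0 T0X e0] := Xstd_T0 hp pla TX;
  have [v0 [nz0 ev0 _]] := fam_through hp pla T0X e0 TX evT nz.
  apply: (@legs_good_start _ la T0 v0 (leqnn _)); split => //; split => // S SX lS.
  by have kn := leg_la0_lt pla hla SX lS; clear -kn lk; lia.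
have [/forallP lg|/forallPn [S]] := boolP [forall S : tab n,
   (S \in Xstd la) && leg S ==> (fam rG T0 v0 S *m s z == - fam rG T0 v0 S)].
  apply: (@legs_good_start _ la T0 v0 (leqnn _)); split => //; split => // S SX lS.
  by apply/eqP; have := lg S; rewrite SX lS.
rewrite negb_imply => /andP [/andP [SX lS] bad].
set w := fam rG T0 v0 S *m s z + fam rG T0 v0 S.
have wnz : w != 0 by rewrite addr_eq0.
have nzf := fam_neq0 hp pla T0X e0 ev0 nz0 SX.
have wE := ev_stab hp SX predm_lt (fam_ev hp pla T0X e0 ev0 SX) nzf.
rewrite (leg_rho pla hla SX lS) scaleN1r opprK -/w in wE.
have ww : wv rG n (sw z (wtT F S)) w.
  by apply: wv_ext wE => j jn; rewrite wtT_stab // predm_lt.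
have [la' [T' [pla' hla' TX' ev']]] := swapped_type pla hla SX wnz ww.
rewrite lS => k'; apply: (IH la' T' w) => //.
by clear -lk k'; lia.
Qed.

Lemma good_start_exists : (0 < d)%N -> good_start.
Proof.
move=> d0; have [c [v nz wc]] := weight_exists hp rG d0.
have [|la [T [pla TX cT]]] := @weight_Xstd F m hp d rG c; first by exists v.
have evT : ev rG T v by apply: wv_ext wc.
have [hla|nh] := boolP (hookish la); first exact: (hook_start (leqnn _) pla hla TX nz evT).
have [T0 T0X e0] := Xstd_T0 hp pla TX.
have [v0 [nz0 ev0 _]] := fam_through hp pla T0X e0 TX evT nz.
exists la, T0, v0; split => //; split => // S i SX lt nok.
by have [h _] := not_okidx lt nok; rewrite h in nh.
Qed.

Variable sq : F -> F.
Hypothesis hsq : forall x, sq x ^+ 2 = x.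

Lemma irr_snf : mx_irreducible rG ->
  exists2 la, is_part n la & exists2 rho, is_snf sq (A := Xstd la) rho & mx_rsim rho rG.
Proof.
move=> irr; have [|la [T0 [v0 [pla T0X e0 nz [ev0 gd]]]]] := good_start_exists.
  by case/mx_irrP: irr.
by exists la => //; apply: (good_snf hp hsq pla irr T0X e0 nz ev0 gd).
Qed.

End HookType.

(** * Existence of tableaux and the order of the column group *)

Lemma psum_mono la r r' : (r <= r')%N -> (psum la r <= psum la r')%N.
Proof. by move=> /subnKC <-; rewrite /psum big_split_ord leq_addr. Qed.

Section TabExists.
Variables (n : nat) (la : seq nat).
Hypothesis pla : is_part n la.

Lemma tab_exists : exists T : tab n, is_tab la T.
Proof.
pose D := [set x : 'I_n * 'I_n | (x.2 < nth 0%N la x.1)%N].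
have cD : #|D| = n.
  rewrite -[RHS](is_part_sum pla (leqnn n)) -sum1_card.
  rewrite (partition_big (fun x => x.1) xpredT) //=; apply: eq_bigr => i _.
  rewrite -(card_ord_below (is_part_nth_le i pla)) -sum1_card.
  rewrite (reindex_onto (fun j : 'I_n => (i, j)) snd) => [|[i' j'] /=]; last first.
    by move=> /andP [_ /eqP ->].
  by apply: eq_bigl => j; rewrite !inE /= !eqxx !andbT.
exists [ffun a => enum_val (cast_ord (esym cD) a)]; apply/andP; split.
  by apply/injectiveP => a b; rewrite !ffunE => /enum_val_inj /cast_ord_inj.
by apply/forallP => a; rewrite ffunE; have := enum_valP (cast_ord (esym cD) a); rewrite inE.
Qed.

Lemma part_ones : (nth 0 la 0 <= 1)%N -> la = nseq n 1%N.
Proof.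
move=> l0; have /and3P [_ /allP pos /eqP <-] := pla.
have : all (pred1 1%N) la.
  apply/allP => x xl; have := pos _ xl; rewrite /= => x0.
  have := is_part_nth_anti pla (leq0n (index x la)); rewrite nth_index // => le.
  by clear -le x0 l0; lia.
by move/all_pred1P => e; rewrite {1}e; congr (nseq _ _); rewrite {2}e sumn_nseq mul1n.
Qed.
End TabExists.

Section ColumnGroupOrder.
Variables (F : fieldType) (n : nat) (la : seq nat).
Hypotheses (hp : n \in [pchar F]) (pla : is_part n la).

(** By Cauchy, divisibility by the prime [n] gives a column permutation of order [n]. On [n] points
    this is an [n]-cycle, so all entries share one column. *)
Lemma colgrp_card_neq0 (T : tab n) : la != nseq n 1%N -> is_tab la T -> #|colgrp T|%:R != 0 :> F.
Proof.
move=> ne tT; apply: contra ne; rewrite -(dvdn_pcharf hp) => dv.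
have /andP [pr _] := hp; have [x xC ox] := Cauchy pr (G := colgrp_group T) dv.
have [a xa] : exists a, x a != a.
  apply/existsP; apply: contraTT (prime_gt1 pr) => /existsPn no.
  rewrite -ox -leqNgt (_ : x = 1%g) ?order1 //; apply/permP => a.
  by rewrite perm1; apply/eqP; have := no a; rewrite negbK.
have full : porbit x a = setT.
  apply/eqP; rewrite eqEcard subsetT cardsT card_ord.
  have dvo : (#|porbit x a| %| #[x]%g)%N by rewrite porbit.unlock; apply: (dvdn_orbit 'P).
  rewrite ox in dvo.
  case/primeP: pr => _ /(_ _ dvo) /orP [/eqP c1|/eqP cn]; last by rewrite cn leqnn.
  case/eqP: xa; have /cards1P [b Eb] : #|porbit x a| == 1%N by rewrite c1.
  have : x a \in porbit x a by have := mem_porbit x 1 a; rewrite expg1.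
  have : a \in porbit x a by apply: porbit_id.
  by rewrite Eb !inE => /eqP -> /eqP ->.
have col b : (T b).2 = (T a).2.
  have : b \in porbit x a by rewrite full inE.
  case/porbitP => k ->; elim: k => [|k IH]; first by rewrite expg0 perm1.
  by rewrite expgSr permM (colgrpP _ _ xC).
apply/eqP/(part_ones pla); rewrite leqNgt; apply/negP => l0.
have n1 := prime_gt1 pr; have n0 := ltnW n1.
have [a0 E0] := @tab_surj n la pla T (Ordinal n0) (Ordinal n0) tT (ltnW l0).
have [a1 E1] := @tab_surj n la pla T (Ordinal n0) (Ordinal n1) tT l0.
by have := col a0; rewrite -(col a1) E0 E1 => /(congr1 val).
Qed.
End ColumnGroupOrder.

(** * Matching labels *)

Section TypeOfD.
Variables (F : closedFieldType) (m : nat).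
Local Notation n := m.+1.
Hypothesis hp : n \in [pchar F].
Variable sq : F -> F.
Hypothesis hsq : forall x, sq x ^+ 2 = x.
Implicit Types (T U S : tab n) (la : seq nat).

Lemma sq0 : sq 0 = 0.
Proof. by have /eqP := hsq 0; rewrite expf_eq0 => /eqP. Qed.

Lemma col_sorted_mono la T : is_tab la T -> col_sorted n T ->
  {homo (fun a => (T a).2 : nat) : a b / (a <= b)%N}.
Proof.
move=> tT so a b; rewrite leq_eqVlt => /predU1P [/ord_inj -> //|ab].
have := so _ _ ab (ltn_ord b); rewrite /colkey.
have := ltn_ord (T a).1; have := ltn_ord (T b).1.
by move: (nat_of_ord _) (nat_of_ord _) (nat_of_ord _) (nat_of_ord _) => x y u v; clear; nia.
Qed.

Lemma col_sorted_below la T i : is_part n la -> T \in Std n la -> col_sorted n T -> (i.+1 < n)%N ->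
  (nd T i).2 = (nd T i.+1).2 -> nd T i.+1 = ((nd T i).1.+1, (nd T i).2).
Proof.
move=> pla sT so lt e; have pT := std_pstd pla sT; have lt' := ltnW lt.
have key j k : (j < k)%N -> (k < n)%N -> ((nd T j).2 * n + (nd T j).1 < (nd T k).2 * n + (nd T k).1)%N.
  move=> jk kn; have jn := ltn_trans jk kn; have := so (inord j) (inord k); rewrite !inordK //.
  by move=> /(_ jk kn).
move: e; case E1 : (nd T i) => [r c]; case E2 : (nd T i.+1) => [r' c'] /= e; subst c'.
have rr : (r < r')%N by have := key i i.+1 (ltnSn i) lt; rewrite E1 E2 /=; clear; lia.
congr (_, _); apply/eqP; rewrite eqn_leq rr andbT leqNgt; apply/negP => rr'.
have [_ H _] := pT _ lt; have := H r'.-1 c; rewrite E2 prednK; last by clear -rr; lia.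
case=> // j ji Ej; have [ji'|ij] := ltnP j i.
  by have := key j i ji' lt'; rewrite Ej E1 /=; clear -rr'; lia.
have ej : j = i by clear -ji ij; lia.
by move: Ej; rewrite ej E1 => -[]; clear -rr'; lia.
Qed.

(** In the column-reading tableau, consecutive entries of a column are vertically adjacent, so the
    generators of its column group act on the basis vector at [T0] by -1. The signed sum multiplies
    this vector by the group order. *)
Lemma snf_colsum la T0 rho : is_part n la -> T0 \in Xstd la -> ell T0 = 0%N ->
  la != nseq n 1%N -> is_snf sq (A := Xstd la) rho -> colsum rho T0 != 0.
Proof.
move=> pla TX e0 ne sn; have sT := Xstd_std TX; have tT := std_tab sT.
have so := ell0_sorted tT e0.
pose j0 := enum_rank_in TX T0; have Ej : enum_val j0 = T0 := enum_rankK_in TX TX.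
pose e : 'rV[F]_#|@Xstd m la| := delta_mx 0 j0.
have es s : s \in colgrp T0 -> e *m rho s = (-1) ^+ odd_perm s *: e.
  move=> /colgrpP Hs; apply: (young_ind (e := fun a => (T0 a).2 : nat)
    (P := fun u => e *m rho u = (-1) ^+ odd_perm u *: e)).
  - exact: (col_sorted_mono tT so).
  - by rewrite repr_mx1 mulmx1 odd_perm1 scale1r.
  - move=> u v Eu Ev; rewrite repr_mxM ?inE // mulmxA Eu -scalemxAl Ev scalerA odd_permM signr_addb.
    by [].
  - move=> i lt ec; rewrite sn // sgenE odd_tperm -val_eqE /= !inordK ?(ltnW lt) //.
    rewrite neq_ltn ltnSn /= expr1 scaleN1r -rowE.
    have Er : rhoi F T0 i.+1 = -1.
      rewrite rhoiE /wtT (col_sorted_below pla sT so lt ec) !resE /= -natr1.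
      by rewrite [X in X^-1](_ : _ = -1) ?invrN1 //; ring.
    (* Here [rho ^+ 2 = 1], so the off-diagonal square root is that of 0. *)
    apply/rowP => k; rewrite !mxE /= Ej Er sqrrN expr1n subrr sq0 if_same.
    by rewrite -[T0 in X in if X then _ else _]Ej (inj_eq enum_val_inj); case: eqP => // _; rewrite oppr0.
  - by move=> a; rewrite Hs.
have eK : e *m colsum rho T0 = #|colgrp T0|%:R *: e.
  rewrite scaler_nat -sumr_const mulmx_sumr; apply: eq_bigr => s sC.
  by rewrite -scalemxAr es // scalerA -signr_addb addbb scale1r.
apply: contraNneq (colgrp_card_neq0 hp pla ne tT) => K0.
move/eqP: eK; rewrite K0 mulmx0 eq_sym scaler_eq0 => /orP [//|/eqP/rowP/(_ j0)].
by rewrite !mxE !eqxx => /eqP; rewrite oner_eq0.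
Qed.

Definition ones := nseq n 1%N.

Lemma Xstd_not_ones la T : is_part n la -> T \in Xstd la -> la != ones.
Proof. by move=> pla TX; apply: contraTneq (Xstd_la0 hp pla TX) => ->; rewrite nth_nseq. Qed.

Lemma D_irr la : is_part n la -> la != ones -> mx_irreducible (Drep n F la).
Proof.
move=> pla ne; have [T tT] := tab_exists pla.
exact: (Drep_irr pla tT (colgrp_card_neq0 hp pla ne tT)).
Qed.

Lemma D_not_rsim la mu : is_part n la -> is_part n mu -> la != ones -> mu != ones ->
  mx_rsim (Drep n F la) (Drep n F mu) -> la = mu.
Proof.
move=> pla pmu nla nmu; have [T tT] := tab_exists pla; have [U tU] := tab_exists pmu.
exact: (Drep_not_rsim pla pmu tT tU (colgrp_card_neq0 hp pla nla tT) (colgrp_card_neq0 hp pmu nmu tU)).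
Qed.

Definition D_type mu la := exists2 rho, is_snf sq (A := Xstd la) rho & mx_rsim rho (Drep n F mu).

Lemma D_type_exists mu : is_part n mu -> mu != ones ->
  exists la, [/\ is_part n la, la != ones & D_type mu la].
Proof.
move=> pmu nmu; have irr := D_irr pmu nmu; have [la pla [rho sn sim]] := irr_snf hp hsq irr.
exists la; split => //; last by exists rho.
have d0 : (0 < #|@Xstd m la|)%N.
  by case/mx_irrP: (mx_rsim_irr (mx_rsim_sym sim) irr).
by have [T TX] := card_gt0P d0; apply: Xstd_not_ones TX.
Qed.

Lemma D_type_dom mu la : is_part n mu -> mu != ones -> is_part n la -> D_type mu la -> dominates la mu.
Proof.
move=> pmu nmu pla [rho sn sim]; have irr := D_irr pmu nmu.
have d0 : (0 < #|@Xstd m la|)%N.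
  by case/mx_irrP: (mx_rsim_irr (mx_rsim_sym sim) irr).
have [T TX] := card_gt0P d0; have [T0 T0X e0] := Xstd_T0 hp pla TX.
apply: (Drep_colsum_dom (F := F) pla pmu (std_tab (Xstd_std T0X))).
apply: contraNneq (snf_colsum pla T0X e0 (Xstd_not_ones pla TX) sn) => K0.
by apply/eqP; apply: colsum_rsim (mx_rsim_sym sim) K0.
Qed.

Lemma D_type_inj la mu nu : is_part n mu -> is_part n nu -> mu != ones -> nu != ones ->
  D_type mu la -> D_type nu la -> mu = nu.
Proof.
move=> pmu pnu nmu nnu [r1 s1 sim1] [r2 s2 sim2]; apply: D_not_rsim => //.
apply: mx_rsim_trans (mx_rsim_sym sim1) _.
by apply: mx_rsim_trans (is_snf_rsim s1 s2) sim2.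
Qed.

(** A numerical statistic that grows strictly along dominance; it measures the induction below. *)
Definition prank la := (\sum_(r < n) psum la r)%N.

Lemma D_type_self mu la : is_part n mu -> mu != ones -> is_part n la -> la != ones ->
  D_type mu la -> la = mu.
Proof.
have bound nu : is_part n nu -> (prank nu <= n * n)%N.
  move=> pnu; apply: (@leq_trans (\sum_(r < n) n)%N); last by rewrite sum_nat_const card_ord.
  apply: leq_sum => r _; rewrite -[X in (_ <= X)%N](psum_ge pnu (leqnn n)).
  by apply/psum_mono/ltnW.
have [N] := ubnP (n * n - prank mu); elim: N mu la => // N IH mu la; rewrite ltnS => lN pmu nmu pla nla ty.
have [//|/eqP ne] := eqVneq la mu.
have dm := D_type_dom pmu nmu pla ty.
have lt : (prank mu < prank la)%N.
  rewrite ltn_neqAle; apply/andP; split; last by apply: leq_sum => r _; apply: dm.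
  apply/eqP => e; case: ne; apply: (dominates_anti pla pmu dm) => r.
  have [rn|nr] := ltnP r n; last by rewrite !(@psum_ge n).
  rewrite leqNgt; apply/negP => lt.
  move/eqP: e; rewrite /prank (bigD1 (Ordinal rn)) //= [X in _ == X](bigD1 (Ordinal rn)) //=.
  rewrite eqn_leq => /andP [_]; rewrite leqNgt => /negP []; rewrite -addSn leq_add //.
  by apply: leq_sum => i _; apply: dm.
(* Since [la] strictly dominates [mu], induction gives [la] the label [la]. The modules of [la] and
   [mu] would then share a label and be isomorphic, against their being distinguished. *)
have [nu [pnu nnu tnu]] := D_type_exists pla nla.
have e : nu = la.
  by apply: (IH la nu) => //; have := bound la pla; clear -lt lN; lia.
by case: ne; rewrite e in tnu; apply: (D_type_inj pla pmu nla nmu tnu ty).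
Qed.

Theorem D_snf la : is_part n la -> la != ones -> D_type la la.
Proof.
move=> pla nla; have [mu [pmu nmu ty]] := D_type_exists pla nla.
by rewrite -{2}(D_type_self pla nla pmu nmu ty).
Qed.

Theorem D_complete d (rG : mx_representation F [set: 'S_n]%G d) : mx_irreducible rG ->
  exists la, [/\ is_part n la, la != ones & mx_rsim rG (Drep n F la)].
Proof.
move=> irr; have [la pla [rho sn sim]] := irr_snf hp hsq irr.
have d0 : (0 < #|@Xstd m la|)%N.
  by case/mx_irrP: (mx_rsim_irr (mx_rsim_sym sim) irr).
have [T TX] := card_gt0P d0; have nla := Xstd_not_ones pla TX.
exists la; split => //; have [r' s' sim'] := D_snf pla nla.
apply: mx_rsim_trans (mx_rsim_sym sim) _.
by apply: mx_rsim_trans (is_snf_rsim sn s') sim'.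
Qed.
End TypeOfD.

(** * The hook length formula *)

Section Lagrange.
Variables (R : fieldType) (k : nat) (x : 'I_k -> R).
Hypothesis xinj : injective x.

Lemma sub_x_neq0 r j : j != r -> x r - x j != 0.
Proof. by move=> ne; rewrite subr_eq0 (inj_eq xinj) eq_sym. Qed.

Definition lagr r : {poly R} := \prod_(j | j != r) ((x r - x j)^-1 *: ('X - (x j)%:P)).

Lemma lagr_eval r i : (lagr r).[x i] = (i == r)%:R.
Proof.
rewrite /lagr horner_prod; have [->|ne] := eqVneq i r.
  by apply: big1 => j jr; rewrite hornerE hornerXsubC mulVf // sub_x_neq0.
by rewrite (bigD1 i) //= hornerE hornerXsubC subrr mulr0 mul0r.
Qed.

Lemma lagrE r : lagr r = (\prod_(j | j != r) (x r - x j)^-1) *: \prod_(j | j != r) ('X - (x j)%:P).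
Proof. by rewrite /lagr scaler_prod. Qed.

Lemma size_lagr_prod r : size (\prod_(j | j != r) ('X - (x j)%:P)) = k.
Proof.
rewrite -big_filter size_prod_XsubC -sum1_size big_filter sum1_card cardC1 card_ord prednK //.
by case: (k) r => [[]|].
Qed.

Lemma lagr_coef r : (lagr r)`_k.-1 = \prod_(j | j != r) (x r - x j)^-1.
Proof.
rewrite lagrE coefZ; set P := \prod_(j | j != r) ('X - _).
have : lead_coef P = 1 by apply/eqP; apply: monic_prod_XsubC.
by rewrite /lead_coef size_lagr_prod => ->; rewrite mulr1.
Qed.

(** Top coefficients are compared in the Lagrange interpolation of [Q] at the [k] nodes. *)
Lemma lagrange_coef (Q : {poly R}) : (size Q <= k)%N ->
  Q`_k.-1 = \sum_r Q.[x r] * \prod_(j | j != r) (x r - x j)^-1.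
Proof.
move=> sQ; have E : Q = \sum_r Q.[x r] *: lagr r.
  apply/eqP; rewrite -subr_eq0; set D := _ - _; apply: contraT => Dnz.
  have := @max_poly_roots _ D [seq x r | r <- enum 'I_k] Dnz.
  rewrite size_map size_enum_ord => H; have : (k < size D)%N.
    apply: H; last by rewrite map_inj_uniq ?enum_uniq.
    apply/allP => y /mapP [i _ ->]; rewrite rootE /D hornerD hornerN horner_sum.
    rewrite (bigD1 i) //= hornerZ lagr_eval eqxx mulr1 big1 ?addr0 ?subrr // => j ji.
    by rewrite hornerZ lagr_eval eq_sym (negPf ji) mulr0.
  rewrite ltnNge (leq_trans (size_polyD _ _)) // geq_max sQ size_polyN.
  apply: (leq_trans (size_sum _ _ _)); apply/bigmax_leqP => r _.
  by apply: leq_trans (size_scale_leq _ _) _; rewrite lagrE (leq_trans (size_scale_leq _ _)) // size_lagr_prod.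
rewrite {1}E coef_sum; apply: eq_bigr => r _; by rewrite coefZ lagr_coef.
Qed.

End Lagrange.

Section ShiftIdentity.
Variables (R : fieldType).

(* P(z-1) - P(z) + P'(z) has degree at most k-2, with leading term C(k,2) *)
Lemma prod_shift k (x : 'I_k -> R) (P := \prod_j ('X - (x j)%:P)) :
  exists2 Q : {poly R}, \prod_j ('X - (1 + x j)%:P) = P - P^`() + Q &
    (size Q <= k.-1)%N /\ Q`_k.-2 = 'C(k, 2)%:R.
Proof.
rewrite {}/P; elim: k x => [|k IH] x.
  exists 0; rewrite ?size_poly0 ?coef0 ?bin0n // !big_ord0 derivC subr0 addr0.
  by [].
have [Q EQ [sQ cQ]] := IH (fun j => x (lift ord0 j)).
rewrite !big_ord_recl EQ; set P := \prod_(i < k) _; set a := x ord0.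
have sP : size P = k.+1 by rewrite /P size_prod_XsubC /index_enum -enumT size_enum_ord.
have lP : P`_k = 1.
  have : lead_coef P = 1 by apply/eqP; apply: monic_prod_XsubC.
  by rewrite /lead_coef sP.
exists (P^`() + ('X - (1 + a)%:P) * Q); last split.
- rewrite derivM derivXsubC mul1r polyCD; ring.
- rewrite /=; apply: (leq_trans (size_polyD _ _)); rewrite geq_max; apply/andP; split.
    by have := lt_size_deriv (p := P); rewrite -size_poly_eq0 sP => /(_ isT).
  have [->|Qnz] := eqVneq Q 0; first by rewrite mulr0 size_poly0.
  apply: leq_trans (size_polyMleq _ _) _; rewrite size_XsubC.
  by have : (0 < size Q)%N; [rewrite lt0n size_poly_eq0|move: sQ; clear; lia].
- rewrite coefD coef_deriv /=; case: k IH x EQ sQ cQ P a sP lP => [|k] IH x EQ sQ cQ P a sP lP.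
    have Q0 : Q = 0 by apply/eqP; rewrite -size_poly_eq0 -leqn0.
    by rewrite Q0 mulr0 coef0 addr0 nth_default ?sP // mul0rn bin_small.
  have Qk : Q`_k = 0 by rewrite nth_default.
  rewrite lP mulrBl coefB coefXM coefCM /= Qk mulr0 subr0.
  rewrite binS bin1 natrD addrC; case: k {IH x EQ P a sP lP Qk} sQ cQ => [|k] sQ cQ /=.
    by rewrite bin_small // ?add0r.
  by rewrite cQ.
Qed.

(** The left side is an interpolation sum for minus the polynomial [X] times the shifted product,
    whose coefficient of degree one less than the number of nodes is then read off. *)
Lemma shift_sum k (x : 'I_k -> R) : injective x ->
  \sum_r x r * \prod_(j | j != r) ((x r - 1 - x j) / (x r - x j)) = \sum_j x j - 'C(k, 2)%:R.
Proof.
case: k x => [|k] x xi; first by rewrite !big_ord0 subr0.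
have [Q EQ [sQ cQ]] := prod_shift x; set P := \prod_j ('X - (x j)%:P) in EQ.
have sP : size P = k.+2 by rewrite /P size_prod_XsubC /index_enum -enumT size_enum_ord.
have P1 : P`_k.+1 = 1.
  have : lead_coef P = 1 by apply/eqP; apply: monic_prod_XsubC.
  by rewrite /lead_coef sP.
have P0 : P`_k = - \sum_j x j.
  have := coefPn_prod_XsubC (ps := [seq x j | j <- index_enum 'I_k.+1]).
  by rewrite size_map /index_enum -enumT size_enum_ord !big_map /= => ->.
pose S := \prod_j ('X - (1 + x j)%:P).
have Sr r : \prod_(j | j != r) ((x r - 1 - x j) / (x r - x j)) =
    - S.[x r] * \prod_(j | j != r) (x r - x j)^-1.
  rewrite big_split /=; congr (_ * _); rewrite /S horner_prod.
  rewrite [in RHS](eq_bigr (fun j => x r - 1 - x j)) => [|j _]; last by rewrite hornerXsubC opprD addrA.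
  by rewrite [in RHS](bigD1 r) //= addrAC subrr sub0r mulN1r opprK.
pose Q1 := 'X * S - 'X * P + k.+1%:R *: P.
have PX r : P.[x r] = 0 by rewrite /P horner_prod (bigD1 r) //= hornerXsubC subrr mul0r.
have -> : \sum_r x r * \prod_(j | j != r) ((x r - 1 - x j) / (x r - x j)) =
   - \sum_r Q1.[x r] * \prod_(j | j != r) (x r - x j)^-1.
  rewrite -sumrN; apply: eq_bigr => r _; rewrite Sr.
  have -> : Q1.[x r] = x r * S.[x r].
    by rewrite /Q1 hornerD hornerD hornerN !hornerM hornerX hornerZ PX !mulr0 subr0 addr0.
  by ring.
have Q1E : Q1 = 'X * (Q - P^`()) + k.+1%:R *: P.
  by rewrite /Q1 /S EQ; congr (_ + _); ring.
have sP' : (size P^`() <= k.+1)%N.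
  by have := lt_size_deriv (p := P); rewrite -size_poly_eq0 sP => /(_ isT).
have sQ1 : (size Q1 <= k.+1)%N.
  apply/leq_sizeP => -[|j] // kj; rewrite Q1E coefD coefZ coefXM /= coefB coef_deriv.
  rewrite (nth_default 0 (s := Q)) ?(leq_trans sQ) // sub0r.
  have [->|jk] := eqVneq j k; first by rewrite P1 mulr1 addNr.
  by rewrite !(nth_default 0 (s := P)) ?mul0rn ?mulr0 ?oppr0 ?addr0 // sP; move: jk kj; clear; lia.
rewrite -(lagrange_coef xi sQ1) /= Q1E coefD coefZ coefXM P0.
case: k x {xi} Q sQ cQ P sP P1 P0 {EQ S Sr Q1 PX Q1E sP' sQ1} => [|k] x Q sQ cQ P sP P1 P0 /=.
  by rewrite add0r mul1r opprK subr0.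
rewrite coefB cQ coef_deriv P0 /=.
rewrite -[in k.+2%:R]addn1 natrD -mulr_natl; ring.
Qed.
End ShiftIdentity.

Section HookLengths.
Local Open Scope nat_scope.
Variables (n k : nat) (la : seq nat).
Hypotheses (pla : is_part n la) (sk : size la <= k).

Lemma ltn_conjp i c : (i < conjp la c) = (c < nth 0 la i).
Proof.
have E : conjp la c = size [seq j <- iota 0 (size la) | c < nth 0 la j].
  rewrite size_filter /conjp -{1}(mkseq_nth 0 la) /mkseq count_map.
  by apply: eq_count => j.
rewrite E -mem_down_closed ?filter_uniq ?iota_uniq //.
  rewrite mem_filter mem_iota /= add0n; have [lt|ge] := ltnP i (size la); first by rewrite andbT.
  by rewrite andbF nth_default.
move=> x y; rewrite !mem_filter !mem_iota /= !add0n => /andP [cx xs] yx.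
by rewrite (leq_trans cx (is_part_nth_anti pla yx)) (leq_ltn_trans yx xs).
Qed.

(* Frobenius' first-column hook lengths. *)
Definition beta i := nth 0 la i + (k.-1 - i).

Lemma beta_lt i j : i < j -> j < k -> beta j < beta i.
Proof.
by move=> ij jk; have := is_part_nth_anti pla (ltnW ij); rewrite /beta; clear -ij jk; lia.
Qed.

(** The hook lengths of row [i] and the differences [beta i - beta j] for [j > i] are distinct, lie
    between 1 and [beta i], and are [beta i] in number. A hook length equal to a difference would
    contradict [ltn_conjp], whether or not row [j] reaches the column. *)
Lemma hook_row i : i < k -> perm_eq
  ([seq hook la i c | c <- iota 0 (nth 0 la i)] ++ [seq beta i - beta j | j <- iota i.+1 (k - i.+1)])
  (iota 1 (beta i)).
Proof.
move=> ik.
have hk c : c < nth 0 la i -> i < conjp la c by rewrite ltn_conjp.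
have ck c : conjp la c <= k by apply: leq_trans (count_size _ _) sk.
have cmono c c' : c <= c' -> conjp la c' <= conjp la c.
  by move=> cc; apply: sub_count => x /=; apply: leq_ltn_trans.
have s_mem x : x \in [seq hook la i c | c <- iota 0 (nth 0 la i)] ++ [seq beta i - beta j | j <- iota i.+1 (k - i.+1)] ->
    x \in iota 1 (beta i).
  rewrite mem_cat => /orP [] /mapP [c]; rewrite mem_iota => /andP [c1 c2] ->; rewrite mem_iota.
    have := hk c c2; have := ck c; rewrite /hook /beta; move: c2; clear -ik; lia.
  have jk : c < k by move: c2; clear -ik; lia.
  by have := beta_lt c1 jk; clear; lia.
have s_uniq : uniq ([seq hook la i c | c <- iota 0 (nth 0 la i)] ++ [seq beta i - beta j | j <- iota i.+1 (k - i.+1)]).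
  rewrite cat_uniq; apply/and3P; split.
  - rewrite map_inj_in_uniq ?iota_uniq // => c c'; rewrite !mem_iota /= !add0n => h h'.
    have := hk _ h; have := hk _ h'; rewrite /hook.
    case: (ltngtP c c') => // cc; have := cmono _ _ (ltnW cc); move: h h' cc; clear; lia.
  - apply/hasPn => x /mapP [j]; rewrite mem_iota => /andP [ij j2] ->; apply/mapP => -[c].
    rewrite mem_iota /= add0n => h; have h1 := hk _ h; have jk : j < k by move: j2; clear -ik; lia.
    have := beta_lt ij jk; have := ltn_conjp j c; rewrite /hook /beta.
    case: (ltnP c (nth 0 la j)) => h2 h3; move: h h1 h2 h3 ij jk; clear; lia.
  - rewrite map_inj_in_uniq ?iota_uniq // => j j'; rewrite !mem_iota => /andP [ij j2] /andP [ij' j2'].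
    have jk : j < k by move: j2; clear -ik; lia.
    have jk' : j' < k by move: j2'; clear -ik; lia.
    have := beta_lt ij jk; have := beta_lt ij' jk'.
    case: (ltngtP j j') => // cc; [have := beta_lt cc jk'|have := beta_lt cc jk]; clear; lia.
have [|_ E] := uniq_min_size s_uniq s_mem.
  by rewrite size_cat !size_map !size_iota /beta; clear -ik; lia.
by apply: uniq_perm; rewrite ?iota_uniq.
Qed.

Lemma hook_row_prod i : i < k ->
  (\prod_(c < nth 0 la i) hook la i c) * (\prod_(j < k | i < j) (beta i - beta j)) = (beta i)`!.
Proof.
move=> ik.
have : \prod_(x <- [seq hook la i c | c <- iota 0 (nth 0 la i)] ++
                   [seq beta i - beta j | j <- iota i.+1 (k - i.+1)]) x =
  \prod_(x <- iota 1 (beta i)) x by apply: perm_big; apply: hook_row.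
rewrite big_cat !big_map /= => E.
rewrite fact_prod /index_iota subSS subn0 -E; congr (_ * _).
  by rewrite -(big_mkord xpredT (hook la i)) /index_iota subn0.
rewrite -(big_mkord (fun j => i < j) (fun j => beta i - beta j)) (big_cat_nat (n := i.+1)) //=.
rewrite big_nat_cond big1 ?mul1n => [|j /andP [/andP [_ ji] ij]]; last by clear -ji ij; lia.
rewrite big_nat_cond [RHS]big_seq_cond /index_iota; apply: eq_bigl => j.
by rewrite mem_iota; clear -ik; case: (i < j) => //; lia.
Qed.

Lemma hook_prod_beta : hook_prod la * (\prod_(i < k) \prod_(j < k | i < j) (beta i - beta j)) =
  \prod_(i < k) (beta i)`!.
Proof.
have -> : hook_prod la = \prod_(i < k) \prod_(c < nth 0 la i) hook la i c.
  rewrite /hook_prod; move: sk => /subnKC <-; rewrite big_split_ord /= [X in _ * X]big1 ?muln1 // => i _.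
  by rewrite nth_default ?leq_addr // big_ord0.
by rewrite -big_split /=; apply: eq_bigr => i _; apply: hook_row_prod.
Qed.

Lemma hook_prod_gt0 : 0 < hook_prod la.
Proof.
have : 0 < \prod_(i < k) (beta i)`! by apply: prodn_gt0 => i; apply: fact_gt0.
by rewrite -hook_prod_beta muln_gt0 => /andP [].
Qed.

Lemma sum_beta : n <= k -> \sum_(i < k) beta i = n + 'C(k, 2).
Proof.
move=> nk; rewrite /beta big_split /= (is_part_sum pla nk) -bin2_sum; congr (_ + _).
rewrite big_mkord (reindex_inj rev_ord_inj) /=; apply: eq_bigr => i _.
by have := ltn_ord i; clear; lia.
Qed.
End HookLengths.

Section Vandermonde.
Variables (R : fieldType) (k : nat).
Implicit Type x : 'I_k -> R.

Definition vdm x := \prod_(i < k) \prod_(j < k | (i < j)%N) (x i - x j).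

Definition dec_at r x i : R := x i - (i == r)%:R.

(** Only factors involving index [r] change; when [r] is the second index, the signs in numerator
    and denominator cancel. *)
Lemma vdm_dec r x : injective x ->
  vdm (dec_at r x) = vdm x * \prod_(j | j != r) ((x r - 1 - x j) / (x r - x j)).
Proof.
move=> xi; pose q j := (x r - 1 - x j) / (x r - x j).
pose g (i j : 'I_k) := if i == r then q j else if j == r then q i else 1.
have nz i j : i != j -> x i - x j != 0 by move=> ne; rewrite subr_eq0 (inj_eq xi).
have E1 : vdm (dec_at r x) = vdm x * \prod_(i < k) \prod_(j < k | (i < j)%N) g i j.
  rewrite /vdm -big_split /=; apply: eq_bigr => i _; rewrite -big_split /=; apply: eq_bigr => j ij.
  have nij : i != j by apply: contraTneq ij => ->; rewrite ltnn.
  rewrite /g /dec_at /q; have [ei|ni] := eqVneq i r.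
    have nj : j != r by rewrite -ei eq_sym.
    have h := nz _ _ nij; rewrite (negPf nj) subr0 -ei mulr1n.
    by field.
  have [ej|nj] := eqVneq j r; last by rewrite !subr0 mulr1.
  rewrite subr0 -ej mulr1n; have := nz _ _ nij; have := nz j i; rewrite eq_sym => /(_ nij).
  by move=> h1 h2; field.
rewrite E1; congr (_ * _).
rewrite (bigD1 r) //= /g eqxx.
have E2 : \prod_(i < k | i != r) \prod_(j < k | (i < j)%N) (if i == r then q j else if j == r then q i else 1) =
          \prod_(i < k | i != r) (if (i < r)%N then q i else 1).
  apply: eq_bigr => i ni; rewrite (negPf ni); case: ifP => ir.
    rewrite (bigD1 r) //= eqxx big1 ?mulr1 // => j /andP [_ /negPf ->].
    by [].
  by rewrite big1 // => j ij; case: eqP => // ejr; rewrite ejr ir in ij.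
rewrite E2 big_mkcond /= (bigD1 r) //= ltnn mul1r -big_split /=; apply: eq_bigr => j jr.
case: (ltngtP j r) => h; rewrite ?mul1r ?mulr1 //.
by case/eqP: jr; apply: ord_inj.
Qed.

Lemma vdm_dec_sum x : injective x ->
  \sum_r x r * vdm (dec_at r x) = (\sum_j x j - 'C(k, 2)%:R) * vdm x.
Proof.
move=> xi; rewrite -shift_sum // mulr_suml; apply: eq_bigr => r _.
by rewrite vdm_dec // mulrA mulrAC.
Qed.

Lemma vdm_eq0 x (i j : 'I_k) : (i < j)%N -> x i = x j -> vdm x = 0.
Proof.
move=> ij e; rewrite /vdm (bigD1 i) //= (bigD1 j) //= e subrr.
by rewrite !mul0r.
Qed.
End Vandermonde.

Lemma shape_ofE m la t : is_part m.+1 la -> pstd m.+1 t ->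
  (forall k, (k < m.+1)%N -> ((t k).2 < nth 0%N la (t k).1)%N) ->
  (forall i c, (c < nth 0%N la i)%N -> exists2 k, (k < m.+1)%N & t k = (i, c)) ->
  shape_of m t = la.
Proof.
move=> pla pt H1 H2; apply: (is_part_inj (shape_of_part pt) pla) => i.
have E c : (c < nth 0%N (shape_of m t) i)%N = (c < nth 0%N la i)%N.
  rewrite (nth_shape_of pt) -(row_seq_size pt); apply/mem_row_seq/idP => [[k kn Ek]|/H2 //].
  by have := H1 k kn; rewrite Ek.
case: (ltngtP (nth 0%N (shape_of m t) i) (nth 0%N la i)) => // h.
  by have := E (nth 0%N (shape_of m t) i); rewrite h ltnn.
by have := E (nth 0%N la i); rewrite h ltnn.
Qed.

(** * Removing a node, and the branching recursion for standard tableaux *)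

Section Decrement.
Local Open Scope nat_scope.
Variables (n : nat) (la : seq nat) (r : nat).
Hypotheses (pla : is_part n.+1 la) (rem : nth 0 la r.+1 < nth 0 la r).

Definition dec_nth i := nth 0 la i - (i == r).

Lemma dec_nth_anti i j : i <= j -> dec_nth j <= dec_nth i.
Proof.
rewrite leq_eqVlt => /predU1P [-> //|ij]; rewrite /dec_nth.
have h := is_part_nth_anti pla ij; have h' := is_part_nth_anti pla (ltnW ij).
case: (eqVneq i r) => [e|ne]; last by clear -h'; lia.
by rewrite e in h h' *; case: eqP => [ej|nj]; clear -h h' rem; lia.
Qed.

(** The sequence is cut after its positive terms, since a partition has no zero parts. *)
Definition dec_part := mkseq dec_nth (size [seq i <- iota 0 (size la) | 0 < dec_nth i]).

Lemma dec_nth_gt0 i : (i < size [seq i <- iota 0 (size la) | 0 < dec_nth i]) = (0 < dec_nth i).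
Proof.
rewrite -mem_down_closed ?filter_uniq ?iota_uniq //.
  rewrite mem_filter mem_iota /= add0n; have [lt|ge] := ltnP i (size la); first by rewrite andbT.
  by rewrite andbF /dec_nth nth_default // sub0n.
move=> x y; rewrite !mem_filter !mem_iota /= !add0n => /andP [cx xs] yx.
by rewrite (leq_trans cx (dec_nth_anti yx)) (leq_ltn_trans yx xs).
Qed.

Lemma nth_dec_part i : nth 0 dec_part i = dec_nth i.
Proof.
have := dec_nth_gt0 i; rewrite /dec_part; case: ltnP => [lt _|ge]; first by rewrite nth_mkseq.
by rewrite nth_default ?size_mkseq // lt0n => /esym/negbFE/eqP ->.
Qed.

Lemma size_dec_part : size dec_part <= size la.
Proof. by rewrite size_mkseq size_filter (leq_trans (count_size _ _)) ?size_iota. Qed.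

Lemma dec_part_part : is_part n dec_part.
Proof.
have rs : r < size la by rewrite -(is_part_nth_gt0 _ pla); clear -rem; lia.
apply/and3P; split.
- by apply/(sortedP 0) => i _; rewrite !nth_dec_part; apply: dec_nth_anti.
- apply/(all_nthP 0) => i; rewrite size_mkseq nth_dec_part => lt.
  by rewrite -dec_nth_gt0.
- rewrite -(sum_nth_ge size_dec_part).
  have : sumn la = n.+1 by case/and3P: pla => _ _ /eqP.
  rewrite sumn_nth (bigD1 (Ordinal rs)) //= [X in _ -> X == _](bigD1 (Ordinal rs)) //= nth_dec_part.
  rewrite /dec_nth eqxx; set A := \sum_(i < _ | _) _; set B := \sum_(i < _ | _) _.
  have -> : B = A.
    apply: eq_bigr => i ir; rewrite nth_dec_part /dec_nth.
    by rewrite (_ : (i == r :> nat) = false) ?subn0 //; apply: contra_neqF ir => /eqP e; apply: val_inj.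
  by move=> e; apply/eqP; clear -e rem; lia.
Qed.
End Decrement.

Section CountStandard.
Variable m : nat.
Local Notation N := m.+1.
Variable la : seq nat.
Hypothesis pla : is_part N.+1 la.

Lemma std_last T : T \in Std N.+1 la ->
  (nth 0%N la (nd T N).1.+1 < nth 0%N la (nd T N).1)%N /\ (nd T N).2 = (nth 0%N la (nd T N).1).-1.
Proof.
move=> sT; have pT := std_pstd pla sT; have sh := tab_in_shape N (std_tab sT).
case E : (nd T N) sh => [r c] /= sh.
have no x : (x.2 < nth 0%N la x.1)%N -> (x = (r.+1, c) \/ x = (r, c.+1)) -> False.
  move=> xs hx; have [k kn Ek] := std_shape pla sT xs.
  have [_ H1 H2] := pT k kn.
  have [j jk Ej] : exists2 j, (j < k)%N & nd T j = (r, c).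
    by case: hx => hx; [apply: H1|apply: H2]; rewrite Ek.
  have := pstd_inj pT (j := j) (k := N) (ltn_trans jk kn) (ltnSn _); rewrite Ej E => /(_ erefl) e.
  by move: jk kn; rewrite e; clear; lia.
have h1 : ~~ (c < nth 0%N la r.+1)%N by apply/negP => h; apply: (no (r.+1, c)) => //; left.
have h2 : ~~ (c.+1 < nth 0%N la r)%N by apply/negP => h; apply: (no (r, c.+1)) => //; right.
by split; move: h1 h2 sh; clear; lia.
Qed.

Definition restr (T : tab N.+1) : tab N := tab_of m (nd T).

Lemma nd_restr T k : T \in Std N.+1 la -> (k < N)%N -> nd (restr T) k = nd T k.
Proof.
move=> sT kn; rewrite /restr nd_tab_of //.
by apply: pstd_le (std_pstd pla sT).
Qed.

Definition last_row r := [set T in Std N.+1 la | (nd T N).1 == r].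

Lemma restr_std r T : T \in last_row r -> restr T \in Std N (dec_part la r).
Proof.
rewrite inE => /andP [sT /eqP er]; have pT := std_pstd pla sT.
have pT' : pstd N (nd T) by apply: pstd_le pT.
have [rem lc] := std_last sT; rewrite er in rem lc.
have EN : nd T N = (r, (nth 0%N la r).-1) by rewrite [nd T N]surjective_pairing er lc.
suff <- : shape_of m (nd T) = dec_part la r by apply: tab_of_std.
apply: shape_ofE (dec_part_part pla rem) pT' _ _ => [k kn|i c].
  rewrite (nth_dec_part pla rem) /dec_nth; have sh := tab_in_shape k (std_tab sT).
  case: eqP => [e|_]; last by rewrite subn0.
  rewrite subn1 e; rewrite e in sh.
  have ne : (nd T k).2 <> (nth 0%N la r).-1.
    move=> ec; have := pstd_inj pT (j := k) (k := N) (ltnW kn) (ltnSn _).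
    by rewrite EN [nd T k]surjective_pairing e ec => /(_ erefl) ek; rewrite ek ltnn in kn.
  by move: ne sh; clear; lia.
rewrite (nth_dec_part pla rem) /dec_nth => lt.
have [|k kn Ek] := @std_shape _ la T (i, c) pla sT; first by rewrite /= (leq_trans lt) ?leq_subr.
exists k => //; rewrite ltn_neqAle -ltnS kn andbT; apply/eqP => ek.
by move: Ek lt; rewrite ek EN => -[<- <-]; rewrite eqxx; clear; lia.
Qed.

Lemma restr_inj r : {in last_row r &, injective restr}.
Proof.
move=> T U; rewrite [T \in _]inE [U \in _]inE.
move=> /andP [sT /eqP rT] /andP [sU /eqP rU] E.
apply: nd_inj => k; rewrite ltnS leq_eqVlt => /predU1P [->|kN].
  by rewrite [LHS]surjective_pairing [RHS]surjective_pairing (std_last sT).2 (std_last sU).2 rT rU.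
by rewrite -(nd_restr sT kN) -(nd_restr sU kN) E.
Qed.

Lemma restr_surj r U : (nth 0%N la r.+1 < nth 0%N la r)%N -> U \in Std N (dec_part la r) ->
  exists2 T, T \in last_row r & restr T = U.
Proof.
move=> rem sU; have pd := dec_part_part pla rem; have pU := std_pstd pd sU.
pose t k := if (k < N)%N then nd U k else (r, (nth 0%N la r).-1).
have tE k : (k < N)%N -> t k = nd U k by rewrite /t => ->.
have tN : t N = (r, (nth 0%N la r).-1) by rewrite /t ltnn.
have sh k : (k < N)%N -> ((nd U k).2 < nth 0%N la (nd U k).1 - ((nd U k).1 == r))%N.
  by move=> kn; have := tab_in_shape k (std_tab sU); rewrite (nth_dec_part pla rem).
have shU x : (x.2 < nth 0%N la x.1 - (x.1 == r))%N -> exists2 k, (k < N)%N & nd U k = x.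
  by move=> h; apply: (std_shape pd sU); rewrite (nth_dec_part pla rem).
have pt : pstd N.+1 t.
  move=> k; rewrite ltnS leq_eqVlt => /predU1P [->|kN].
    rewrite tN; apply: (addable_ext (t := nd U)) => [j jN|]; first by rewrite tE.
    split=> [j jN Ej|r' c' [er ec]|r' c' [er ec]].
    - by have := sh j jN; rewrite Ej /= eqxx; clear; lia.
    - apply: shU => /=; have := is_part_nthS r' pla; rewrite -er.
      by have := rem; rewrite -ec (_ : (r' == r) = false); [clear; lia|rewrite er; clear; lia].
    - by apply: shU => /=; rewrite -er eqxx -[c'.+1]/(c'.+1) in ec *; move: ec rem; clear; lia.
  rewrite tE //; apply: (addable_ext (t := nd U)) (pU k kN) => j jk.
  by rewrite tE // (ltn_trans jk).
have st : shape_of N t = la.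
  apply: shape_ofE => // [k|i c h].
    rewrite ltnS leq_eqVlt => /predU1P [->|kN]; first by rewrite tN /=; move: rem; clear; lia.
    by rewrite tE //; apply: leq_trans (sh k kN) (leq_subr _ _).
  have [e|ne] := eqVneq (i, c) (r, (nth 0%N la r).-1); first by exists N; rewrite ?tN.
  have [|k kN Ek] := shU (i, c); last by exists k; rewrite ?tE // ltnW.
  rewrite /=; case: eqP => [ei|_]; last by rewrite subn0.
  move: ne h; rewrite ei xpair_eqE eqxx /=; clear; lia.
have sT : tab_of N t \in Std N.+1 la by rewrite -[in X in _ \in Std _ X]st; apply: tab_of_std.
exists (tab_of N t).
  by rewrite inE sT nd_tab_of // tN eqxx.
by apply: nd_inj => k kN; rewrite nd_restr // nd_tab_of ?tE // ltnW.
Qed.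

(** Deleting the largest entry is a bijection onto the standard tableaux of the smaller shape; that
    entry always occupies a removable node. *)
Lemma card_last_row r : #|last_row r| =
  (if (nth 0 la r.+1 < nth 0 la r)%N then #|Std N (dec_part la r)| else 0%N).
Proof.
case: ifP => [rem|nrem]; last first.
  apply/eqP; rewrite cards_eq0 -subset0; apply/subsetP => T; rewrite [T \in _]inE.
  move=> /andP [sT /eqP er]; have [] := std_last sT.
  by rewrite er nrem.
rewrite -(card_in_imset (@restr_inj r)); apply: eq_card => U; apply/imsetP/idP => [[T TR ->]|sU].
  exact: restr_std.
by have [T TR <-] := restr_surj rem sU; exists T.
Qed.

Lemma card_std_rec : #|Std N.+1 la| =
  (\sum_(r < N.+1) if (nth 0 la r.+1 < nth 0 la r)%N then #|Std N (dec_part la r)| else 0)%N.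
Proof.
rewrite -sum1_card (partition_big (fun T : tab N.+1 => (T ord_max).1) xpredT) //=.
apply: eq_bigr => r _; rewrite -card_last_row -sum1_card; apply: eq_bigl => T.
rewrite [in RHS]inE; congr (_ && _).
by rewrite -[N in nd T N]/(nat_of_ord (@ord_max N)) nd_ord.
Qed.
End CountStandard.

(** * The recursion for the product of hook lengths *)

Section HookLengthFormula.
Import Num.Theory.

Section Step.
Variables (k : nat) (la : seq nat).
Hypothesis pla : is_part k la.
Let x (i : 'I_k) : rat := (beta k la i)%:R.
Let B : rat := \prod_(i < k) (beta k la i)`!%:R.

Lemma beta_inj : injective x.
Proof.
move=> i j /eqP; rewrite eqr_nat => /eqP e.
case: (ltngtP i j) => [h|h|/ord_inj //].
  by have := beta_lt pla h (ltn_ord j); rewrite e ltnn.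
by have := beta_lt pla h (ltn_ord i); rewrite e ltnn.
Qed.

Lemma prod_fact_neq0 : B != 0.
Proof. by apply/prodf_neq0 => i _; rewrite pnatr_eq0 -lt0n fact_gt0. Qed.

Lemma hook_prod_vdm n mu : is_part n mu -> (size mu <= k)%N ->
  (hook_prod mu)%:R * vdm (fun i : 'I_k => (beta k mu i)%:R) = \prod_(i < k) (beta k mu i)`!%:R :> rat.
Proof.
move=> pmu sk; rewrite -natr_prod -(hook_prod_beta pmu sk) natrM; congr (_ * _); rewrite /vdm natr_prod.
apply: eq_bigr => i _; rewrite natr_prod; apply: eq_bigr => j ij.
by rewrite natrB // ltnW // (beta_lt pmu ij).
Qed.

(** The inverse hook product is the Vandermonde product of the numbers [beta] over the product of
    their factorials. Removing a node lowers one [beta] by 1 and its factorial by the factor [x r].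
    The number [k] of terms is kept, even if a row becomes empty. *)
Lemma step_rem n (r : 'I_k) : k = n.+1 ->
  (nth 0 la r.+1 < nth 0 la r)%N ->
  ((hook_prod (dec_part la r))%:R : rat)^-1 = x r * vdm (dec_at r x) / B.
Proof.
move=> kE rem; have pla' : is_part n.+1 la by rewrite -kE.
have pd := dec_part_part pla' rem.
have sk : (size (dec_part la r) <= k)%N := leq_trans (size_dec_part _ _) (is_part_size pla).
have bE i : beta k (dec_part la r) i = (beta k la i - (i == r))%N.
  rewrite /beta (nth_dec_part pla' rem) /dec_nth; case: eqP => [->|_]; last by rewrite !subn0.
  by clear -rem; lia.
have b0 : (0 < beta k la r)%N by rewrite /beta; clear -rem; lia.
have := hook_prod_vdm pd sk.
have -> : vdm (fun i : 'I_k => (beta k (dec_part la r) i)%:R) = vdm (dec_at r x) :> rat.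
  rewrite /vdm; apply: eq_bigr => i _; apply: eq_bigr => j _; rewrite !bE /dec_at /x -!val_eqE /=.
  congr (_ - _).
    by case: eqP => [->|_]; rewrite ?subn0 ?subr0 // natrB.
  by case: eqP => [->|_]; rewrite ?subn0 ?subr0 // natrB.
have -> : \prod_(i < k) (beta k (dec_part la r) i)`!%:R = B / x r :> rat.
  rewrite /B /x (bigD1 r) //= [in RHS](bigD1 r) //= bE eqxx subn1.
  have -> : \prod_(i < k | i != r) (beta k (dec_part la r) i)`!%:R
      = \prod_(i < k | i != r) (beta k la i)`!%:R :> rat.
    by apply: eq_bigr => i ir; rewrite bE (_ : (i == r :> nat) = false) ?subn0 //; apply: negPf.
  rewrite -[in RHS](prednK b0) factS natrM.
  have : ((beta k la r).-1.+1%:R : rat) != 0 by rewrite pnatr_eq0.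
  by move: (_.+1%:R : rat) => b bn; field.
move=> E.
have h0 : ((hook_prod (dec_part la r))%:R : rat) != 0.
  by rewrite pnatr_eq0 -lt0n; apply: (hook_prod_gt0 pd sk).
have x0 : x r != 0 by rewrite /x pnatr_eq0 -lt0n.
have B0 := prod_fact_neq0.
apply: (mulfI h0); rewrite divff //; move: E; set v := vdm _ => E.
by rewrite [x r * v]mulrC !mulrA E; field; rewrite x0 B0.
Qed.

(** Rows without a removable node contribute nothing: lowering [beta r] makes it equal to the next
    one and the Vandermonde product vanishes, or [r] is the last index and [beta r] is 0. The sum
    may thus run over all rows. *)
Lemma step_not_rem (r : 'I_k) : ~~ (nth 0 la r.+1 < nth 0 la r)%N -> x r * vdm (dec_at r x) = 0.
Proof.
rewrite -leqNgt => le; have rk := ltn_ord r.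
have [rk1|kr] := ltnP r.+1 k.
  rewrite (@vdm_eq0 _ _ _ r (Ordinal rk1)) ?mulr0 //=.
  have be : beta k la r = (beta k la r.+1).+1.
    by have := is_part_nthS r pla; rewrite /beta; clear -le rk1; lia.
  rewrite /dec_at /x eqxx be -natr1 addrK -val_eqE /= (_ : (r.+1 == r) = false) ?subr0 //.
  by clear; lia.
have nk : nth 0%N la r.+1 = 0%N by rewrite nth_default // (leq_trans (is_part_size pla)).
by rewrite /x (_ : beta k la r = 0%N) ?mul0r // /beta; move: le; rewrite nk; clear -kr rk; lia.
Qed.

Lemma hook_step : \sum_(r < k) x r * vdm (dec_at r x) / B = k%:R / (hook_prod la)%:R.
Proof.
rewrite -mulr_suml vdm_dec_sum; last exact: beta_inj.
have sk := is_part_size pla.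
have -> : \sum_j x j - 'C(k, 2)%:R = k%:R.
  by rewrite -natr_sum (sum_beta pla (leqnn k)) natrD addrK.
have h0 : ((hook_prod la)%:R : rat) != 0.
  by rewrite pnatr_eq0 -lt0n; apply: (hook_prod_gt0 pla sk).
have B0 := prod_fact_neq0; have E := hook_prod_vdm pla sk.
by rewrite -/B in E; rewrite -mulrA; congr (_ * _); apply: (mulfI h0); rewrite mulrA E divff // divff.
Qed.

End Step.

Theorem hook_length_formula m la : is_part m.+1 la ->
  (#|Std m.+1 la| * hook_prod la)%N = (m.+1)`!.
Proof.
elim: m la => [|m IH] la pla.
  have la1 : la = [:: 1%N].
    have s1 := is_part_size pla; have /and3P [_ _ /eqP] := pla.
    by case: la s1 {pla} => [|a [|b l]] //= _; rewrite addn0 => ->.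
  have hp1 : hook_prod la = 1%N.
    by rewrite la1 /hook_prod !big_ord1.
  have [T tT] : exists T : tab 1, T \in Std 1 la.
    exists [ffun=> (ord0, ord0)]; rewrite inE; apply/and3P; split; first (apply/andP; split).
    - by apply/injectiveP => a b _; rewrite !ord1.
    - by apply/forallP => a; rewrite ffunE la1.
    - by apply/forallP => a; apply/forallP => b; rewrite !ffunE ltnn andbF.
    - by apply/forallP => a; apply/forallP => b; rewrite !ffunE ltnn andbF.
  rewrite hp1 muln1; apply/eqP/cards1P; exists T; apply/setP => U; rewrite in_set1.
  have UT : U = T.
    apply/ffunP => a; rewrite [LHS]surjective_pairing [RHS]surjective_pairing.
    by rewrite !(ord1 (_ : 'I_1)).
  by rewrite UT tT eqxx.
have sk := is_part_size pla.
have h0 : ((hook_prod la)%:R : rat) != 0.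
  by rewrite pnatr_eq0 -lt0n; apply: (hook_prod_gt0 pla sk).
apply/eqP; rewrite -(eqr_nat rat) natrM card_std_rec // natr_sum.
suff -> : \sum_(r < m.+2) ((if (nth 0 la r.+1 < nth 0 la r)%N
     then #|Std m.+1 (dec_part la r)| else 0)%N)%:R = (m.+2)`!%:R / (hook_prod la)%:R :> rat.
  by rewrite divfK.
have -> : (m.+2)`!%:R / (hook_prod la)%:R = (m.+1)`!%:R * (m.+2%:R / (hook_prod la)%:R) :> rat.
  by rewrite factS natrM mulrA [_ * m.+2%:R]mulrC.
rewrite -(hook_step pla) mulr_sumr; apply: eq_bigr => r _; case: ifP => [rem|/negbT nrem]; last first.
  by rewrite (step_not_rem pla nrem) mul0r mulr0.
rewrite -(step_rem pla (erefl m.+2) rem).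
have pd := dec_part_part pla rem.
have d0 : ((hook_prod (dec_part la r))%:R : rat) != 0.
  by rewrite pnatr_eq0 -lt0n; apply: (hook_prod_gt0 pd (leqnn _)).
by rewrite -(IH _ pd) natrM mulfK.
Qed.
End HookLengthFormula.

(** * Shapes and dimensions for hooks *)

Lemma hookish_eq n la : is_part n la -> hookish la -> (0 < n)%N ->
  la = nth 0%N la 0 :: nseq (n - nth 0%N la 0) 1%N.
Proof.
move=> /and3P [so al /eqP su] hla n0; case: la => [|k l] in so al su hla *.
  by move: n0; rewrite -su.
congr (_ :: _) => /=; rewrite -su /= addKn; apply: part_ones (sumn l) _ _ hla.
by apply/and3P; split; [exact: path_sorted so|case/andP: al|].
Qed.

Section HookShape.
Local Open Scope nat_scope.
Variables x y : nat.
Local Notation hk := (x.+1 :: nseq y 1).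

Lemma hook_part : is_part (x.+1 + y) hk.
Proof.
apply/and3P; split; last by rewrite /= sumn_nseq mul1n.
  apply/(sortedP 0) => i; rewrite /= size_nseq ltnS => iy; rewrite nth_nseq iy /=.
  by case: i iy => [|i] iy //=; rewrite nth_nseq (ltnW iy).
by rewrite -[all _ _]/(all (leq 1) (nseq y 1)) all_nseq orbT.
Qed.

Lemma hook_hookish : hookish hk.
Proof. by rewrite /hookish /= nth_nseq; case: ifP. Qed.

Lemma hook_prod_hook : hook_prod hk = (x.+1 + y) * x`! * y`!.
Proof.
have fact_sub n : \prod_(i < n) (n - i) = n`! by rewrite -ffact_prod ffactnn.
have c0 : conjp hk 0 = y.+1 by rewrite /conjp /= count_nseq mul1n.
have cS j : conjp hk j.+1 = (j < x) by rewrite /conjp /= count_nseq mul0n addn0.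
rewrite /hook_prod /= big_ord_recl /= size_nseq big_ord_recl /= /hook c0 /= -!mulnA.
congr (_ * _); first by clear; lia.
congr (_ * _).
  rewrite -fact_sub; apply: eq_bigr => j _; rewrite -[X in (_ + X)%N]/(conjp hk j.+1) cS ltn_ord.
  by rewrite /bump /=; clear; lia.
rewrite -fact_sub; apply: eq_bigr => i _; rewrite nth_nseq ltn_ord big_ord1.
by rewrite -[X in (_ + X)%N]/(conjp hk 0) c0 /bump /=; clear; lia.
Qed.

Lemma card_std_hook : #|Std (x + y).+1 hk| = 'C(x + y, x).
Proof.
have := @hook_length_formula (x + y) hk hook_part.
rewrite hook_prod_hook -[x.+1 + y]/(x + y).+1 factS -(@bin_fact (x + y) x) ?leq_addr // addKn.
move: (#|_|) ('C(_, _)) => c b; rewrite -mulnA => e; apply/eqP.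
have h : 0 < (x + y).+1 * (x`! * y`!) by rewrite !muln_gt0 !fact_gt0.
by rewrite -(eqn_pmul2r h) e mulnCA.
Qed.
End HookShape.

Lemma reindex_rep (R : fieldType) (gT : finGroupType) (G : {group gT}) d e
    (rho : mx_representation R G d) (f : 'I_e -> 'I_d) : injective f -> e = d ->
  exists2 rho' : mx_representation R G e, mx_rsim rho' rho &
    forall g j l, rho' g j l = rho g (f j) (f l).
Proof.
move=> fi ed.
have E1 : rowsub f 1%:M *m colsub f 1%:M = 1%:M :> 'M[R]_e.
  rewrite -mxsub_mul mul1mx; apply/matrixP => i j; rewrite !mxE.
  by rewrite (inj_eq fi).
have E2 : colsub f 1%:M *m rowsub f 1%:M = 1%:M :> 'M[R]_d.
  by subst d; apply: mulmx1C.
have rr : mx_repr G (fun g => rowsub f 1%:M *m rho g *m colsub f 1%:M).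
  split=> [|x y Gx Gy]; first by rewrite repr_mx1 mulmx1.
  by rewrite repr_mxM // -!mulmxA (mulmxA (colsub f _)) E2 mul1mx !mulmxA.
exists (MxRepresentation rr) => [|g j l].
  exists (rowsub f 1%:M) => [//||x Gx].
    by apply/row_freeP; exists (colsub f 1%:M).
  by rewrite /= -!mulmxA E2 mulmx1.
by rewrite /= mul_rowsub_mx mul1mx mulmx_colsub mulmx1 !mxE.
Qed.

(** * Restricting hooks to size n - 1 *)

Section HookRestriction.
Variables (F : closedFieldType) (z : nat).
Local Notation n := z.+2.
Hypothesis hp : n \in [pchar F].
Variable sq : F -> F.
Hypothesis hsq : forall x, sq x ^+ 2 = x.
Variable k : nat.
Hypothesis k2n : (2 <= k <= n)%N.
Local Notation la := (k :: nseq (n - k) 1%N).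
Local Notation lam := (k.-1 :: nseq (n - k) 1%N).
Local Notation X := (@Xstd z.+1 la).

Lemma hook_la_part : is_part n la.
Proof.
have [k2 kn] := andP k2n; case: k k2 kn => [|x] // _ xn.
by rewrite -{1}(subnKC xn); apply: hook_part.
Qed.

Lemma hook_la_hookish : hookish la.
Proof. by have [k2 _] := andP k2n; case: k k2 => [|x] // _; apply: hook_hookish. Qed.

Lemma hook_lam_part : is_part z.+1 lam.
Proof.
have [k2 kn] := andP k2n; case: k k2 kn => [|[|x]] // _ xn.
have e : z.+1 = (x.+1 + (n - x.+2))%N by clear -xn; lia.
by rewrite {1}e; apply: hook_part.
Qed.

Lemma hook_rem : (nth 0%N la 1 < nth 0%N la 0)%N.
Proof. by have [k2 _] := andP k2n; apply: leq_ltn_trans hook_la_hookish k2. Qed.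

Lemma hook_dec : dec_part la 0 = lam.
Proof.
apply: (is_part_inj (dec_part_part hook_la_part hook_rem) hook_lam_part) => i.
rewrite (nth_dec_part hook_la_part hook_rem) /dec_nth.
by case: i => [|i] /=; rewrite ?subn1 ?subn0.
Qed.

(** For a hook, the tableaux kept in [Xstd] are those whose deletion of [n] shortens the first row,
    which identifies them with the standard tableaux of [lam]. *)
Lemma Xstd_last_row : X = last_row z la 0.
Proof.
apply/setP => T; rewrite !inE hook_la_hookish -[X in nd T X]/(nat_of_ord (@ord_max z.+1)) nd_ord.
by rewrite -val_eqE.
Qed.

Lemma restr_rhoi T i : T \in X -> (i.+1 < z.+1)%N -> rhoi F (restr T) i.+1 = rhoi F T i.+1.
Proof.
move=> /Xstd_std sT iz; rewrite !rhoiE /wtT !(nd_restr hook_la_part) //.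
exact: ltnW.
Qed.

Lemma restr_stab T U i : T \in X -> U \in X -> (i.+1 < z.+1)%N ->
  (restr U == stab i.+1 (restr T)) = (U == stab i.+1 T).
Proof.
move=> TX UX iz; have sT := Xstd_std TX; have sU := Xstd_std UX; have pla := hook_la_part.
have izn : (i.+1 < n)%N by apply: ltnW.
have iz' := ltnW iz.
apply/eqP/eqP => E; apply: nd_inj => j jn.
  move: jn; rewrite ltnS leq_eqVlt => /predU1P [->|jz].
    rewrite nd_stab // (gtn_eqF iz') (gtn_eqF iz) !(Xstd_arm pla _ _ hook_la_hookish) //.
  by rewrite -(nd_restr pla sU jz) E (nd_stab _ iz jz) (nd_stab _ izn (ltnW jz)) !(nd_restr pla).
by rewrite (nd_stab _ iz jn) !(nd_restr pla) // E (nd_stab _ izn (ltnW jn)).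
Qed.

Lemma hook_rep : exists2 rho : mx_representation F [set: 'S_n]%G #|Std z.+1 lam|,
  [/\ forall i, (1 <= i < z.+1)%N -> rho (sgen n i) = snf_mx sq z.+1 lam i,
      forall j : 'I_#|Std z.+1 lam|, nodeof (enum_val j) z.+1 = (0, k - 2)%N ->
        row j (rho (sgen n z.+1)) = delta_mx 0 j &
      forall j : 'I_#|Std z.+1 lam|, nodeof (enum_val j) z.+1 = (n - k, 0)%N ->
        row j (rho (sgen n z.+1)) = - delta_mx 0 j] &
  mx_rsim rho (Drep n F la).
Proof.
have [k2 kn] := andP k2n; have pla := hook_la_part; have hla := hook_la_hookish.
have ne : la != ones z.+1 by apply: contraTneq k2 => -[->].
have [rho snf sim] := D_snf hp hsq pla ne.
have surj (j : 'I_#|Std z.+1 lam|) : exists l : 'I_#|X|, restr (enum_val l) == enum_val j.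
  have [|T TL e] := restr_surj pla hook_rem (U := enum_val j).
    by rewrite hook_dec enum_valP.
  have TX : T \in X by rewrite Xstd_last_row.
  by exists (enum_rank_in TX T); rewrite enum_rankK_in // e.
have dE : #|Std z.+1 lam| = #|X|.
  by rewrite Xstd_last_row card_last_row ?hook_la_part // hook_rem hook_dec.
pose f j := xchoose (surj j).
have fP j : restr (enum_val (f j)) = enum_val j := eqP (xchooseP (surj j)).
have fX j : enum_val (f j) \in X := enum_valP (f j).
have fi : injective f by move=> j l e; apply: enum_val_inj; rewrite -!fP e.
have fE j l : (enum_val (f l) == enum_val (f j)) = (l == j) by rewrite (inj_eq enum_val_inj) (inj_eq fi).
have [rho' sim' E'] := reindex_rep rho fi dE.
exists rho'; last exact: mx_rsim_trans sim' sim.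
(* The last two entries have axial distance 1 or -1, so the square root vanishes and the last
   generator is diagonal. *)
have last j l : rho' (sgen n z.+1) j l = rhoi F (enum_val (f j)) z.+1 *+ (l == j).
  rewrite E' snf // mxE /= fE; case: eqP => // _.
  have -> : rhoi F (enum_val (f j)) z.+1 ^+ 2 = 1.
    have [lg|ar] := boolP (leg (enum_val (f j))).
      by rewrite (leg_rho hp pla hla (fX j) lg) sqrrN expr1n.
    by rewrite (arm_rho hp pla hla (fX j) ar) expr1n.
  by rewrite subrr (sq0 hsq) mulr0n; case: ifP.
have ndz j : nodeof (enum_val j) z.+1 = nd (enum_val (f j)) z.
  by rewrite -fP -(nd_restr pla (Xstd_std (fX j)) (ltnSn z)).
split.
- case=> // i /andP [_ iz]; apply/matrixP => j l; rewrite E' (snf _ (ltnW iz)) !mxE /= fE.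
  rewrite (inj_eq enum_val_inj) -(restr_stab (fX j) (fX l)) // -(restr_rhoi (fX j)) //.
  by rewrite !fP.
- move=> j; rewrite ndz => e; apply/rowP => l; rewrite !mxE eqxx last.
  by rewrite (arm_rho hp pla hla (fX j)) // /leg e.
- move=> j; rewrite ndz => e; apply/rowP => l; rewrite !mxE eqxx last.
  have [lg|ar] := boolP (leg (enum_val (f j))).
    by rewrite (leg_rho hp pla hla (fX j) lg) mulNrn.
  rewrite (arm_rho hp pla hla (fX j) ar) /=.
  (* If [n - 1] stands at [(n - k, 0)] without being in the leg, that node is the corner, so
     [k = n], and [n - 1] is the first entry. Then [n = 2], and in characteristic 2 the signs
     agree. *)
  have nk : k = n by move: ar kn; rewrite /leg e /=; clear; lia.
  have z0 : z = 0%N.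
    have := arm_nd hp pla hla (fX j) ar; rewrite e => -[_ /=].
    by rewrite nk.
  have c2 : 2%:R = 0 :> F by have := pcharf0 hp; rewrite z0.
  case: (l == j) => /=; rewrite ?oppr0 //.
  by apply/eqP; rewrite -subr_eq0 opprK -mulr2n c2.
Qed.

End HookRestriction.

Theorem theorem2p8 (F : closedFieldType) (p : nat) (hp : p \in [pchar F])
  (sq : F -> F) (hsq : forall x : F, sq x ^+ 2 = x) :
  [/\
  (* (1) non-hook partitions *)
  forall la : seq nat, is_part p la -> la != nseq p 1%N ->
    (forall k : nat, la != k :: nseq (p - k) 1%N) ->
    (exists rho : mx_representation F [set: 'S_p]%G #|Std p la|,
       (forall i : nat, (1 <= i < p)%N -> rho (sgen p i) = snf_mx sq p la i)
       /\ mx_rsim rho (Drep p F la))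
    /\ (Ddim p F la * hook_prod la)%N = p`!,
  (* (2) hooks (k, 1^(n-k)), k >= 2 *)
  forall k : nat, (2 <= k <= p)%N ->
    let la := k :: nseq (p - k) 1%N in
    let lam := k.-1 :: nseq (p - k) 1%N in
    (exists rho : mx_representation F [set: 'S_p]%G #|Std p.-1 lam|,
       [/\ forall i : nat, (1 <= i < p.-1)%N ->
             rho (sgen p i) = snf_mx sq p.-1 lam i,
           forall j : 'I_#|Std p.-1 lam|,
             nodeof (enum_val j) p.-1 = (0, k - 2)%N ->
             row j (rho (sgen p p.-1)) = delta_mx 0 j,
           forall j : 'I_#|Std p.-1 lam|,
             nodeof (enum_val j) p.-1 = (p - k, 0)%N ->
             row j (rho (sgen p p.-1)) = - delta_mx 0 j &
           mx_rsim rho (Drep p F la)])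
    /\ Ddim p F la = 'C(p - 2, k - 2) &
  (* (3) complete set of pairwise non-isomorphic irreducibles *)
  [/\ forall la : seq nat, is_part p la -> la != nseq p 1%N ->
        mx_irreducible (Drep p F la),
      forall la mu : seq nat, is_part p la -> is_part p mu ->
        la != nseq p 1%N -> mu != nseq p 1%N -> la != mu ->
        ~ mx_rsim (Drep p F la) (Drep p F mu) &
      forall (d : nat) (rG : mx_representation F [set: 'S_p]%G d),
        mx_irreducible rG ->
        exists la : seq nat,
          [/\ is_part p la, la != nseq p 1%N & mx_rsim rG (Drep p F la)]]].
Proof.
have pr := pcharf_prime hp; case: p => [|[|z]] // in hp pr *.
split.
- move=> la pla nla nhk.
  have hla : hookish la = false.
    by apply/negP => hla; case/eqP: (nhk (nth 0%N la 0)); apply: hookish_eq pla hla _.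
  have [rho snf sim] := D_snf hp hsq pla nla.
  (* Off hooks no tableau is discarded, so the module has the full standard basis. *)
  have XE : @Xstd z.+1 la = Std z.+2 la by apply/setP => T; rewrite inE hla andbT.
  move: rho snf sim; rewrite XE => rho snf sim; split.
    by exists rho; split => // -[//|i] /andP [_ ip]; apply: snf.
  by rewrite -(hook_length_formula pla); congr (_ * _)%N; case: sim.
- move=> k k2p la lam; have [rho [r1 r2 r3] sim] := hook_rep hp hsq k2p.
  split; first by exists rho.
  have -> : Ddim z.+2 F la = #|Std z.+1 lam| by case: sim.
  rewrite /lam; have [k2 kp] := andP k2p; case: k k2 kp {k2p la lam rho r1 r2 r3 sim} => [|[|x]] // _ kp.
  have zE : z = (x + (z.+2 - x.+2))%N by clear -kp; lia.
  by rewrite !subn2 /=; move: (_ - _)%N zE => y zE; subst z; apply: card_std_hook.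
- split=> [la pla nla|la mu pla pmu nla nmu ne sim|d rG irr].
  + exact: D_irr.
  + by case/eqP: ne; apply: D_not_rsim sim.
  + exact: (D_complete hp hsq irr).
Qed.
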